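(* Let $\Omega$ be a bounded open set in $\mathbb{R}^4$ and let $g$ be a nonnegative measurable function on $\Omega$. (1) (A sufficient condition) If $g\in\mathcal{M}\log L(\Omega)$, then $g$ is admissible. (2) (A necessary condition) In addition, let $\Omega$ be a ball centered at the origin and let $g$ be radial and radially decreasing. Then $g$ is admissible only if $g\in\mathcal{M}\log L(\Omega)$.
   Context: $\mathcal{D}^{2,2}_0(\Omega)$ denotes the completion of $C_c^\infty(\Omega)$ with respect to the norm $\|\Delta u\|_{L^2(\Omega)}$; for bounded $\Omega$ it coincides with the Sobolev space $H^2_0(\Omega)$. A function $g$ on $\Omega$ is called admissible if there is a constant $C>0$ such that $$\int_\Omega g(x)u^2\,dx\le C\int_\Omega|\Delta u|^2\,dx\qquad\text{for all }u\in\mathcal{D}^{2,2}_0(\Omega).$$ Let $|A|$ denote Lebesgue measure. For an extended real-valued measurable function $f$ on $\Omega$, finite a.e., let $\alpha_f(s)=|\{x\in\Omega:|f(x)|>s\}|$ for $s>0$, let $f^*(t)=\inf\{s>0:\alpha_f(s)<t\}$ for $t>0$ be its decreasing rearrangement, and let $f^{**}(t)=\frac1t\int_0^tf^*(s)\,ds$. Define $$\mathcal{M}\log L(\Omega)=\Big\{f\text{ measurable}:\ \sup_{0<t<|\Omega|}t\,\log\Big(\frac{|\Omega|}{t}\Big)f^{**}(t)<\infty\Big\}.$$ ''Radial and radially decreasing'' means that $g(x)$ depends only on $|x|$ and is a nonincreasing function of $|x|$. *)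

(* Defs.v *)
From HB Require Import structures.
From mathcomp Require Import all_boot all_order all_algebra.
From mathcomp Require Import all_classical all_reals all_analysis measurable_realfun.

Set Implicit Arguments.
Unset Strict Implicit.
Unset Printing Implicit Defensive.

Import Order.TTheory GRing.Theory Num.Theory.
Import numFieldNormedType.Exports.

Local Open Scope classical_set_scope.
Local Open Scope ring_scope.

(* R^4 is ((R * R) * R) * R.  Topologically this is the usual R^4, but the
   library norm on it is the sup norm; [enorm] is the Euclidean norm. *)
Notation R4 R := (R * R * R * R)%type.

Section Lebesgue4.
Variable R : realType.

Definition borel_leb4 : {measure set (R4 (measurableTypeR R)) -> \bar R} :=
  (@lebesgue_measure R \x @lebesgue_measure R \x @lebesgue_measure R
    \x @lebesgue_measure R)%E.

(* R^4 with the sigma-algebra of all Lebesgue (Caratheodory) measurable sets,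
   rather than that of Borel sets; [leb4] is the complete Lebesgue measure. *)
Definition R4L_display :=
  @caratheodory_display R (R4 (measurableTypeR R)) (borel_leb4^*)%mu.

Definition R4L : measurableType R4L_display :=
  caratheodory_type (borel_leb4^*)%mu.

Definition leb4 : {measure set R4L -> \bar R} :=
  @completed_measure_extension _ _ _ borel_leb4.

End Lebesgue4.

Section Defs.
Variable R : realType.
Implicit Types (Omega : set (R4 R)) (x : R4 R).

(* Lebesgue (not just Borel) measurability on Omega. *)
Definition lebesgue_measurable_fun d (T : measurableType d) Omega
    (f : R4 R -> T) : Prop :=
  @measurable_fun _ _ (R4L R) T Omega f.

Definition enorm x : R :=
  let: (x0, x1, x2, x3) := x in
  Num.sqrt (x0 ^+ 2 + x1 ^+ 2 + x2 ^+ 2 + x3 ^+ 2).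

Definition basis4 (i : 'I_4) : R4 R :=
  ((i == 0 :> nat)%:R, (i == 1 :> nat)%:R,
   (i == 2 :> nat)%:R, (i == 3 :> nat)%:R).

Definition partial (i : 'I_4) (f : R4 R -> R) : R4 R -> R :=
  fun x => 'D_(basis4 i) f x.

Definition laplacian (f : R4 R -> R) : R4 R -> R :=
  fun x => \sum_(i < 4) partial i (partial i f) x.

(* C^oo: every iterated partial derivative exists and is continuous. *)
Definition smooth (f : R4 R -> R) : Prop :=
  forall s : seq 'I_4, let h := foldr partial f s in
    continuous h /\ forall i x, derivable h x (basis4 i).

Definition test_function Omega (f : R4 R -> R) : Prop :=
  [/\ smooth f, compact (closure [set x | f x != 0])
    & closure [set x | f x != 0] `<=` Omega].

Definition sq_int Omega (f : R4 R -> R) : \bar R :=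
  (\int[leb4 R]_(x in (Omega : set (R4L R))) ((f x) ^+ 2)%:E)%E.

(* [D220 Omega u w]: [u] represents an element of the completion of
   C_c^oo(Omega) for the norm |Delta phi|_2, and [w] represents Delta u, i.e.
   the value at [u] of the continuous extension of the Laplacian to the
   completion, so that the norm of [u] is the L^2 norm of [w].
   This realisation of the completion inside L^2(Omega) is meant for bounded
   Omega, where phi_n converges in L^2(Omega) as soon as Delta phi_n does. *)
Definition D220 Omega (u w : R4 R -> R) : Prop :=
  [/\ lebesgue_measurable_fun Omega u,
      lebesgue_measurable_fun Omega w
    & exists phi : nat -> R4 R -> R,
      [/\ forall n, test_function Omega (phi n),
          sq_int Omega (fun x => phi n x - u x) @[n --> \oo] --> 0%E
        & sq_int Omega (fun x => laplacian (phi n) x - w x)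
            @[n --> \oo] --> 0%E] ].

Definition admissible Omega (g : R4 R -> \bar R) : Prop :=
  exists2 C : R, 0 < C & forall u w, D220 Omega u w ->
    (\int[leb4 R]_(x in (Omega : set (R4L R))) (g x * ((u x) ^+ 2)%:E)
      <= C%:E * sq_int Omega w)%E.

Definition alpha Omega (f : R4 R -> \bar R) (s : R) : \bar R :=
  leb4 R (Omega `&` [set x | (s%:E < `|f x|)%E]).

Definition rearr Omega (f : R4 R -> \bar R) (t : R) : \bar R :=
  ereal_inf [set s%:E | s in [set s : R | 0 < s /\ (alpha Omega f s < t%:E)%E]].

Definition rearr_avg Omega (f : R4 R -> \bar R) (t : R) : \bar R :=
  (t^-1%:E * \int[lebesgue_measure]_(s in `]0%R, t[) rearr Omega f s)%E.

(* Meant for |Omega| < +oo, because of [fine]. *)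
Definition MlogL Omega (f : R4 R -> \bar R) : Prop :=
  [/\ lebesgue_measurable_fun Omega f,
      {ae leb4 R, forall x, Omega x -> f x \is a fin_num}
    & (ereal_sup [set (t * ln (fine (leb4 R Omega) / t))%:E
                        * rearr_avg Omega f t
                 | t in [set t : R | (0 < t)%R /\ t%:E < leb4 R Omega]]
       < +oo)%E].

Definition centered_ball Omega : Prop :=
  exists2 r : R, 0 < r & Omega = [set x | enorm x < r].

Definition radial_decreasing Omega (g : R4 R -> \bar R) : Prop :=
  (forall x y, Omega x -> Omega y -> enorm x = enorm y -> g x = g y) /\
  (forall x y, Omega x -> Omega y -> enorm x <= enorm y -> (g y <= g x)%E).

End Defs.

(* Main.v *)
Require Import Defs.
From HB Require Import structures.
From mathcomp Require Import all_boot all_order all_algebra.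
From mathcomp Require Import all_classical all_reals all_analysis measurable_realfun.
From mathcomp Require Import ring lra.

(** The logarithm comes from the capacity of sets in dimension four: a function
    with compact support in Omega that is at least 1 on a set of measure m has
    energy \int |Laplacian f|^2 at least of order 1 / (1 + log (|Omega| / m)), and
    for small balls this order is attained.  So a weight is admissible when its
    mass on a set of measure m is O(1 / (1 + log (|Omega| / m))), and membership in
    M log L expresses this through the decreasing rearrangement.

    Sufficiency follows Hansson's proof of the capacitary strong type inequality.
    In dimension four |x|^-2 is a multiple of the fundamental solution of the
    Laplacian, so a test function is dominated by the potential of its Laplacian
    ([potential_bound]).  The composition of |x|^-2 with itself has only
    logarithmic growth, hence a set A of measure m inside Omega carries a constant
    density of total mass 1 / (1 + log (|Omega| / m)) whose double potential is
    bounded on Omega ([double_pot_le], [equilibrium_le]).  Let A_k be the set where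
    |f| exceeds lam 2^k.  Testing f against the sum of lam 2^k times these
    densities on the A_k, and using the theorem of Tonelli, the inequality of
    Young, and the bound of the double potentials for the cross terms, gives

      sum_k (lam 2^k)^2 / (1 + log (|Omega| / |A_k|)) <= C \int |Laplacian f|^2

    ([hansson]).  A dyadic decomposition of the integral of g f^2 and the bound of
    the integral of g over A_k then prove the weighted inequality for test
    functions ([weighted_le_test_function]).  It passes to the completion by
    truncating g and letting the level of truncation grow
    ([admissible_of_MlogL]); this is the place where finiteness of g almost
    everywhere is used.

    For necessity, one smooth bump is averaged over N dyadic scales, the largest
    being half the radius r of the ball ([log_bump]).  In dimension four the energy
    is invariant under dilations, and Laplacians living at different scales are almost
    orthogonal, so that the energy of the average is O(1 / N), whereas the average
    is bounded below on the ball of radius r 2^-(N+1).  Admissibility bounds the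
    mass of g on that ball by K / N ([admissible_mass]).  For g radially decreasing
    this mass controls the integral of the rearrangement over the interval from 0
    to the measure of the ball ([rearr_le_integral]), and the monotonicity of that
    integral interpolates between consecutive radii.

    Balls of the product norm on R^4 are cubes, of explicitly known measure, so
    the potential theoretic estimates use this norm; the Euclidean norm enters
    through its square, which is smooth. *)

Set Implicit Arguments.
Unset Strict Implicit.
Unset Printing Implicit Defensive.

Import Order.TTheory GRing.Theory Num.Theory.
Import numFieldNormedType.Exports.

Local Open Scope classical_set_scope.
Local Open Scope ring_scope.

(** * Measure on R^4 *)

Section product_measure_tools.
Context {R : realType} d1 d2 (T1 : measurableType d1) (T2 : measurableType d2).
Variable m1 : {sigma_finite_measure set T1 -> \bar R}.
Variable m2 : {sigma_finite_measure set T2 -> \bar R}.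
Local Open Scope ereal_scope.

Lemma sigma_finite_prod : sigma_finite setT (m1 \x m2).
Proof.
have /sigma_finiteP[F [TF ndF Foo]] := sigma_finiteT m1.
have /sigma_finiteP[G [TG ndG Goo]] := sigma_finiteT m2.
exists (fun n => F n `*` G n).
  rewrite -setXTT TF TG predeqE => -[x y]; split.
    move=> [/= [n _ Fnx] [k _ Gky]]; exists (maxn n k) => //; split.
    - by move: x Fnx; exact/subsetPset/ndF/leq_maxl.
    - by move: y Gky; exact/subsetPset/ndG/leq_maxr.
  by move=> [n _ []/= ? ?]; split; exists n.
move=> k; have [? ?] := Foo k; have [? ?] := Goo k.
split; first exact: measurableX.
by rewrite product_measure1E// lte_mul_pinfty// ge0_fin_numE.
Qed.

(** A copy of the product measure that carries its sigma-finiteness as a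
    structure, so that products can be iterated. *)
Definition sf_prod : set (T1 * T2) -> \bar R := (m1 \x m2).

HB.instance Definition _ := Measure.on sf_prod.
HB.instance Definition _ := Measure_isSigmaFinite.Build _ _ _ sf_prod
  sigma_finite_prod.

End product_measure_tools.

Section measure_preserving.
Context {R : realType}.
Local Open Scope ereal_scope.

Definition preserves d (T : measurableType d) (m : set T -> \bar R) (f : T -> T) :=
  measurable_fun setT f /\ forall A, measurable A -> m (f @^-1` A) = m A.

(** The image measure agrees with the product measure on rectangles, which
    determine it. *)
Lemma preserves_prod d1 d2 (T1 : measurableType d1) (T2 : measurableType d2)
    (m1 : {sigma_finite_measure set T1 -> \bar R})
    (m2 : {sigma_finite_measure set T2 -> \bar R}) f1 f2 :
  preserves m1 f1 -> preserves m2 f2 ->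
  preserves (sf_prod m1 m2) (fun z => (f1 z.1, f2 z.2)).
Proof.
move=> [mf1 pf1] [mf2 pf2].
have mf : measurable_fun setT (fun z : T1 * T2 => (f1 z.1, f2 z.2)).
  by apply/measurable_fun_pair; apply: measurableT_comp.
split=> // A mA; apply/esym.
pose m' : {measure set (T1 * T2) -> \bar R} :=
  measure_function_pushforward__canonical__measure_function_Measure (m1 \x m2) mf.
apply: (@product_measure_unique _ _ _ _ _ m1 m2 m') => // A1 A2 mA1 mA2.
rewrite -(pf1 _ mA1) -(pf2 _ mA2) -product_measure1E//.
- by rewrite -[_ @^-1` _]setTI; exact: mf1.
- by rewrite -[_ @^-1` _]setTI; exact: mf2.
Qed.

Lemma ge0_integral_preserves d (T : measurableType d)
    (m : {measure set T -> \bar R}) f (F : T -> \bar R) :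
  preserves m f -> measurable_fun setT F -> (forall x, 0 <= F x) ->
  \int[m]_x F (f x) = \int[m]_x F x.
Proof.
move=> [mf pf] mF F0.
rewrite -[LHS]/(\int[m]_(x in f @^-1` setT) ((F \o f) x)).
rewrite -(ge0_integral_pushforward mf m)//.
by apply: eq_measure_integral => A mA _; exact: pf.
Qed.

(** Translation maps half-open intervals to half-open intervals of the same
    length, and this characterises Lebesgue measure. *)
Lemma preserves_shift (a : R) :
  preserves (@lebesgue_measure R : set (measurableTypeR R) -> _) (fun x => (x + a)%R).
Proof.
have mf : measurable_fun [set: measurableTypeR R] (fun x : measurableTypeR R => (x + a)%R : measurableTypeR R).
  exact: measurable_funD.
split=> // A mA; apply/esym.
apply: (@lebesgue_measure_unique R (measure_function_pushforward__canonical__measure_function_Measure lebesgue_measure mf)) => //.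
move=> X [[x y] _ <-] /=.
rewrite /pushforward (_ : _ @^-1` _ = `]x - a, y - a]%classic)%R; last first.
  by apply/seteqP; split=> z /=; rewrite !in_itv/= ltrBlDr lerBrDr.
rewrite !lebesgue_measure_itv/= !lte_fin ltrD2r -!EFinB.
by case: ifP => // _; congr (_ %:E); ring.
Qed.

End measure_preserving.

Section leb4_borel.
Context {R : realType}.
Local Notation X4 := (R4 (measurableTypeR R)).
Local Open Scope ereal_scope.

(** The Borel measure [borel_leb4], built from [sf_prod] so that the theorem
    of Tonelli applies to it. *)
Definition mu4 : {sigma_finite_measure set X4 -> \bar R} :=
  sf_prod (sf_prod (sf_prod (@lebesgue_measure R) (@lebesgue_measure R))
    (@lebesgue_measure R)) (@lebesgue_measure R).

Lemma measurable_R4L (A : set X4) : measurable A ->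
  measurable (A : set (R4L R)).
Proof. by move=> mA; exact: caratheodory_measurable_mu_ext. Qed.

Lemma leb4E (A : set X4) : measurable A -> leb4 R A = mu4 A.
Proof. by move=> mA; exact: (measurable_mu_extE (borel_leb4 R)). Qed.

Lemma measurable_fun_R4L d (T : measurableType d) (A : set X4) (f : X4 -> T) :
  measurable A -> measurable_fun A f -> @measurable_fun _ _ (R4L R) T A f.
Proof.
by move=> mA mf _ Y mY; apply: measurable_R4L; exact: mf.
Qed.

(** Borel integrands may be integrated with respect to the Borel measure, a
    product measure, instead of its completion. *)
Lemma ge0_integral_leb4 (A : set X4) (f : X4 -> \bar R) :
  measurable A -> measurable_fun A f -> (forall x, A x -> 0 <= f x) ->
  \int[leb4 R]_(x in (A : set (R4L R))) f x = \int[mu4]_(x in A) f x.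
Proof.
move=> mA mf f0.
have mid : @measurable_fun _ _ (R4L R) X4 setT id.
  by move=> _ Y mY; rewrite setTI; exact: measurable_R4L.
have := ge0_integral_pushforward mid (leb4 R) mA mf.
rewrite preimage_id => <- //; last by move=> x /set_mem /f0.
apply: eq_measure_integral => B mB _; exact: leb4E.
Qed.

Lemma preserves4_shift (h : R4 R) : preserves mu4 (fun x : X4 => (x + h)%R : X4).
Proof.
have := preserves_prod (preserves_prod (preserves_prod (preserves_shift h.1.1.1)
  (preserves_shift h.1.1.2)) (preserves_shift h.1.2)) (preserves_shift h.2).
by congr (preserves mu4 _).
Qed.

Lemma ball4E (x : R4 R) r : ball x r =
  (ball x.1.1.1 r `*` ball x.1.1.2 r `*` ball x.1.2 r `*` ball x.2 r)%classic.
Proof. by []. Qed.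

Lemma measurable_ball4 (x : R4 R) r : measurable (ball x r : set X4).
Proof.
rewrite ball4E; do ![apply: measurableX]; exact: measurable_ball.
Qed.

Lemma mu4_ball (x : R4 R) r : (0 <= r)%R ->
  mu4 (ball x r) = ((r *+ 2) ^+ 4)%:E.
Proof.
move=> r0; rewrite ball4E.
have mb (y : R) : measurable (ball y r : set (measurableTypeR R)).
  exact: measurable_ball.
rewrite [LHS]product_measure1E; [|by do ![apply: measurableX]|by []].
rewrite [X in X * _]product_measure1E; [|by do ![apply: measurableX]|by []].
rewrite [X in X * _ * _]product_measure1E //.
transitivity ((r *+ 2)%:E * (r *+ 2)%:E * (r *+ 2)%:E * (r *+ 2)%:E).
  by congr (_ * _ * _ * _); exact: lebesgue_measure_ball.
by rewrite -!EFinM; congr (_%:E); ring.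
Qed.

(** An open set is the union of the countably many rational cubes that it
    contains; the product structure on R^4 is generated by rectangles. *)
Lemma open_measurable4 (U : set (R4 R)) : open U -> measurable (U : set X4).
Proof.
move=> oU.
pose I := (rat * rat * rat * rat * nat)%type.
pose c (i : I) : R4 R := (ratr i.1.1.1.1, ratr i.1.1.1.2, ratr i.1.1.2, ratr i.1.2).
pose e (i : I) : R := (i.2.+1%:R)^-1%R.
pose g n : I := odflt (0%R, 0%R, 0%R, 0%R, 0%N) (unpickle n).
have -> : U = \bigcup_(n in [set n | ball (c (g n)) (e (g n)) `<=` U])
    (ball (c (g n)) (e (g n)) : set (R4 R)).
  apply/seteqP; split=> [x Ux|x [i /= iU]]; last exact: iU.
  move: oU; rewrite openE => /(_ x Ux); rewrite /interior.
  case/nbhs_ballP => r /= r0 xrU.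
  have [n nr] : exists n : nat, ((n.+1%:R)^-1 + (n.+1%:R)^-1 < r)%R.
    have [n nr] := ltr_add_invr (y := 0) (x := (r / 2)%R) (divr_gt0 r0 (ltr0n _ 2)).
    exists n; move: nr; rewrite add0r.
    by move: (n.+1%:R^-1)%R => z; lra.
  have n0 : (0 < n.+1%:R^-1 :> R)%R by rewrite invr_gt0.
  have H (y d : R) : (0 < d)%R -> exists q : rat, ball y d (ratr q).
    move=> d0; have [|q] := @rat_in_itvoo R (y - d)%R (y + d)%R; first lra.
    rewrite in_itv/= => qy; exists q; rewrite -ball_normE /ball_/= ltr_norml.
    by move/andP: qy => [? ?]; apply/andP; split; lra.
  have [q1 h1] := H x.1.1.1 _ n0; have [q2 h2] := H x.1.1.2 _ n0.
  have [q3 h3] := H x.1.2 _ n0; have [q4 h4] := H x.2 _ n0.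
  have xc : ball x (n.+1%:R^-1) (c (q1, q2, q3, q4, n)) by rewrite ball4E.
  exists (pickle (q1, q2, q3, q4, n)); rewrite /= /g pickleK/=; last exact: ball_sym.
  move=> y /= cy; apply: xrU; apply: (@le_ball _ _ _ (n.+1%:R^-1 + n.+1%:R^-1)%R).
    exact: ltW.
  exact: ball_triangle xc cy.
apply: bigcup_measurable => n _; exact: measurable_ball4.
Qed.

Lemma continuous_measurable4 (f : R4 R -> R) :
  continuous f -> measurable_fun setT (f : X4 -> R).
Proof.
move=> /continuousP cf; apply: (measurability _ (RGenOpens.measurableE R)).
move=> _ [_ [a [b ->] <-]]; rewrite setTI; apply: open_measurable4.
exact/cf/interval_open.
Qed.

End leb4_borel.

(** * Directional derivatives and coordinates *)

Section lines.
Context {R : realType} {V : normedModType R}.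
Implicit Types (f : V -> R) (x v : V).

(** Directional derivatives are derivatives along lines, which gives access
    to the one-variable chain rule and mean value theorem. *)
Lemma derive_line f x v :
  'D_v f x = 'D_1 (fun t : R => f (t *: v + x)) (0 : R).
Proof.
rewrite /derive; set g1 := fun h => h^-1 *: _; set g2 := fun h => h^-1 *: _.
suff -> : g1 = g2 by [].
by apply/funext => t; rewrite /g1 /g2 /= [_%:A]mulr1 addr0 scale0r add0r.
Qed.

Lemma is_derive_line f x v (d : R) :
  is_derive (0 : R) (1 : R) (fun t : R => f (t *: v + x)) d <-> is_derive x v f d.
Proof.
split=> -[fd fE].
  by apply: DeriveDef; [exact/derivable1P|rewrite derive_line].
by apply: DeriveDef; [exact/(derivable1P f x v)|rewrite -derive_line].
Qed.

End lines.

Section directional_calculus.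
Context {R : realType}.
Implicit Types (f g : R4 R -> R) (x v : R4 R).

Lemma is_derive_line_at f x v (t d : R) :
  is_derive (t *: v + x) v f d ->
  is_derive t (1 : R) (fun s : R => f (s *: v + x)) d.
Proof.
move=> /is_derive_line H; apply/is_derive_line.
rewrite (_ : (fun _ => _) = (fun s : R => f (s *: v + (t *: v + x)))) //.
by apply/funext => s; rewrite [_%:A]mulr1 scalerDl addrA.
Qed.

Lemma is_derive_comp1 (h : R -> R) f x v (dh df : R) :
  is_derive (f x) (1 : R) h dh -> is_derive x v f df ->
  is_derive x v (fun y => h (f y)) (dh * df).
Proof.
move=> Hh /is_derive_line Hf; apply/is_derive_line.
apply: (@is_derive1_comp R h (fun t : R => f (t *: v + x))) => //.
by rewrite scale0r add0r.
Qed.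

Definition coord (i : 'I_4) x : R :=
  match val i with 0 => x.1.1.1 | 1 => x.1.1.2 | 2 => x.1.2 | _ => x.2 end.

Lemma coordD i x y : coord i (x + y) = coord i x + coord i y.
Proof. by case: i => -[|[|[|[|]]]]. Qed.

Lemma coordZ i (t : R) y : coord i (t *: y) = t * coord i y.
Proof. by case: i => -[|[|[|[|]]]]. Qed.

Lemma coordN i x : coord i (- x) = - coord i x.
Proof. by case: i => -[|[|[|[|]]]]. Qed.

Lemma coord_basis i j : coord j (basis4 R i) = (i == j)%:R.
Proof.
by case: i => -[|[|[|[|]]]] // ?; case: j => -[|[|[|[|]]]] // ?.
Qed.

Lemma continuous_coord i : continuous (coord i).
Proof.
have cf (U V : topologicalType) : continuous (fst : U * V -> U).
  by move=> [? ?]; exact: cvg_fst.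
have cs (U V : topologicalType) : continuous (snd : U * V -> V).
  by move=> [? ?]; exact: cvg_snd.
case: i => -[|[|[|[|]]]] // ? x; rewrite /coord/=.
- apply: (@continuous_comp _ _ _ fst (fst \o fst)); first exact: cf.
  by apply: (@continuous_comp _ _ _ fst fst); exact: cf.
- apply: (@continuous_comp _ _ _ fst (snd \o fst)); first exact: cf.
  by apply: (@continuous_comp _ _ _ fst snd); [exact: cf|exact: cs].
- by apply: (@continuous_comp _ _ _ fst snd); [exact: cf|exact: cs].
- exact: cs.
Qed.

Lemma is_derive_coord i j x : is_derive x (basis4 R i) (coord j) (i == j)%:R.
Proof.
apply/is_derive_line.
have -> : (fun t => coord j (t *: basis4 R i + x)) =
    (fun t : R => (i == j)%:R * t + coord j x).
  by apply/funext => t; rewrite coordD coordZ coord_basis mulrC.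
apply: is_derive_eq.
by rewrite addr0 -[_ *: _]/(_ * _) mulr1.
Qed.

(** The square of the Euclidean norm. *)
Definition sqnorm x : R := \sum_(i < 4) coord i x ^+ 2.

Lemma sqnormE x : sqnorm x = x.1.1.1 ^+ 2 + x.1.1.2 ^+ 2 + x.1.2 ^+ 2 + x.2 ^+ 2.
Proof. by rewrite /sqnorm !big_ord_recl big_ord0 /coord /= addr0 !addrA. Qed.

Lemma enormE x : enorm x = Num.sqrt (sqnorm x).
Proof. by rewrite sqnormE; case: x => [[[? ?] ?] ?]. Qed.

Lemma sqnorm_ge0 x : 0 <= sqnorm x.
Proof. by apply: sumr_ge0 => i _; exact: sqr_ge0. Qed.

Lemma continuous_sqnorm : continuous sqnorm.
Proof.
have -> : sqnorm = (fun y => \sum_(i < 4) (coord i y * coord i y)).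
  by apply/funext => y; apply: eq_bigr => i _; rewrite expr2.
apply: continuous_big => //=; first exact: add_continuous.
by move=> i _ x; apply: cvgM; exact: continuous_coord.
Qed.

Lemma is_derive_sqnorm i x : is_derive x (basis4 R i) sqnorm (2 * coord i x).
Proof.
have -> : sqnorm = \sum_(j < 4) (coord j ^+ 2).
  by apply/funext => y; rewrite /sqnorm fct_sumE; apply: eq_bigr => j _.
have H := @is_derive_sum R _ _ 4 (fun j => coord j ^+ 2) x (basis4 R i) _
  (fun j => @is_deriveX _ _ (coord j) 2 x _ _ (is_derive_coord i j x)).
apply: (is_derive_eq H); rewrite (bigD1 i)//= big1 ?addr0.
  by rewrite eqxx -[_ *: _]/(_ * _) mulr1 expr1.
by move=> j ji; rewrite eq_sym (negbTE ji) scaler0.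
Qed.

Lemma coord_le_norm i x : `|coord i x| <= `|x|.
Proof.
rewrite !prod_normE/= !le_max.
by case: i => -[|[|[|[|]]]] // ?; rewrite /coord/= lexx ?orbT.
Qed.

Lemma norm_le_coord x r : (forall i, `|coord i x| <= r) -> `|x| <= r.
Proof.
move=> H; rewrite !prod_normE/= !ge_max.
have h0 := H (@Ordinal 4 0 isT); have h1 := H (@Ordinal 4 1 isT).
have h2 := H (@Ordinal 4 2 isT); have h3 := H (@Ordinal 4 3 isT).
by rewrite h0 h1 h2 h3.
Qed.

Lemma sqr_norm_le_sqnorm x : `|x| ^+ 2 <= sqnorm x.
Proof.
suff : `|x| <= Num.sqrt (sqnorm x).
  by move=> /(lerXn2r 2 (normr_ge0 _) (sqrtr_ge0 _)) ; rewrite sqr_sqrtr// sqnorm_ge0.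
apply: norm_le_coord => i; rewrite -sqrtr_sqr ler_sqrt ?sqnorm_ge0//.
by rewrite /sqnorm (bigD1 i)//= lerDl; apply: sumr_ge0 => j _; exact: sqr_ge0.
Qed.

Lemma sqnorm_le_sqr_norm x : sqnorm x <= 4 * `|x| ^+ 2.
Proof.
have -> : 4 * `|x| ^+ 2 = \sum_(i < 4) `|x| ^+ 2 :> R.
  by rewrite sumr_const card_ord mulr_natl.
apply: ler_sum => i _; rewrite -real_normK ?num_real//.
by apply: lerXn2r; rewrite ?nnegrE//; exact: coord_le_norm.
Qed.

End directional_calculus.

(** * Integration by parts *)

Section test_functions.
Context {R : realType}.
Local Notation X4 := (R4 (measurableTypeR R)).
Implicit Types (f g F : R4 R -> R) (x v : R4 R).

Lemma smooth_continuous f : smooth f -> continuous f.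
Proof. by move=> /(_ [::]) []. Qed.

Lemma smooth_derive i f x : smooth f -> is_derive x (basis4 R i) f (partial i f x).
Proof. by move=> /(_ [::]) /= [_ fd]; exact/derivableP. Qed.

Lemma smooth_partial i f : smooth f -> smooth (partial i f).
Proof. by move=> sf s; have := sf (rcons s i); rewrite foldr_rcons. Qed.

Lemma bounded_set_lt (A : set (R4 R)) : bounded_set A ->
  exists2 r : R, 0 < r & forall x, A x -> `|x| < r.
Proof.
move=> [M [Mr H]]; exists (`|M| + 1); first by rewrite ltr_pwDr.
move=> x Ax; apply: (@le_lt_trans _ _ (`|M| + 2^-1)).
  apply: (H _ _ _ Ax); rewrite (le_lt_trans (ler_norm M))//; lra.
lra.
Qed.

Lemma bounded_compact_supp f (K : set (R4 R)) : continuous f -> compact K ->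
  (forall x, ~ K x -> f x = 0) -> exists2 M, 0 < M & forall x, `|f x| <= M.
Proof.
move=> cf cK f0.
have : compact (f @` K).
  by apply: continuous_compact => //; exact: continuous_subspaceT.
move=> /compact_bounded [M [Mr H]]; exists (`|M| + 1); first by rewrite ltr_pwDr.
move=> x; have [Kx|nKx] := pselect (K x).
  by apply: (H _ _ (f x)); [rewrite (le_lt_trans (ler_norm M))//; lra|exists x].
by rewrite f0// normr0 addr_ge0.
Qed.

Lemma partial_off_supp f i x :
  ~ closure [set y | f y != 0] x -> partial i f x = 0.
Proof.
move=> nx; have : open (~` closure [set y | f y != 0]).
  exact/closed_openC/closed_closure.
rewrite openE => /(_ x nx); rewrite /interior => nf.
rewrite /partial -(@derive_cst _ _ _ (0 : R) x (basis4 R i)).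
apply: near_eq_derive.
near=> y.
  have : (~` closure [set y | f y != 0]) y by near: y.
  move=> /= ny; apply/eqP; apply: contrapT => /negP fy; apply: ny.
  exact: subset_closure.
Unshelve. all: by end_near. Qed.

Lemma measurable_cst_ball (c : R) (x : R4 R) (r : R) :
  measurable_fun setT (fun y : X4 =>
    (c%:E * (\1_(ball x r : set X4) y)%:E)%E).
Proof.
apply: emeasurable_funM => //; apply/measurable_EFinP.
by apply: measurable_indic; exact: measurable_ball4.
Qed.

Lemma integral_cst_ball (c : R) (x : R4 R) (r : R) : 0 <= c -> 0 <= r ->
  (\int[mu4]_y (c%:E * (\1_(ball x r : set X4) y)%:E) = (c * (r *+ 2) ^+ 4)%:E)%E.
Proof.
move=> c0 r0; rewrite ge0_integralZl//; last first.
  apply/measurable_EFinP; apply: measurable_indic; exact: measurable_ball4.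
rewrite integral_indic//; last exact: measurable_ball4.
by rewrite setIT EFinM; congr (_ * _)%E; exact: mu4_ball.
Qed.

Lemma indic_ball (x y : R4 R) (r : R) : `|y - x| < r ->
  \1_(ball x r : set X4) (y : X4) = 1 :> R.
Proof.
move=> xy; rewrite indicE mem_set//.
by rewrite -ball_normE /ball_/= distrC.
Qed.

Lemma integrable_bounded f (r M : R) : measurable_fun setT (f : X4 -> R) ->
  (forall x, `|f x| <= M) ->
  (forall x, r <= `|x| -> f x = 0) -> mu4.-integrable setT (EFin \o (f : X4 -> R)).
Proof.
move=> mf fM f0; apply/integrableP; split; first exact/measurable_EFinP.
have M0 : 0 <= M by exact: le_trans (fM 0).
apply: (@le_lt_trans _ _ (\int[mu4]_x (M%:E * (\1_(ball (0 : R4 R) (Num.max r 0) : set X4) x)%:E))%E).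
  apply: ge0_le_integral => //.
  - by apply: measurableT_comp => //; exact/measurable_EFinP.
  - exact: measurable_cst_ball.
  - move=> x _ /=; rewrite -EFinM lee_fin indicE.
    have [xr|xr] := leP (Num.max r 0) `|x : R4 R|.
      rewrite f0 ?normr0 ?mulr_ge0//.
      by rewrite (le_trans _ xr)// le_max lexx.
    by rewrite mem_set ?mulr1// -ball_normE /ball_/= sub0r normrN.
by rewrite integral_cst_ball ?ltry// le_max lexx orbT.
Qed.

Lemma integral_shift F (h : R4 R) : continuous F ->
  (\int[mu4]_x (F (x + h) : R)%:E = \int[mu4]_x (F x)%:E)%E.
Proof.
move=> cF; rewrite [LHS]integralE [RHS]integralE.
have mF : measurable_fun setT (EFin \o (F : X4 -> R)).
  by apply/measurable_EFinP; exact: continuous_measurable4.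
congr (_ - _)%E.
  have := @ge0_integral_preserves R _ X4 mu4 _ (EFin \o F)^\+%E (preserves4_shift h).
  move=> /(_ (measurable_funepos mF)) H; etransitivity; [|exact: H].
  by apply: eq_integral => x _; rewrite !funeposE.
have := @ge0_integral_preserves R _ X4 mu4 _ (EFin \o F)^\-%E (preserves4_shift h).
move=> /(_ (measurable_funeneg mF)) H; etransitivity; [|exact: H].
by apply: eq_integral => x _; rewrite !funenegE.
Qed.

Lemma cvg_harmonic_dnbhs : @harmonic R n @[n --> \oo] --> 0^'.
Proof.
move=> A nA.
have H : \forall n \near \oo, harmonic n != 0 :> R -> A (harmonic n).
  exact: (@cvg_harmonic R (fun y => y != 0 -> A y) nA).
change (\forall n \near \oo, A (harmonic n)).
near=> n; have : harmonic n != 0 :> R -> A (harmonic n) by near: n.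
by apply; exact: lt0r_neq0 (harmonic_gt0 n).
Unshelve. all: by end_near. Qed.

(** The mean value theorem; this is the domination needed to differentiate
    under the integral sign. *)
Lemma diff_quotient_le F (i : 'I_4) M (x : R4 R) (t : R) : 0 < t ->
  (forall x, is_derive x (basis4 R i) F (partial i F x)) ->
  (forall x, `|partial i F x| <= M) ->
  `|t^-1 * (F (t *: basis4 R i + x) - F x)| <= M.
Proof.
move=> t0 dF FM; pose f (s : R) := F (s *: basis4 R i + x).
have df (s : R) : is_derive s (1 : R) f (partial i F (s *: basis4 R i + x)).
  exact: is_derive_line_at.
have [|s _] := MVT t0 (fun s _ => df s).
  apply: derivable_within_continuous => s _; exact: (@ex_derive _ _ _ _ _ _ _ (df s)).
rewrite {1 2}/f subr0 scale0r add0r => ->.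
by rewrite mulrA mulrAC mulVf ?gt_eqF// mul1r.
Qed.

(** By translation invariance all difference quotients have integral zero,
    and they converge boundedly to the derivative. This replaces integration
    by parts in one variable followed by the theorem of Fubini. *)
Lemma integral_partial_eq0 F (i : 'I_4) (r M : R) :
  continuous F -> continuous (partial i F) ->
  (forall x, is_derive x (basis4 R i) F (partial i F x)) ->
  (forall x, `|partial i F x| <= M) -> (forall x, `|F x| <= M) ->
  (forall x, r <= `|x| -> F x = 0) ->
  (\int[mu4]_x (partial i F x)%:E = 0)%E.
Proof.
move=> cF cdF dF dFM FM F0.
have M0 : 0 <= M by exact: le_trans (FM 0).
pose h n : R4 R := harmonic n *: basis4 R i.
pose q n (x : X4) : \bar R := ((harmonic n)^-1 * (F (h n + x) - F x))%:E.
have cFh n : continuous (fun x => F (h n + x)).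
  move=> x; apply: (@continuous_comp _ _ _ (fun x => h n + x) F); last exact: cF.
  by apply: cvgD; [exact: cvg_cst|exact: cvg_id].
have cq n : continuous (fun x => (harmonic n)^-1 * (F (h n + x) - F x)).
  move=> x; apply: cvgM; first exact: cvg_cst.
  by apply: cvgB; [exact: cFh|exact: cF].
have basis1 : `|basis4 R i| <= 1.
  by apply: norm_le_coord => j; rewrite coord_basis; case: eqP; rewrite ?normr1 ?normr0.
have hn n : `|h n| <= 1.
  rewrite normrZ -[leRHS]mulr1; apply: ler_pM => //.
  by rewrite ger0_norm ?harmonic_ge0//= invf_le1// ler1n.
have F0' n x : r + 1 <= `|x| -> F (h n + x) = 0.
  move=> rx; apply: F0.
  have := lerB_normD x (h n); have := hn n; rewrite (addrC (h n)); lra.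
have q0 n : (\int[mu4]_x q n x = 0)%E.
  rewrite /q; under eq_integral do rewrite EFinM EFinB.
  have i1 : mu4.-integrable setT (EFin \o (F : X4 -> R)).
    apply: (@integrable_bounded _ r M) => //; exact: continuous_measurable4.
  have i2 : mu4.-integrable setT (EFin \o (fun x : X4 => F (h n + x))).
    apply: (@integrable_bounded _ (r + 1) M) => //.
    - exact: continuous_measurable4.
    - by move=> x; exact: F0'.
  rewrite integralZl//; last exact: integrableB.
  rewrite integralB// (_ : \int[mu4]_x (F (h n + x))%:E = \int[mu4]_x (F x)%:E)%E.
    by rewrite subee ?mule0//; exact: integrable_fin_num.
  by under eq_integral do rewrite addrC; exact: integral_shift.
have [] := @dominated_convergence _ X4 R mu4 setT measurableT q
  (fun x => (partial i F x)%:E)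
  (fun x => (M%:E * (\1_(ball (0 : R4 R) (`|r| + 2) : set X4) x)%:E))%E.
- by move=> n; apply/measurable_EFinP; exact: continuous_measurable4.
- by apply/measurable_EFinP; exact: continuous_measurable4.
- apply: aeW => x _; apply: cvg_EFin; first by near=> n.
  rewrite /comp /q /=.
  have /cvg_ex[l Hl] := @ex_derive _ _ _ _ _ _ _ (dF x).
  have lE : partial i F x = l by exact: cvg_lim.
  rewrite lE.
  exact: (cvg_comp _ _ cvg_harmonic_dnbhs Hl).
- apply/integrableP; split; first exact: measurable_cst_ball.
  under eq_integral do rewrite gee0_abs ?mule_ge0//.
  by rewrite integral_cst_ball ?ltry// addr_ge0.
- apply: aeW => x n _; rewrite /q /=.
  have [xr|xr] := ltP `|x : R4 R| (`|r| + 2).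
    rewrite indic_ball ?subr0// mule1 lee_fin.
    by apply: diff_quotient_le => //; exact: harmonic_gt0.
  have rr := ler_norm r.
  rewrite F0' ?F0; [|lra|lra].
  by rewrite subr0 mulr0 normr0 lee_fin mulr_ge0.
by move=> _ _; under eq_fun do rewrite q0; move=> /cvg_lim <- //; exact: lim_cst.
Unshelve. all: by end_near. Qed.

End test_functions.

(** * Green's identity for a regularised fundamental solution *)

Section green.
Context {R : realType}.
Local Notation X4 := (R4 (measurableTypeR R)).
Implicit Types (f g F : R4 R -> R) (x y : R4 R).

Definition csmooth f := smooth f /\ compact (closure [set x | f x != 0]).

Lemma closure_sub_closed (A K : set (R4 R)) :
  closed K -> A `<=` K -> closure A `<=` K.
Proof. by move=> cK AK; rewrite [K](closure_id K).1//; exact: closureS. Qed.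

Lemma eq0_off_supp f x : ~ closure [set y | f y != 0] x -> f x = 0.
Proof.
move=> nx; apply/eqP; apply: contrapT => /negP fx; apply: nx; exact: subset_closure.
Qed.

Lemma compact_supp_integrable F (K : set (R4 R)) : continuous F -> compact K ->
  (forall x, ~ K x -> F x = 0) -> mu4.-integrable setT (EFin \o (F : X4 -> R)).
Proof.
move=> cF cK F0.
have [M M0 FM] := bounded_compact_supp cF cK F0.
have [r r0 Kr] := bounded_set_lt (compact_bounded cK).
apply: (@integrable_bounded _ F r M) => //; first exact: continuous_measurable4.
by move=> x rx; apply: F0 => /Kr; lra.
Qed.

Lemma csmooth_partial i f : csmooth f -> csmooth (partial i f).
Proof.
move=> [sf cf]; split; first exact: smooth_partial.
apply: subclosed_compact (cf) _; first exact: closed_closure.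
apply: closure_sub_closed => [|x]; first exact: closed_closure.
move=> /= /eqP dx; apply: contrapT => nx; apply: dx.
exact: partial_off_supp.
Qed.

Lemma partial2_off_supp i f x :
  ~ closure [set y | f y != 0] x -> partial i (partial i f) x = 0.
Proof.
move=> nx; apply: partial_off_supp => nx'; apply: nx; move: nx'.
apply: closure_sub_closed => [|z]; first exact: closed_closure.
move=> /= /eqP dz; apply: contrapT => nz; apply: dz; exact: partial_off_supp.
Qed.

Lemma laplacian_off_supp f x :
  ~ closure [set y | f y != 0] x -> laplacian f x = 0.
Proof. by move=> nx; rewrite /laplacian big1// => i _; exact: partial2_off_supp. Qed.

Lemma csmooth_bound f : csmooth f -> exists r M : R, [/\ 0 < r, 0 < M,
  forall x, `|f x| <= M & forall x, r <= `|x| -> f x = 0].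
Proof.
move=> [sf cf].
have [M M0 fM] := bounded_compact_supp (smooth_continuous sf) cf (@eq0_off_supp f).
have [r r0 Kr] := bounded_set_lt (compact_bounded cf).
exists r, M; split=> // x rx; apply: eq0_off_supp => /Kr; lra.
Qed.

Lemma csmooth_integrableM f g : csmooth f -> continuous g ->
  mu4.-integrable setT (EFin \o ((fun x => g x * f x) : X4 -> R)).
Proof.
move=> [sf cf] cg; apply: (compact_supp_integrable _ cf) => x.
  by apply: cvgM; [exact: cg|exact: smooth_continuous].
by move=> nx; rewrite (eq0_off_supp nx) mulr0.
Qed.

(** The integrand is the derivative of G times that of f minus f times that
    of G. *)
Lemma integral_partial2_swap f (i : 'I_4) (G G1 G2 : R4 R -> R) : csmooth f ->
  continuous G -> continuous G1 -> continuous G2 ->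
  (forall x, is_derive x (basis4 R i) G (G1 x)) ->
  (forall x, is_derive x (basis4 R i) G1 (G2 x)) ->
  (\int[mu4]_x (G x * partial i (partial i f) x - G2 x * f x)%:E = 0)%E.
Proof.
move=> cf cG cG1 cG2 dG dG1.
have cf1 := csmooth_partial i cf; have cf2 := csmooth_partial i cf1.
have c0 := smooth_continuous cf.1; have c1 := smooth_continuous cf1.1.
have c2 := smooth_continuous cf2.1.
pose F x := G x * partial i f x - G1 x * f x.
have dF x : is_derive x (basis4 R i) F
    (G x * partial i (partial i f) x - G2 x * f x).
  have Hf := smooth_derive i x cf.1; have Hf1 := smooth_derive i x cf1.1.
  have := is_deriveB (is_deriveM (dG x) Hf1) (is_deriveM (dG1 x) Hf).
  move=> H; apply: (is_derive_eq H).
  rewrite -![_ *: _]/(_ * _); ring.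
have pF x : partial i F x = G x * partial i (partial i f) x - G2 x * f x.
  by rewrite /partial (@derive_val _ _ _ _ _ _ _ (dF x)).
have cF : continuous F.
  by move=> x; apply: cvgB; apply: cvgM; [exact: cG|exact: c1|exact: cG1|exact: c0].
have cpF : continuous (partial i F).
  have -> : partial i F = fun x => G x * partial i (partial i f) x - G2 x * f x.
    exact/funext.
  by move=> x; apply: cvgB; apply: cvgM; [exact: cG|exact: c2|exact: cG2|exact: c0].
have F0 x : ~ closure [set y | f y != 0] x -> F x = 0.
  by move=> nx; rewrite /F (partial_off_supp _ nx) (eq0_off_supp nx) !mulr0 subr0.
have pF0 x : ~ closure [set y | f y != 0] x -> partial i F x = 0.
  by move=> nx; rewrite pF (eq0_off_supp nx) partial2_off_supp// !mulr0 subr0.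
have [M M0 FM] := bounded_compact_supp cF cf.2 F0.
have [N N0 FN] := bounded_compact_supp cpF cf.2 pF0.
have [r r0 Kr] := bounded_set_lt (compact_bounded cf.2).
under eq_integral do rewrite -pF.
apply: (@integral_partial_eq0 _ F i r (Num.max M N)) => //.
- by move=> x; rewrite le_max FN orbT.
- by move=> x; rewrite le_max FM.
- move=> x rx; apply: F0 => /Kr; lra.
Qed.

End green.

Section fundamental_solution.
Context {R : realType}.
Local Notation X4 := (R4 (measurableTypeR R)).
Variables (y : R4 R) (e : R).
Hypothesis e0 : 0 < e.
Implicit Types (x : R4 R).

(** The squared distance to y, shifted away from zero so that its negative
    powers are smooth. *)
Definition reg_sqdist x := sqnorm (x - y) + e ^+ 2.

Lemma reg_sqdist_gt0 x : 0 < reg_sqdist x.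
Proof. by rewrite ltr_wpDl ?sqnorm_ge0// exprn_gt0. Qed.

Lemma continuous_reg_sqdist : continuous reg_sqdist.
Proof.
move=> x; apply: cvgD; last exact: cvg_cst.
apply: (@continuous_comp _ _ _ (fun x => x - y) sqnorm); last exact: continuous_sqnorm.
by apply: cvgB; [exact: cvg_id|exact: cvg_cst].
Qed.

Lemma is_derive_reg_sqdist i x : is_derive x (basis4 R i) reg_sqdist (2 * coord i (x - y)).
Proof.
have /is_derive_line H := is_derive_sqnorm i (x - y).
apply/is_derive_line.
have -> : (fun t => reg_sqdist (t *: basis4 R i + x)) =
    (fun t : R => sqnorm (t *: basis4 R i + (x - y))) + cst (e ^+ 2).
  by apply/funext => t; rewrite /reg_sqdist -(addrA _ x).
by apply: is_derive_eq; rewrite addr0.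
Qed.

(** [fsol 1] regularises |x - y|^-2, which up to a constant is the
    fundamental solution of the Laplacian in dimension four. *)
Definition fsol n x := (reg_sqdist x) ^- n.

Lemma continuous_fsol n : continuous (fsol n).
Proof.
move=> x; apply: (@cvgV _ _ _ _ (fun x => reg_sqdist x ^+ n)).
  by rewrite expf_neq0// gt_eqF// reg_sqdist_gt0.
apply: (@continuous_comp _ _ _ reg_sqdist (fun s => s ^+ n)); first exact: continuous_reg_sqdist.
exact: exprn_continuous.
Qed.

Lemma is_derive_fsol i n x : is_derive x (basis4 R i) (fsol n.+1)
  (- (2 * n.+1%:R * coord i (x - y) * fsol n.+2 x)).
Proof.
have s0 : reg_sqdist x != 0 by rewrite gt_eqF// reg_sqdist_gt0.
have H : is_derive (reg_sqdist x) (1 : R) (fun s : R => s ^- n.+1) (- (n.+1%:R * (reg_sqdist x) ^- n.+2)).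
  have H1 : is_derive (reg_sqdist x) (1 : R) (fun s => s ^+ n.+1) (n.+1%:R *: (reg_sqdist x) ^+ n *: (1 : R)).
    by apply: DeriveDef; [exact: exprn_derivable|exact: exp_derive].
  apply: (is_derive_eq (is_deriveV _ H1)); first by rewrite expf_neq0.
  rewrite -![_ *: _]/(_ * _) /= !exprS expr0.
  by field; rewrite expf_neq0 ?s0.
have := is_derive_comp1 H (is_derive_reg_sqdist i x).
by move=> K; apply: (is_derive_eq K); rewrite /fsol; ring.
Qed.

Lemma is_derive_fsol2 i x : is_derive x (basis4 R i)
  (fun x => - (2 * coord i (x - y) * fsol 2 x))
  (8 * coord i (x - y) ^+ 2 * fsol 3 x - 2 * fsol 2 x).
Proof.
have H : is_derive x (basis4 R i) (fun x => coord i (x - y)) 1.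
  have -> : (fun x => coord i (x - y)) = coord i - cst (coord i y).
    by apply/funext => z; rewrite coordD coordN.
  have H := is_derive_coord i i x.
  by apply: is_derive_eq; rewrite eqxx subr0.
have := is_deriveZ (- 2) (is_deriveM H (is_derive_fsol i 1 x)).
rewrite (_ : _ \*: _ = (fun x => - (2 * coord i (x - y) * fsol 2 x))).
  move=> K; apply: (is_derive_eq K).
  rewrite -![_ *: _]/(_ * _); ring.
by apply/funext => z /=; rewrite -![_ *: _]/(_ * _) mulNr mulrA.
Qed.

(** For s = |x - y|^2 + e^2 the Laplacian of 1 / s is 8 |x - y|^2 / s^3 - 8 /
    s^2 = - 8 e^2 / s^3; the cancellation is particular to dimension four. *)
Lemma green_fsol f : csmooth f ->
  (\int[mu4]_x (fsol 1 x * laplacian f x + 8 * e ^+ 2 * fsol 3 x * f x)%:E = 0)%E.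
Proof.
move=> cf.
pose G1 i x := - (2 * coord i (x - y) * fsol 2 x).
pose G2 i x := 8 * coord i (x - y) ^+ 2 * fsol 3 x - 2 * fsol 2 x.
have cco i : continuous (fun x => coord i (x - y)).
  move=> x; apply: (@continuous_comp _ _ _ (fun x => x - y) (coord i)).
    by apply: cvgB; [exact: cvg_id|exact: cvg_cst].
  exact: continuous_coord.
have cG1 i : continuous (G1 i).
  move=> x; apply: cvgN; apply: cvgM; last exact: continuous_fsol.
  by apply: cvgM; [exact: cvg_cst|exact: cco].
have cG2 i : continuous (G2 i).
  move=> x; apply: cvgB; apply: cvgM.
  - apply: cvgM; [exact: cvg_cst|]; rewrite expr2.
    under eq_fun do rewrite expr2.
    by apply: cvgM; exact: cco.
  - exact: continuous_fsol.
  - exact: cvg_cst.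
  - exact: continuous_fsol.
have H i := @integral_partial2_swap R f i _ (G1 i) (G2 i) cf (@continuous_fsol 1) (cG1 i) (cG2 i).
have {}H i : (\int[mu4]_x (fsol 1 x * partial i (partial i f) x - G2 i x * f x)%:E = 0)%E.
  apply: H => x; last exact: is_derive_fsol2.
  by apply: is_derive_eq (is_derive_fsol i 0 x) _; rewrite /G1 mulr1.
have E x : fsol 1 x * laplacian f x + 8 * e ^+ 2 * fsol 3 x * f x =
   \sum_(i < 4) (fsol 1 x * partial i (partial i f) x - G2 i x * f x).
  rewrite big_split/= -mulr_sumr -[\sum_(i < 4) partial _ _ _]/(laplacian f x).
  congr (_ + _); rewrite sumrN -mulr_suml /G2 big_split/= -mulr_suml -mulr_sumr.
  rewrite -/(sqnorm (x - y)) sumr_const card_ord.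
  have -> : sqnorm (x - y) = reg_sqdist x - e ^+ 2 by rewrite /reg_sqdist addrK.
  rewrite /fsol; have := reg_sqdist_gt0 x; move: (reg_sqdist x) => s s0.
  by rewrite -mulNr -mulr_natl; congr (_ * _); field; rewrite gt_eqF.
under eq_integral do rewrite E -sumEFin.
rewrite integral_sum// => [|i].
  by rewrite big1// => i _; exact: H.
rewrite (_ : (fun _ => _) = (EFin \o (fun x : X4 => fsol 1 x * partial i (partial i f) x)%R)
   \- (EFin \o (fun x : X4 => G2 i x * f x)%R))%E; last exact/funext.
apply: integrableB => //; apply: csmooth_integrableM => //.
  by do 2 apply: csmooth_partial.
exact: continuous_fsol.
Qed.

End fundamental_solution.

(** * Test functions are dominated by Riesz potentials *)

Section riesz_kernel.
Context {R : realType}.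
Local Notation X4 := (R4 (measurableTypeR R)).
Implicit Types (f g F : R4 R -> R) (x y z : R4 R).

(** Inversion is not continuous at 0, but x / (x^2 + 1 / n) tends to the
    inverse of x everywhere, since the inverse of 0 is 0. *)
Lemma measurable_inv : measurable_fun setT (fun x : R => x^-1).
Proof.
have cq n : continuous (fun x : R => x / (x ^+ 2 + n.+1%:R^-1)).
  move=> x; have s0 : 0 < x ^+ 2 + n.+1%:R^-1 by rewrite ltr_wpDl// sqr_ge0.
  apply: cvgM; first exact: cvg_id.
  apply: (@cvgV _ _ _ _ (fun x : R => x ^+ 2 + n.+1%:R^-1)); first by rewrite gt_eqF.
  by apply: cvgD; [exact: exprn_continuous|exact: cvg_cst].
apply: (@measurable_fun_cvg _ (measurableTypeR R) R setT
    (fun n (x : R) => x / (x ^+ 2 + harmonic n))) => /=.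
  by move=> n; exact: continuous_measurable_fun.
move=> x _; have [->|x0] := eqVneq x 0.
  under eq_fun do rewrite mul0r.
  by rewrite invr0; exact: cvg_cst.
have -> : x^-1 = x / (x ^+ 2 + 0) by rewrite addr0; field.
apply: cvgM; first exact: cvg_cst.
apply: cvgV; first by rewrite addr0 expf_neq0.
by apply: cvgD; [exact: cvg_cst|exact: cvg_harmonic].
Qed.

Lemma measurable_normR4 : measurable_fun setT (fun z : X4 => `|(z : R4 R)|).
Proof. by apply: continuous_measurable4; exact: norm_continuous. Qed.

(** At the origin the value is 0 for p > 0. *)
Definition rpow (p : nat) z : R := `|z| ^- p.

Lemma measurable_rpow p : measurable_fun setT (rpow p : X4 -> R).
Proof.
by apply: (measurableT_comp measurable_inv); apply: measurable_funX;
  exact: measurable_normR4.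
Qed.

Lemma rpow_ge0 p z : 0 <= rpow p z.
Proof. by rewrite invr_ge0 exprn_ge0. Qed.

Lemma measurable_rpow_shift y : measurable_fun setT (fun x : X4 => rpow 2 (x - y)).
Proof. exact: (measurableT_comp (measurable_rpow 2) (preserves4_shift (- y)).1). Qed.

Lemma mu4_set1 y : measurable ([set y] : set X4) /\ mu4 [set y] = 0%E.
Proof.
case: y => [[[a b] c] d].
have -> : [set (a, b, c, d)] = ([set (a, b, c)] `*` [set d])%classic :> set X4.
  by apply/seteqP; split=> [[? ?] [-> ->]|[? ?] [/= -> ->]].
have m1 (z : R) : measurable ([set z] : set (measurableTypeR R)) by [].
have m3 : measurable ([set (a, b, c)] :
    set (measurableTypeR R * measurableTypeR R * measurableTypeR R)%type).
  rewrite (_ : [set _] = [set a] `*` [set b] `*` [set c])%classic.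
    by do ![apply: measurableX].
  by apply/seteqP; split=> [[[? ?] ?] [-> -> ->]|[[? ?] ?] [[/= -> ->] ->]].
split; first exact: measurableX.
rewrite [LHS]product_measure1E//.
by rewrite [X in (_ * X)%E]lebesgue_measure_set1 mule0.
Qed.

Lemma continuous_laplacian f : smooth f -> continuous (laplacian f).
Proof.
move=> sf; apply: continuous_big => //=; first exact: add_continuous.
by move=> i _; apply: smooth_continuous; do 2 apply: smooth_partial.
Qed.

Lemma fsol1_le_rpow2 y (e : R) x : x != y -> fsol y e 1 x <= rpow 2 (x - y).
Proof.
move=> xy; have n0 : 0 < `|x - y| by rewrite normr_gt0 subr_eq0.
rewrite /fsol expr1 /rpow lef_pV2 ?posrE ?exprn_gt0//.
  by rewrite /reg_sqdist (le_trans (sqr_norm_le_sqnorm _))// lerDl sqr_ge0.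
rewrite /reg_sqdist ltr_pwDl ?sqr_ge0//.
by rewrite (lt_le_trans _ (sqr_norm_le_sqnorm _))// exprn_gt0.
Qed.

Lemma fsol_ge0 y (e : R) n x : 0 <= fsol y e n x.
Proof. by rewrite invr_ge0 exprn_ge0// addr_ge0 ?sqnorm_ge0 ?sqr_ge0. Qed.

(** Multiply the identity of [green_fsol] by the sign of f y, and let s be
    the squared distance shifted by e^2. On the cube of radius e around y one
    has s <= 5 e^2, so the term 8 e^2 f / s^3 is at least 8 / 125 e^-4 times
    |f y| / 2, and the cube has measure 16 e^4: this is the left-hand side.
    Between e and d that term is nonnegative, and beyond d it is at most 8
    e^2 d^-6 |f|. *)
Lemma potential_bound_eps f y (d : R) : csmooth f -> 0 < d ->
  (forall x, `|x - y| < d -> `|f y| / 2 <= Num.sg (f y) * f x) ->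
  forall e : R, 0 < e -> e <= d ->
  ((64 / 125 * `|f y|)%:E <=
    \int[mu4]_x (rpow 2 (x - y) * `|laplacian f x|)%:E +
    (8 * e ^+ 2 * d ^- 6)%:E * \int[mu4]_x `|f x|%:E)%E.
Proof.
move=> cf d0 fd e e0 ed.
have cl := continuous_laplacian cf.1; have cf0 := smooth_continuous cf.1.
pose s := Num.sg (f y); pose eta := 8 * e ^+ 2 * d ^- 6.
have eta0 : 0 <= eta.
  by apply: mulr_ge0; [rewrite mulr_ge0// sqr_ge0|rewrite invr_ge0 exprn_ge0// ltW].
pose D x := fsol y e 1 x * laplacian f x + 8 * e ^+ 2 * fsol y e 3 x * f x.
pose c := 4 / 125 * e ^- 4 * `|f y|.
have c0 : 0 <= c.
  apply: mulr_ge0 => //; apply: mulr_ge0 => //.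
  by rewrite invr_ge0 exprn_ge0// ltW.
have cG n : continuous (fsol y e n) by exact: continuous_fsol.
have cD : continuous D.
  move=> x; apply: cvgD; apply: cvgM; [exact: cG|exact: cl| |exact: cf0].
  by apply: cvgM; [exact: cvg_cst|exact: cG].
have cGl : continuous (fun x => fsol y e 1 x * `|laplacian f x|).
  move=> x; apply: cvgM; first exact: cG.
  by apply: cvg_norm; exact: cl.
have pw x : c * \1_(ball y e : set X4) (x : X4) <=
    s * D x + (fsol y e 1 x * `|laplacian f x| + eta * `|f x|).
  have G0 := fsol_ge0 y e 1 x; have H0 := fsol_ge0 y e 3 x.
  set H := 8 * e ^+ 2 * fsol y e 3 x.
  have Hp : 0 <= H by rewrite /H mulr_ge0 // mulr_ge0 // sqr_ge0.
  have ns : `|s| <= 1.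
    by rewrite /s normr_sg; case: (_ != 0).
  have h1 : s * (fsol y e 1 x * laplacian f x) >= - (fsol y e 1 x * `|laplacian f x|).
    rewrite mulrCA -mulrN ler_wpM2l// lerNl -mulrN.
    rewrite (le_trans (ler_norm _))// normrM normrN.
    by rewrite -[leRHS]mul1r ler_wpM2r.
  suff h2 : c * \1_(ball y e : set X4) (x : X4) <= H * (s * f x) + eta * `|f x|.
    rewrite /D mulrDr (mulrCA s H) in h1 *; lra.
  have ef0 : 0 <= eta * `|f x| by rewrite mulr_ge0.
  have [xe|xe] := ltP `|x - y| e.
    rewrite indic_ball// mulr1.
    have fx : `|f y| / 2 <= s * f x by apply: fd; lra.
    have He : 8 / 125 * e ^- 4 <= H.
      have -> : 8 / 125 * e ^- 4 = 8 * e ^+ 2 * (5 * e ^+ 2) ^- 3.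
        by field; rewrite gt_eqF.
      rewrite /H; apply: ler_wpM2l; first by rewrite mulr_ge0// sqr_ge0.
      rewrite /fsol.
      have s0 := reg_sqdist_gt0 y e0 x.
      rewrite lef_pV2 ?posrE ?exprn_gt0 ?mulr_gt0 ?exprn_gt0//.
      apply: lerXn2r; [by rewrite nnegrE ltW|by rewrite nnegrE mulr_ge0// sqr_ge0|].
      have := sqnorm_le_sqr_norm (x - y).
      have : `|x - y| ^+ 2 <= e ^+ 2 by apply: lerXn2r; rewrite ?nnegrE// ltW.
      rewrite /reg_sqdist; lra.
    have e4 : 0 <= 8 / 125 * e ^- 4.
      by apply: mulr_ge0 => //; rewrite invr_ge0 exprn_ge0// ltW.
    have fy2 : 0 <= `|f y| / 2 by rewrite divr_ge0.
    by have := ler_pM e4 fy2 He fx; rewrite /c; lra.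
  have -> : \1_(ball y e : set X4) (x : X4) = 0 :> R.
    rewrite indicE memNset// -ball_normE /ball_/= => /=; rewrite distrC; lra.
  rewrite mulr0; have [xd|xd] := ltP `|x - y| d.
    rewrite addr_ge0// mulr_ge0//; apply: le_trans (fd _ xd).
    by rewrite divr_ge0.
  have He : H <= eta.
    rewrite /H /eta; apply: ler_wpM2l; first by rewrite mulr_ge0// sqr_ge0.
    rewrite /fsol.
    have s0 := reg_sqdist_gt0 y e0 x.
    rewrite lef_pV2 ?posrE ?exprn_gt0// (exprM d 2 3).
    apply: lerXn2r; [by rewrite nnegrE sqr_ge0|by rewrite nnegrE ltW|].
    rewrite /reg_sqdist (@le_trans _ _ (`|x - y| ^+ 2))//.
      by apply: lerXn2r; rewrite ?nnegrE// ltW.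
    by rewrite (le_trans (sqr_norm_le_sqnorm _))// lerDl sqr_ge0.
  have : - `|f x| <= s * f x.
    rewrite lerNl -mulrN (le_trans (ler_norm _))// normrM normrN.
    by rewrite -[leRHS]mul1r ler_wpM2r.
  move=> /(ler_wpM2l Hp); have := ler_wpM2r (normr_ge0 (f x)) He; lra.
have iD : mu4.-integrable setT (EFin \o (D : X4 -> R)).
  apply: (compact_supp_integrable cD cf.2) => x nx.
  by rewrite /D laplacian_off_supp// (eq0_off_supp nx) !mulr0 addr0.
have iG : mu4.-integrable setT (EFin \o (fun x : X4 => fsol y e 1 x * `|laplacian f x|)).
  apply: (compact_supp_integrable cGl cf.2) => x nx.
  by rewrite laplacian_off_supp// normr0 mulr0.
have iF : mu4.-integrable setT (EFin \o (fun x : X4 => `|f x|)).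
  apply: (compact_supp_integrable _ cf.2) => x.
    by apply: cvg_norm; exact: cf0.
  by move=> nx; rewrite (eq0_off_supp nx) normr0.
have iR : mu4.-integrable setT (fun x : X4 => (fsol y e 1 x * `|laplacian f x|)%:E + eta%:E * `|f x|%:E)%E.
  by apply: integrableD => //; exact: integrableZl.
have isD : mu4.-integrable setT (fun x : X4 => s%:E * (D x)%:E)%E.
  exact: integrableZl.
apply: (@le_trans _ _ (\int[mu4]_x (s%:E * (D x)%:E + ((fsol y e 1 x * `|laplacian f x|)%:E + eta%:E * `|f x|%:E))%E)%E).
  have -> : 64 / 125 * `|f y| = c * (e *+ 2) ^+ 4.
    by rewrite /c -[e *+ 2]mulr_natl; field; rewrite gt_eqF.
  rewrite -(integral_cst_ball y c0 (ltW e0)).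
  apply: le_integral => //.
  - apply/integrableP; split; first exact: measurable_cst_ball.
    under eq_integral do rewrite gee0_abs ?mule_ge0//.
    by rewrite integral_cst_ball ?ltry// ltW.
  - exact: integrableD.
  - move=> x _; rewrite -!EFinM -!EFinD lee_fin; exact: pw.
rewrite integralD//.
rewrite integralZl// green_fsol// mule0 add0e.
rewrite integralD//; last exact: integrableZl.
rewrite integralZl//; apply: leeD => //.
apply: ae_ge0_le_integral => //.
- by move=> x _; rewrite lee_fin mulr_ge0// fsol_ge0.
- by apply/measurable_EFinP; exact: continuous_measurable4.
- by move=> x _; rewrite lee_fin mulr_ge0// rpow_ge0.
- apply/measurable_EFinP; apply: measurable_funM.
    exact: measurable_rpow_shift.
  by apply: continuous_measurable4 => x; apply: cvg_norm; exact: cl.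
- exists [set y]; split; [exact: (mu4_set1 y).1|exact: (mu4_set1 y).2|].
  move=> x /= H; apply: contrapT => xy; apply: H => _.
  rewrite lee_fin ler_wpM2r// fsol1_le_rpow2//; exact/eqP.
Qed.

(** The error term of [potential_bound_eps] vanishes with e; any e for which
    it is at most |f y| / 100 gives the constant 1 / 2, since 64 / 125 > 1 /
    2 + 1 / 100. *)
Lemma potential_bound f y : csmooth f ->
  ((`|f y| / 2)%:E <= \int[mu4]_x (rpow 2 (x - y) * `|laplacian f x|)%:E)%E.
Proof.
move=> cf; have cf0 := smooth_continuous cf.1.
have I0 : (0 <= \int[mu4]_x (rpow 2 (x - y) * `|laplacian f x|)%:E)%E.
  by apply: integral_ge0 => x _; rewrite lee_fin mulr_ge0// rpow_ge0.
have [fy0|fy0] := eqVneq (f y) 0; first by rewrite fy0 normr0 mul0r.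
have nf : 0 < `|f y| by rewrite normr_gt0.
have [d d0 fd] : exists2 d, 0 < d &
    forall x, `|x - y| < d -> `|f y| / 2 <= Num.sg (f y) * f x.
  have h0 : 0 < `|f y| / 2 by rewrite divr_gt0.
  have := cf0 y => /cvgrPdist_lt /(_ _ h0) /nbhs_ballP [d /= d0 Hd].
  exists d => // x xd; have /= := Hd x; rewrite -ball_normE /ball_/= distrC => /(_ xd).
  rewrite ltr_norml => /andP[h1 h2].
  case: (ltgtP (f y) 0) fy0 => // fy _.
    by rewrite ltr0_sg// ltr0_norm// in h1 h2 *; lra.
  by rewrite gtr0_sg// gtr0_norm// in h1 h2 *; lra.
have [N N0 NE] : exists2 N, 0 <= N & (\int[mu4]_x `|f x|%:E = N%:E)%E.
  have iF : mu4.-integrable setT (EFin \o (fun x : X4 => `|f x|)).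
    apply: (compact_supp_integrable _ cf.2) => x.
      by apply: cvg_norm; exact: cf0.
    by move=> nx; rewrite (eq0_off_supp nx) normr0.
  have fin := integrable_fin_num measurableT iF.
  exists (fine (\int[mu4]_x `|f x|%:E)); last by rewrite fineK.
  by apply: fine_ge0; apply: integral_ge0.
(* The third bound makes the error term at most |f y| / 100. *)
pose e := Num.min (Num.min d 1) (`|f y| * d ^+ 6 / (8 * 100 * (N + 1))).
have d6 : 0 < d ^+ 6 by rewrite exprn_gt0.
have N1 : 0 < N + 1 by lra.
have e0 : 0 < e.
  rewrite !lt_min d0 ltr01 andTb; have c0 : (0 : R) < 8 * 100 by lra.
  by apply: divr_gt0; exact: mulr_gt0.
have ed : e <= d by rewrite !ge_min lexx.
have e1 : e <= 1 by rewrite !ge_min lexx orbT.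
have e2 : e <= `|f y| * d ^+ 6 / (8 * 100 * (N + 1)) by rewrite !ge_min lexx !orbT.
have := potential_bound_eps cf d0 fd e0 ed.
rewrite NE -EFinM; case: (\int[mu4]_x _)%E I0 => [v|_ _|//]; last exact: leey.
rewrite lee_fin => v0; rewrite -EFinD !lee_fin.
suff : 8 * e ^+ 2 * d ^- 6 * N <= `|f y| / 100 by lra.
have : 8 * e ^+ 2 * d ^- 6 * N <= 8 * e * d ^- 6 * (N + 1).
  have d6' : 0 <= d ^- 6 by rewrite invr_ge0 ltW.
  apply: ler_pM => //; last by rewrite lerDl.
    by apply: mulr_ge0 => //; rewrite mulr_ge0// sqr_ge0.
  apply: ler_wpM2r => //; apply: ler_wpM2l => //.
  by rewrite expr2 -[leRHS]mulr1 ler_wpM2l// ltW.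
move=> /le_trans; apply; rewrite ler_pdivlMr ?mulr_gt0// in e2.
have -> : 8 * e * d ^- 6 * (N + 1) = (e * (8 * 100 * (N + 1))) / (100 * d ^+ 6).
  by field; rewrite gt_eqF.
rewrite ler_pdivrMr ?mulr_gt0//.
have -> : `|f y| / 100 * (100 * d ^+ 6) = `|f y| * d ^+ 6 by field.
exact: e2.
Qed.

End riesz_kernel.

(** * Convolution potentials and radial integrals *)

Section potentials.
Context {R : realType}.
Local Notation X4 := (R4 (measurableTypeR R)).
Implicit Types (c F G : X4 -> \bar R) (x y z : R4 R).
Local Open Scope ereal_scope.

(** For even c this is the convolution of c and F. *)
Definition pot c F z := \int[mu4]_x (c (x - z)%R * F x).

Lemma measurable_sub4 :
  measurable_fun setT (fun p : X4 * X4 => (p.2 - p.1)%R : X4).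
Proof.
have mf (i : X4 * X4 -> X4) : measurable_fun setT i -> [/\
    measurable_fun setT (fun p => (i p).1.1.1), measurable_fun setT (fun p => (i p).1.1.2),
    measurable_fun setT (fun p => (i p).1.2) & measurable_fun setT (fun p => (i p).2)].
  move=> mi; split; by do ![apply: measurableT_comp => //].
have [a1 a2 a3 a4] := mf _ (measurable_fst : measurable_fun setT (@fst X4 X4)).
have [b1 b2 b3 b4] := mf _ (measurable_snd : measurable_fun setT (@snd X4 X4)).
apply/measurable_fun_pair => /=; last exact: measurable_funB.
apply/measurable_fun_pair => /=; last exact: measurable_funB.
by apply/measurable_fun_pair => /=; exact: measurable_funB.
Qed.

Lemma measurable_pot_integrand c F : measurable_fun setT c -> measurable_fun setT F ->
  measurable_fun setT (fun p : X4 * X4 => c (p.2 - p.1)%R * F p.2).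
Proof.
move=> mc mF; apply: emeasurable_funM.
  exact: (measurableT_comp mc measurable_sub4).
exact: (measurableT_comp mF measurable_snd).
Qed.

Lemma measurable_pot c F : measurable_fun setT c -> (forall x, 0 <= c x) ->
  measurable_fun setT F -> (forall x, 0 <= F x) ->
  measurable_fun setT (pot c F : X4 -> _).
Proof.
move=> mc c0 mF F0.
apply: (@measurable_fun_fubini_tonelli_F _ _ X4 X4 R mu4
  (fun p => c (p.2 - p.1)%R * F p.2)).
  exact: measurable_pot_integrand.
by move=> p; rewrite mule_ge0.
Qed.

Lemma pot_ge0 c F z : (forall x, 0 <= c x) -> (forall x, 0 <= F x) -> 0 <= pot c F z.
Proof. by move=> c0 F0; apply: integral_ge0 => x _; rewrite mule_ge0. Qed.

(** Convolution with an even kernel is a symmetric operator, by the theorem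
    of Tonelli. *)
Lemma pot_swap c F G : measurable_fun setT c -> (forall x, 0 <= c x) ->
  (forall x, c (- x)%R = c x) ->
  measurable_fun setT F -> (forall x, 0 <= F x) ->
  measurable_fun setT G -> (forall x, 0 <= G x) ->
  \int[mu4]_z (G z * pot c F z) = \int[mu4]_x (F x * pot c G x).
Proof.
move=> mc c0 cN mF F0 mG G0.
have mcx x : measurable_fun setT (fun y : X4 => c (y - x)%R).
  exact: (measurableT_comp mc (preserves4_shift (- x)%R).1).
transitivity (\int[mu4]_z \int[mu4]_x (G z * (c (x - z)%R * F x))).
  apply: eq_integral => z _; rewrite /pot ge0_integralZl//.
    exact: emeasurable_funM.
  by move=> x _; rewrite mule_ge0.
rewrite (@fubini_tonelli _ _ X4 X4 R mu4 mu4 (fun p => G p.1 * (c (p.2 - p.1)%R * F p.2))).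
- apply: eq_integral => x _ /=; rewrite /pot -ge0_integralZl//.
  + apply: eq_integral => z _; rewrite -(cN (z - x)%R) opprB.
    by rewrite !muleA (muleC (G z)) muleC muleA.
  + exact: emeasurable_funM.
  + by move=> z _; rewrite mule_ge0.
- apply: emeasurable_funM; first exact: (measurableT_comp mG measurable_fst).
  exact: measurable_pot_integrand.
- by move=> p; rewrite !mule_ge0.
Qed.

Lemma pot1 c z : measurable_fun setT c -> (forall x, 0 <= c x) ->
  \int[mu4]_x c (x - z)%R = \int[mu4]_x c x.
Proof.
by move=> mc c0; exact: (ge0_integral_preserves (preserves4_shift (- z)%R) mc c0).
Qed.

(** Symmetry applied to the constant function 1, whose potential is constant. *)
Lemma pot_total c F : measurable_fun setT c -> (forall x, 0 <= c x) ->
  (forall x, c (- x)%R = c x) ->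
  measurable_fun setT F -> (forall x, 0 <= F x) ->
  \int[mu4]_z (pot c F z) = (\int[mu4]_x F x) * \int[mu4]_x c x.
Proof.
move=> mc c0 cN mF F0.
have p1 x : pot c (cst 1) x = \int[mu4]_x c x.
  by rewrite -(pot1 x)//; apply: eq_integral => z _; rewrite mule1.
rewrite -[LHS]/(\int[mu4]_z pot c F z).
transitivity (\int[mu4]_z (cst 1 z * pot c F z)).
  by apply: eq_integral => z _; rewrite mul1e.
rewrite (@pot_swap c F (cst 1) mc c0 cN mF F0 (measurable_cst _) (fun=> lee01)).
under eq_integral do rewrite p1.
by apply: ge0_integralZr => //; exact: integral_ge0.
Qed.

End potentials.

Section shells.
Context {R : realType}.
Local Notation X4 := (R4 (measurableTypeR R)).
Implicit Types (x y z : R4 R) (r s : R).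

Definition shell r s : set X4 := [set z : X4 | r <= `|(z : R4 R)| < s].

Lemma measurable_shell r s : measurable (shell r s).
Proof.
rewrite (_ : shell r s = (fun z : X4 => `|(z : R4 R)|) @^-1` `[r, s[%classic).
  by rewrite -[_ @^-1` _]setTI; exact: measurable_normR4.
by apply/seteqP; split=> z; rewrite /= in_itv.
Qed.

(** The kernel is at most its value on the inner sphere, and the shell lies
    in a cube of side 2 s. *)
Lemma integral_shell_le p r s : 0 < r -> r <= s ->
  (\int[mu4]_(z in shell r s) (rpow p z)%:E <= (r ^- p * (2 * s) ^+ 4)%:E)%E.
Proof.
move=> r0 rs; have s0 : 0 <= s by lra.
apply: (@le_trans _ _ (\int[mu4]_(z in shell r s) (r ^- p)%:E)%E).
  apply: ge0_le_integral => //.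
  - exact: measurable_shell.
  - by move=> z _; rewrite lee_fin rpow_ge0.
  - apply/measurable_EFinP; apply: measurable_funTS; exact: measurable_rpow.
  - move=> z /= /andP[rz zs]; rewrite lee_fin /rpow lef_pV2 ?posrE ?exprn_gt0//.
      by apply: lerXn2r => //; rewrite nnegrE// ltW.
    lra.
rewrite integral_cst; last exact: measurable_shell.
rewrite EFinM; apply: lee_wpmul2l; first by rewrite lee_fin invr_ge0 exprn_ge0// ltW.
rewrite (mulr_natl s 2) -(mu4_ball 0)//; apply: le_measure; rewrite ?inE.
- exact: measurable_shell.
- exact: measurable_ball4.
- by move=> z /= /andP[_ zs]; rewrite -ball_normE /ball_/= sub0r normrN.
Qed.

Lemma integral_shellD p r s t : r <= s -> s <= t ->
  (\int[mu4]_(z in shell r t) (rpow p z)%:E =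
   \int[mu4]_(z in shell r s) (rpow p z)%:E + \int[mu4]_(z in shell s t) (rpow p z)%:E)%E.
Proof.
move=> rs st; rewrite -ge0_integral_setU.
- congr integral; apply/seteqP; split=> z /=.
    by move=> /andP[rz zt]; have [zs|sz] := ltP `|z : R4 R| s;
      [left; apply/andP|right; apply/andP].
  by move=> [] /andP[h1 h2]; apply/andP; split => //; lra.
- exact: measurable_shell.
- exact: measurable_shell.
- by apply/measurable_EFinP; apply: measurable_funTS; exact: measurable_rpow.
- by move=> z _; rewrite lee_fin rpow_ge0.
- apply/disj_setPS => z [] /= /andP[_ h1] /andP[h2 _].
  by move: (lt_le_trans h1 h2); rewrite ltxx.
Qed.

(** The shells of ratio 2 contribute a geometric series; the induction needs
    the partial sums of that series in the bound. *)
Lemma integral_dyadic_shell r n : 0 < r ->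
  (\int[mu4]_(z in shell (r / 2 ^+ n) r) (rpow 2 z)%:E <= (2 ^+ 7 * r ^+ 2)%:E)%E.
Proof.
move=> r0; suff : (\int[mu4]_(z in shell (r / 2 ^+ n) r) (rpow 2 z)%:E <=
    (2 ^+ 7 * r ^+ 2 * (1 - 4 ^- n))%:E)%E.
  move=> /le_trans; apply; rewrite lee_fin -[leRHS]mulr1; apply: ler_wpM2l.
    by rewrite mulr_ge0 ?sqr_ge0// exprn_ge0.
  by rewrite gerBl invr_ge0 exprn_ge0.
elim: n => [|n IH].
  rewrite !expr0 invr1 subrr mulr0 mulr1 (_ : shell r r = set0) ?integral_set0//.
  by apply/seteqP; split=> z //= /andP[h1 h2]; move: (le_lt_trans h1 h2); rewrite ltxx.
have e2 : 0 < r / 2 ^+ n by rewrite divr_gt0// exprn_gt0.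
have e2' : 0 < r / 2 ^+ n.+1 by rewrite divr_gt0// exprn_gt0.
have e3 : r / 2 ^+ n = 2 * (r / 2 ^+ n.+1) by rewrite exprS; field; rewrite expf_neq0.
rewrite (@integral_shellD _ _ (r / 2 ^+ n)); [|lra|]; last first.
  have p1 : 1 <= 2 ^+ n :> R by apply: exprn_ege1; rewrite ler1n.
  rewrite ler_pdivrMr ?exprn_gt0//; nra.
apply: le_trans (leeD _ IH) _; first by apply: integral_shell_le => //; lra.
rewrite -EFinD lee_fin.
have -> : (r / 2 ^+ n.+1) ^- 2 * (2 * (r / 2 ^+ n)) ^+ 4 = 64 * r ^+ 2 * 4 ^- n.
  have -> : 4 ^+ n = 2 ^+ n * 2 ^+ n :> R by rewrite -exprMn; congr (_ ^+ _); lra.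
  rewrite (exprS 2 n); field; rewrite expf_neq0 ?gt_eqF//.
have -> : 4 ^- n.+1 = 4 ^- n / 4 :> R by rewrite exprS invfM mulrC.
have : 0 <= r ^+ 2 * 4 ^- n by rewrite mulr_ge0 ?sqr_ge0// invr_ge0 exprn_ge0.
lra.
Qed.

Lemma integral_riesz_ball r : 0 < r ->
  (\int[mu4]_(z in shell 0 r) (rpow 2 z)%:E <= (2 ^+ 7 * r ^+ 2)%:E)%E.
Proof.
move=> r0.
pose U := \bigcup_n shell (r / 2 ^+ n) r.
have nd : {homo (fun n => shell (r / 2 ^+ n) r) : n m / (n <= m)%N >-> (n <= m)%O}.
  move=> n m nm; apply/subsetPset => z /= /andP[h1 h2]; apply/andP; split => //.
  apply: le_trans h1; apply: ler_wpM2l; first exact: ltW.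
  rewrite lef_pV2 ?posrE ?exprn_gt0//.
  by rewrite ler_weXn2l// ler1n.
have mf A : measurable_fun A (EFin \o (rpow 2 : X4 -> R)).
  by apply/measurable_EFinP; apply: measurable_funTS; exact: measurable_rpow.
have f0 z : (0 <= (rpow 2 z)%:E)%E by rewrite lee_fin rpow_ge0.
have UE : shell 0 r = U `|` [set 0 : R4 R].
  apply/seteqP; split=> z; last first.
    move=> [[n _ /andP[h1 h2]]|->]; apply/andP; split => //.
    by rewrite [ltLHS]normr0.
  move=> /andP[_ zr].
  have [->|z0] := eqVneq (z : R4 R) 0; first by right.
  left; have nz : 0 < `|z : R4 R| by rewrite normr_gt0.
  exists (Num.trunc (r / `|z : R4 R|)).+1 => //=; apply/andP; split => //.
  have rz : 0 <= r / `|z : R4 R| by rewrite divr_ge0 ?ltW.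
  have /andP[_] := truncn_itv rz; set n := (Num.trunc _).+1 => h.
  rewrite ler_pdivrMr ?exprn_gt0// mulrC -ler_pdivrMr//.
  apply: (le_trans (ltW h)); rewrite -natrX ler_nat.
  by rewrite ltnW// ltn_expl.
rewrite UE ge0_integral_setU//.
- rewrite [X in (_ + X)%E]integral0_eq ?adde0; last first.
    by move=> z /= ->; rewrite /rpow normr0 expr0n invr0.
  have := @ge0_nondecreasing_set_cvg_integral _ X4 R _ (EFin \o (rpow 2)) mu4 nd
    (fun n => measurable_shell _ _) (fun n => mf _) (fun n z _ => f0 z).
  move=> H; rewrite -(cvg_lim _ H)//; apply: lime_le; first by apply/cvg_ex; eexists; exact: H.
  by apply: nearW => n; exact: integral_dyadic_shell.
- by apply: bigcup_measurable => n _; exact: measurable_shell.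
- exact: (mu4_set1 0).1.
- apply/disj_setPS => z [[n _ /= /andP[h _]]] /= z0; move: h; rewrite z0 normr0.
  by rewrite leNgt divr_gt0// exprn_gt0.
Qed.

(** By scale invariance each shell of ratio exp 1 contributes the same
    constant, and at most 1 + ln (D / r) of them are needed. *)
Lemma integral_log_shell r D : 0 < r -> r <= D ->
  (\int[mu4]_(z in shell r D) (rpow 4 z)%:E
   <= (16 * expR 1 ^+ 4 * (1 + ln (D / r)))%:E)%E.
Proof.
move=> r0 rD; have D0 : 0 < D by lra.
have c0 : (0 : R) < 16 * expR 1 ^+ 4 by rewrite mulr_gt0// exprn_gt0// expR_gt0.
have H n : (\int[mu4]_(z in shell r (r * expR 1 ^+ n)) (rpow 4 z)%:E <=
    (16 * expR 1 ^+ 4 * n%:R)%:E)%E.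
  elim: n => [|n IH].
    rewrite expr0 mulr1 mulr0 (_ : shell r r = set0) ?integral_set0//.
    by apply/seteqP; split=> z //= /andP[h1 h2]; move: (le_lt_trans h1 h2); rewrite ltxx.
  have e1 : 1 <= expR 1 :> R by have := expR_ge1Dx (1 : R); lra.
  have en : 1 <= expR 1 ^+ n :> R by exact: exprn_ege1.
  have s0 : 0 < r * expR 1 ^+ n by rewrite mulr_gt0// exprn_gt0// expR_gt0.
  have es : r * expR 1 ^+ n.+1 = expR 1 * (r * expR 1 ^+ n) by rewrite exprS; ring.
  rewrite (@integral_shellD _ _ (r * expR 1 ^+ n)); [|nra|rewrite es; nra].
  apply: le_trans (leeD IH _) _.
    by apply: integral_shell_le => //; rewrite es; nra.
  rewrite -EFinD lee_fin es -(natr1 n) mulrDr mulr1 lerD2l.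
  rewrite le_eqVlt; apply/orP; left; apply/eqP.
  field; rewrite ?gt_eqF ?exprn_gt0 ?expR_gt0//.
pose n := (Num.trunc (ln (D / r))).+1.
have l0 : 0 <= ln (D / r) by rewrite ln_ge0// ler_pdivlMr// mul1r.
have /andP[n1 n2] := truncn_itv l0.
apply: (@le_trans _ _ (\int[mu4]_(z in shell r (r * expR 1 ^+ n)) (rpow 4 z)%:E)%E).
  apply: ge0_subset_integral.
  - exact: measurable_shell.
  - exact: measurable_shell.
  - by apply/measurable_EFinP; apply: measurable_funTS; exact: measurable_rpow.
  - by move=> z _; rewrite lee_fin rpow_ge0.
  - move=> z /= /andP[h1 h]; apply/andP; split => //; apply: (lt_le_trans h).
    rewrite -ler_pdivrMl// mulrC -expRM_natl mulr1 -[leLHS]lnK ?posrE ?divr_gt0// ler_expR ?posrE ?expR_gt0 ?divr_gt0//.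
    exact: ltW.
apply: le_trans (H n) _; rewrite lee_fin; apply: ler_wpM2l; first exact: ltW.
rewrite /n -(natr1 (Num.trunc _)).
by rewrite addrC lerD2l.
Qed.

End shells.

(** * The double potential of a set *)

Section double_potential.
Context {R : realType}.
Local Notation X4 := (R4 (measurableTypeR R)).
Implicit Types (x y z : R4 R).

Definition riesz : X4 -> \bar R := fun z => (rpow 2 z)%:E.

Definition eindic (A : set X4) : X4 -> \bar R := fun z => (\1_A z)%:E.

Lemma riesz_ge0 z : (0 <= riesz z)%E.
Proof. by rewrite lee_fin rpow_ge0. Qed.

Lemma measurable_riesz : measurable_fun setT riesz.
Proof. by apply/measurable_EFinP; exact: measurable_rpow. Qed.

Lemma rieszN z : riesz (- z) = riesz z.
Proof. by rewrite /riesz /rpow normrN. Qed.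

Lemma eindic_ge0 A z : (0 <= eindic A z)%E.
Proof. by rewrite lee_fin indicE. Qed.

Lemma measurable_eindic A : measurable A -> measurable_fun setT (eindic A).
Proof. by move=> mA; apply/measurable_EFinP; exact: measurable_indic. Qed.

Lemma integral_eindic A : measurable A -> (\int[mu4]_z eindic A z = mu4 A)%E.
Proof. by move=> mA; rewrite /eindic integral_indic// setIT. Qed.

Section truncated_kernels.
Variables (p : nat) (r s : R).

Definition shell_kernel z : R := rpow p z * \1_(shell r s : set X4) (z : X4).

Lemma shell_kernel_ge0 z : 0 <= shell_kernel z.
Proof. by rewrite mulr_ge0 ?rpow_ge0// indicE. Qed.

Lemma measurable_shell_kernel : measurable_fun setT (fun z : X4 => (shell_kernel z)%:E).
Proof.
apply/measurable_EFinP; apply: measurable_funM; first exact: measurable_rpow.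
by apply: measurable_indic; exact: measurable_shell.
Qed.

Lemma shell_kernelN z : shell_kernel (- z) = shell_kernel z.
Proof.
rewrite /shell_kernel /rpow normrN; congr (_ * _); rewrite !indicE; congr (_ %:R).
by congr nat_of_bool; apply/idP/idP => /set_mem; rewrite /shell/= ?normrN => H;
  apply/mem_set; rewrite /= ?normrN.
Qed.

Lemma integral_shell_kernel :
  (\int[mu4]_z (shell_kernel z)%:E = \int[mu4]_(z in shell r s) (rpow p z)%:E)%E.
Proof.
rewrite [RHS]integral_mkcond; apply: eq_integral => z _.
rewrite /shell_kernel patchE indicE; case: ifP => _; first by rewrite mulr1.
by rewrite mulr0.
Qed.

Lemma shell_kernel_in z : r <= `|z| -> `|z| < s -> shell_kernel z = rpow p z.
Proof. by move=> h1 h2; rewrite /shell_kernel indicE mem_set ?mulr1//; apply/andP. Qed.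

End truncated_kernels.

(** When both points are far, a b <= (a^2 + b^2) / 2 for the two values of
    the kernel separates the variables and turns the exponent 2 into 4, which
    is the logarithmically divergent one; when only one of them is far, its
    kernel is at most rho^-2. *)
Lemma kernel_split (rho D : R) z w : 0 < rho -> `|z| < D -> `|w| < D ->
  rpow 2 z * rpow 2 w <= shell_kernel 2 0 rho z * shell_kernel 2 0 rho w +
    ((rho ^- 2 * shell_kernel 2 0 rho z + shell_kernel 4 rho D z) +
     (rho ^- 2 * shell_kernel 2 0 rho w + shell_kernel 4 rho D w)).
Proof.
move=> rho0 zD wD.
have i0 : 0 <= rho ^- 2 by rewrite invr_ge0 exprn_ge0// ltW.
have far u : rho <= `|u| -> rpow 2 u <= rho ^- 2.
  move=> ru; have u0 : 0 < `|u| by lra.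
  rewrite /rpow lef_pV2 ?posrE ?exprn_gt0//.
  by apply: lerXn2r; rewrite ?nnegrE// ltW.
have r4 u : rpow 4 u = rpow 2 u ^+ 2 by rewrite /rpow -exprVn -exprVn -exprM.
have p2z := rpow_ge0 2 z; have p2w := rpow_ge0 2 w.
have t0z := mulr_ge0 i0 (shell_kernel_ge0 2 0 rho z); have t0w := mulr_ge0 i0 (shell_kernel_ge0 2 0 rho w).
have t4z := shell_kernel_ge0 4 rho D z; have t4w := shell_kernel_ge0 4 rho D w.
have tt : 0 <= shell_kernel 2 0 rho z * shell_kernel 2 0 rho w by rewrite mulr_ge0 ?shell_kernel_ge0.
case: (ltP `|z| rho) => hz; case: (ltP `|w| rho) => hw.
- have tz : shell_kernel 2 0 rho z = rpow 2 z by exact: shell_kernel_in.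
  have tw : shell_kernel 2 0 rho w = rpow 2 w by exact: shell_kernel_in.
  by rewrite tz tw in tt t0z t0w *; lra.
- have tz : shell_kernel 2 0 rho z = rpow 2 z by exact: shell_kernel_in.
  by have := ler_wpM2l p2z (far _ hw); rewrite tz in tt t0z *; lra.
- have tw : shell_kernel 2 0 rho w = rpow 2 w by exact: shell_kernel_in.
  by have := ler_wpM2r p2w (far _ hz); rewrite tw in tt t0w *; lra.
- have tz : shell_kernel 4 rho D z = rpow 2 z ^+ 2 by rewrite -r4; exact: shell_kernel_in.
  have tw : shell_kernel 4 rho D w = rpow 2 w ^+ 2 by rewrite -r4; exact: shell_kernel_in.
  have := sqr_ge0 (rpow 2 z - rpow 2 w); rewrite sqrrB tz tw mulr2n.
  move: t4z t4w; rewrite tz tw; lra.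
Qed.

Definition logconst : R := 16 * expR 1 ^+ 4.

(** Here rho^4 = |A|. [kernel_split] at the radius rho bounds the double
    potential by the product of two near integrals, each O(rho^2), and by
    terms that depend on only one of the two differences. Integrating such a
    term over both variables gives |A| = rho^4 times an integral that is O(1
    + ln (D / rho)). *)
Lemma double_pot_le (Om A : set X4) (D rho : R) (x : R4 R) :
  measurable Om -> measurable A -> A `<=` Om -> Om x ->
  (forall y z, Om y -> Om z -> `|y - z| < D) ->
  0 < rho -> rho <= D -> mu4 A = (rho ^+ 4)%:E ->
  (pot riesz (fun z => eindic Om z * pot riesz (eindic A) z) x <=
    (rho ^+ 4 * (2 ^+ 14 + 2 * (2 ^+ 7 + logconst * (1 + ln (D / rho)))))%:E)%E.
Proof.
move=> mOm mA AOm Omx OmD rho0 rhoD muA.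
have i0 : 0 <= rho ^- 2 by rewrite invr_ge0 exprn_ge0// ltW.
pose m := rho ^+ 4.
pose a (z : X4) := (shell_kernel 2 0 rho z)%:E; pose b (z : X4) := (shell_kernel 4 rho D z)%:E.
pose cc (z : X4) := (((rho ^- 2)%:E * a z) + b z)%E.
have a0 z : (0 <= a z)%E by rewrite lee_fin shell_kernel_ge0.
have b0 z : (0 <= b z)%E by rewrite lee_fin shell_kernel_ge0.
have cc0 z : (0 <= cc z)%E by rewrite adde_ge0// mule_ge0.
have ma : measurable_fun setT a by exact: measurable_shell_kernel.
have mb : measurable_fun setT b by exact: measurable_shell_kernel.
have mcc : measurable_fun setT cc.
  by apply: emeasurable_funD => //; exact: emeasurable_funM.
have aN z : a (- z) = a z by rewrite /a shell_kernelN.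
have ccN z : cc (- z) = cc z by rewrite /cc aN /b shell_kernelN.
have sh (c : X4 -> \bar R) y : measurable_fun setT c -> measurable_fun setT (fun z : X4 => c (z - y)).
  by move=> mc; exact: (measurableT_comp mc (preserves4_shift (- y)).1).
have mi := measurable_eindic mA; have i_0 := eindic_ge0 A.
set al := (\int[mu4]_z a z)%E.
have al_le : (al <= (2 ^+ 7 * rho ^+ 2)%:E)%E.
  by rewrite /al integral_shell_kernel; exact: integral_riesz_ball.
have al0 : (0 <= al)%E by exact: integral_ge0.
pose be := logconst * (1 + ln (D / rho)).
have be_le : (\int[mu4]_z b z <= be%:E)%E.
  by rewrite /b integral_shell_kernel; exact: integral_log_shell.
have cc_le : (\int[mu4]_z cc z <= (2 ^+ 7 + be)%:E)%E.
  rewrite ge0_integralD//; last 2 first.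
  - by move=> z _; rewrite mule_ge0.
  - exact: emeasurable_funM.
  rewrite ge0_integralZl//.
  rewrite EFinD; apply: leeD => //.
  apply: (@le_trans _ _ ((rho ^- 2)%:E * (2 ^+ 7 * rho ^+ 2)%:E)%E).
    exact: lee_wpmul2l.
  by rewrite -EFinM lee_fin mulrCA mulVf ?mulr1// expf_neq0// gt_eqF.
have pw (z : R4 R) : (riesz (z - x)%R * (eindic Om z * pot riesz (eindic A) z) <=
    a (z - x)%R * al + (m%:E * cc (z - x)%R + pot cc (eindic A) z))%E.
  have rhs0 : (0 <= a (z - x)%R * al + (m%:E * cc (z - x)%R + pot cc (eindic A) z))%E.
    rewrite adde_ge0 ?mule_ge0// adde_ge0 ?mule_ge0// ?pot_ge0//.
    by rewrite lee_fin exprn_ge0// ltW.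
  have [Omz|nOmz] := pselect (Om z); last first.
    by rewrite {1}/eindic indicE memNset// mul0e mule0.
  have -> : eindic Om z = 1%E by rewrite /eindic indicE mem_set.
  rewrite mul1e /pot -ge0_integralZl ?riesz_ge0//; last 2 first.
  - by apply: emeasurable_funM => //; apply: sh; exact: measurable_riesz.
  - by move=> y _; rewrite mule_ge0 ?riesz_ge0.
  have -> : (a (z - x)%R * al = \int[mu4]_y (a (z - x)%R * a (y - z)%R))%E.
    rewrite ge0_integralZl//; [|exact: sh].
    by rewrite (pot1 z).
  have -> : (m%:E * cc (z - x)%R = \int[mu4]_y (cc (z - x)%R * eindic A y))%E.
    by rewrite ge0_integralZl// integral_eindic// muA muleC.
  have mac : measurable_fun setT (fun y : X4 => cc (y - z)%R * eindic A y)%E.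
    by apply: emeasurable_funM => //; exact: sh.
  rewrite -ge0_integralD//; last 3 first.
  - by move=> y _; rewrite mule_ge0.
  - exact: emeasurable_funM.
  - by move=> y _; rewrite mule_ge0.
  rewrite -ge0_integralD//; last 4 first.
  - by move=> y _; rewrite mule_ge0.
  - by apply: emeasurable_funM => //; exact: sh.
  - by move=> y _; rewrite adde_ge0// mule_ge0.
  - by apply: emeasurable_funD => //; exact: emeasurable_funM.
  apply: ge0_le_integral => //.
  - by move=> y _; rewrite !mule_ge0 ?riesz_ge0.
  - apply: emeasurable_funM => //; apply: emeasurable_funM => //.
    by apply: sh; exact: measurable_riesz.
  - apply: emeasurable_funD; first by apply: emeasurable_funM => //; exact: sh.
    by apply: emeasurable_funD => //; exact: emeasurable_funM.
  move=> y _; have [Ay|nAy] := pselect (A y); last first.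
    have -> : eindic A y = 0%E by rewrite /eindic indicE memNset.
    by rewrite !mule0 adde_ge0// ?mule_ge0// adde0.
  have -> : eindic A y = 1%E by rewrite /eindic indicE mem_set.
  rewrite !mule1 /riesz /cc /a /b -!EFinM -!EFinD lee_fin.
  by apply: kernel_split => //; apply: OmD => //; exact: AOm.
apply: (@le_trans _ _ (\int[mu4]_z (a (z - x)%R * al + (m%:E * cc (z - x)%R + pot cc (eindic A) z)))%E).
  apply: ge0_le_integral => //.
  - by move=> z _; rewrite !mule_ge0 ?riesz_ge0 ?eindic_ge0// pot_ge0// => ?; exact: riesz_ge0.
  - apply: emeasurable_funM; first by apply: sh; exact: measurable_riesz.
    apply: emeasurable_funM; first exact: measurable_eindic.
    by apply: measurable_pot => //; [exact: measurable_riesz|exact: riesz_ge0].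
  - apply: emeasurable_funD; first by apply: emeasurable_funM => //; exact: sh.
    apply: emeasurable_funD; first by apply: emeasurable_funM => //; exact: sh.
    exact: measurable_pot.
have m0 : (0 <= m%:E)%E by rewrite lee_fin exprn_ge0// ltW.
rewrite ge0_integralD//; last 4 first.
- by move=> z _; rewrite mule_ge0.
- by apply: emeasurable_funM => //; exact: sh.
- by move=> z _; rewrite adde_ge0 ?pot_ge0// mule_ge0.
- apply: emeasurable_funD; last exact: measurable_pot.
  by apply: emeasurable_funM => //; exact: sh.
rewrite ge0_integralD//; last 4 first.
- by move=> z _; rewrite mule_ge0.
- by apply: emeasurable_funM => //; exact: sh.
- by move=> z _; rewrite pot_ge0.
- exact: measurable_pot.
rewrite pot_total// ge0_integralZr//; [|exact: sh].
rewrite ge0_integralZl//; [|exact: sh].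
rewrite !(pot1 x)// integral_eindic// muA -/al.
apply: (@le_trans _ _ ((2 ^+ 7 * rho ^+ 2)%:E * (2 ^+ 7 * rho ^+ 2)%:E +
   (m%:E * (2 ^+ 7 + be)%:E + m%:E * (2 ^+ 7 + be)%:E))%E).
  apply: leeD; first exact: lee_pmul.
  by apply: leeD; apply: lee_wpmul2l.
rewrite -!EFinM -!EFinD lee_fin /m.
by rewrite le_eqVlt; apply/orP; left; apply/eqP; rewrite /be; ring.
Qed.

End double_potential.

(** * Hansson's capacitary inequality *)

Lemma mule_shuffle (R : realType) (a b c p q : \bar R) :
  (a * ((b * p) * (c * q)) = (b * c) * (a * q * p))%E.
Proof. by rewrite (muleACA b) (muleCA a) (muleC p) (muleA a). Qed.

Section capacity.
Context {R : realType}.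
Local Notation X4 := (R4 (measurableTypeR R)).
Implicit Types (x y z : R4 R).
Variables (Om : set X4) (M D : R).
Hypotheses (mOm : measurable Om) (muOm : mu4 Om = M%:E) (M0 : 0 < M).
Hypotheses (D0 : 0 < D) (MD : M <= D ^+ 4).
Hypothesis OmD : forall y z, Om y -> Om z -> `|y - z| < D.

Definition mass (A : set X4) : R := fine (mu4 A).

(** Up to a constant, a lower bound, attained by small balls, of the energy
    of a function that is at least 1 on a set of measure m inside a domain of
    measure M. *)
Definition inv_log (m : R) : R := (1 + ln (M / m))^-1.

(** The height of the constant density on A that serves as an approximate
    equilibrium measure: unless A is null its total mass is [inv_log (mass
    A)], and [equilibrium_le] bounds its double potential. *)
Definition equi_dens (A : set X4) : R := (mass A)^-1 * inv_log (mass A).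

Definition capconst : R := 2 ^+ 14 + 2 ^+ 8 + 2 * logconst * (1 + ln (D ^+ 4 / M)).

Lemma massE A : measurable A -> A `<=` Om -> mu4 A = (mass A)%:E /\ 0 <= mass A <= M.
Proof.
move=> mA AO; have le : (mu4 A <= M%:E)%E.
  by rewrite -muOm; apply: le_measure; rewrite ?inE.
have fin : mu4 A \is a fin_num.
  by rewrite ge0_fin_numE// (le_lt_trans le)// ltry.
rewrite /mass fineK//; split=> //; rewrite fine_ge0//=.
by rewrite -lee_fin fineK.
Qed.

Lemma ln_mass_ge0 m : 0 < m -> m <= M -> 0 <= ln (M / m).
Proof. by move=> m0 mM; rewrite ln_ge0// ler_pdivlMr// mul1r. Qed.

Lemma inv_log_ge0 m : 0 <= m <= M -> 0 <= inv_log m.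
Proof.
move=> /andP[m0 mM]; rewrite invr_ge0; move: m0; rewrite le_eqVlt => /orP[/eqP<-|m0].
  by rewrite invr0 mulr0 ln0// addr0.
by rewrite addr_ge0// ln_mass_ge0.
Qed.

Lemma equi_dens_ge0 A : measurable A -> A `<=` Om -> 0 <= equi_dens A.
Proof.
move=> mA AO; have [_ mM] := massE mA AO.
apply: mulr_ge0; last exact: inv_log_ge0.
by rewrite invr_ge0; case/andP: mM.
Qed.

Lemma logconst_gt0 : (0 : R) < logconst.
Proof. by rewrite mulr_gt0// exprn_gt0// expR_gt0. Qed.

Lemma l0_ge0 : 0 <= ln (D ^+ 4 / M).
Proof. by rewrite ln_ge0// ler_pdivlMr// mul1r. Qed.

Lemma capconst_gt0 : 0 < capconst.
Proof.
have c0 := logconst_gt0; have l0 := l0_ge0.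
have h : 0 <= logconst * (1 + ln (D ^+ 4 / M)) by rewrite mulr_ge0 ?addr_ge0// ltW.
have h1 : (0 : R) < 2 ^+ 14 by exact: exprn_gt0.
have h2 : (0 : R) < 2 ^+ 8 by exact: exprn_gt0.
rewrite /capconst -mulrA.
by move: (2 ^+ 14) (2 ^+ 8) h1 h2 (logconst * _) h => a b a0 b0 c; lra.
Qed.

(** [double_pot_le] with rho the fourth root of the measure of A; the
    logarithm of D / rho is controlled by that of M / |A|, up to a constant
    depending on D^4 / M. *)
Lemma equilibrium_le A x : measurable A -> A `<=` Om -> Om x ->
  ((equi_dens A)%:E * pot (@riesz R) (fun z => eindic Om z * pot (@riesz R) (eindic A) z) x
    <= capconst%:E)%E.
Proof.
move=> mA AO Ox; have [muA /andP[m0 mM]] := massE mA AO.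
have [mz|mn0] := eqVneq (mass A) 0.
  by rewrite /equi_dens mz invr0 mul0r mul0e lee_fin ltW// capconst_gt0.
have {}m0 : 0 < mass A by rewrite lt_neqAle eq_sym mn0.
set m := mass A in m0 mM muA *.
pose rho := Num.sqrt (Num.sqrt m).
have rho0 : 0 < rho by rewrite !sqrtr_gt0.
have rho4 : rho ^+ 4 = m by rewrite (exprM _ 2 2) sqr_sqrtr ?sqrtr_ge0// sqr_sqrtr// ltW.
have rhoD : rho <= D.
  by rewrite -(@ler_pXn2r _ 4) ?nnegrE ?(ltW rho0) ?(ltW D0)// rho4 (le_trans mM).
have l0 := l0_ge0; have l1 := ln_mass_ge0 m0 mM; have lc := logconst_gt0.
have lE : 4 * ln (D / rho) = ln (D ^+ 4 / M) + ln (M / m).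
  rewrite -lnM ?posrE ?divr_gt0 ?exprn_gt0// -[D ^+ 4 / M * _]mulrA mulKf ?gt_eqF//.
  by rewrite -rho4 -expr_div_n lnXn ?divr_gt0// mulr_natl.
have lle : ln (D / rho) <= ln (D ^+ 4 / M) + ln (M / m) by lra.
have K0 : 0 <= equi_dens A by exact: equi_dens_ge0.
apply: (@le_trans _ _ ((equi_dens A)%:E * (rho ^+ 4 * (2 ^+ 14 + 2 * (2 ^+ 7 + logconst * (1 + ln (D / rho)))))%:E)%E).
  apply: lee_wpmul2l => //; apply: double_pot_le => //; by rewrite rho4.
rewrite -EFinM lee_fin rho4 /equi_dens -/m /inv_log.
rewrite mulrACA mulVf ?gt_eqF// mul1r ler_pdivrMl; last lra.
rewrite /capconst mulrC.
move: (ln (D / rho)) (ln (D ^+ 4 / M)) (ln (M / m)) (@logconst R) lle l0 l1 lc => a b c d.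
move=> h1 h2 h3 h4.
have : d * a <= d * (b + c) by rewrite ler_wpM2l// ltW.
have : 0 <= d * b * c by rewrite !mulr_ge0// ltW.
have : 0 <= d * c by rewrite mulr_ge0// ltW.
nra.
Qed.

(** In the triangular form every cross term can be estimated on the smaller
    of its two level sets. *)
Lemma sum_sqr_le (a : nat -> \bar R) n : (forall k, 0 <= a k)%E ->
  ((\sum_(k < n) a k) * (\sum_(k < n) a k) <=
    2%:E * \sum_(k < n) (a k * \sum_(j < k.+1) a j))%E.
Proof.
move=> a0; elim: n => [|n IH]; first by rewrite !big_ord0 mul0e mule0.
have s0 k : (0 <= \sum_(j < k) a j)%E by apply: sume_ge0.
rewrite [in leLHS]big_ord_recr [in leRHS]big_ord_recr /= [in leRHS]big_ord_recr /=.
set S := (\sum_(k < n) a k)%E in IH *; have S0 : (0 <= S)%E by exact: s0.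
set T := (\sum_(k < n) _)%E in IH *.
have T0 : (0 <= T)%E by apply: sume_ge0 => k _; rewrite mule_ge0.
have SA : (0 <= S + a n)%E by rewrite adde_ge0.
have -> : ((S + a n) * (S + a n) = S * S + (S * a n + a n * (S + a n)))%E.
  by rewrite ge0_muleDl// ge0_muleDr// -addeA.
rewrite [in leRHS]ge0_muleDr//; last by rewrite mule_ge0.
apply: leeD => //.
have -> : (2%:E * (a n * (S + a n)) = a n * (S + a n) + a n * (S + a n))%E.
  rewrite -[2%:E]/((1 + 1)%R%:E) EFinD ge0_muleDl ?lee01//.
  by rewrite mul1e.
apply: leeD => //; rewrite muleC; apply: lee_wpmul2l => //; exact: leeDl.
Qed.

Variables (f : R4 R -> R) (lam : R).
Hypotheses (cf : csmooth f) (fOm : forall x, f x != 0 -> Om x) (lam0 : 0 < lam).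
Hypothesis lapOm : forall x, laplacian f x != 0 -> Om x.

Definition level_set (k : nat) : set X4 := [set x : X4 | lam * 2 ^+ k < `|f x|].

Lemma level_set_sub k : level_set k `<=` Om.
Proof.
move=> x; rewrite /level_set /= => h; apply: fOm; rewrite -normr_gt0.
by apply: le_lt_trans h; rewrite mulr_ge0 ?exprn_ge0// ltW.
Qed.

Lemma measurable_level_set k : measurable (level_set k).
Proof.
apply: open_measurable4.
have -> : level_set k = (fun x => `|f x|) @^-1` [set s | lam * 2 ^+ k < s] by [].
apply: open_comp; last exact: open_gt.
move=> x _; apply: (@continuous_comp _ _ _ f (fun s : R => `|s|)).
  exact: (smooth_continuous cf.1).
exact: norm_continuous.
Qed.

(** The square of the level times the total mass of the equilibrium density,
    with the value 0 when the level set is null. *)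
Definition level_weight k : R := (lam * 2 ^+ k) ^+ 2 * (mass (level_set k) * equi_dens (level_set k)).

Let g (z : X4) : \bar R := `|laplacian f z|%:E.

Let pk k : X4 -> \bar R := pot (@riesz R) (eindic (level_set k)).

Let ck k : R := lam * 2 ^+ k * equi_dens (level_set k).

Let ak k (z : X4) : \bar R := ((ck k)%:E * pk k z)%E.

Let dk0 k : 0 <= equi_dens (level_set k).
Proof. by apply: equi_dens_ge0; [exact: measurable_level_set|exact: level_set_sub]. Qed.

Let l20 k : 0 <= lam * 2 ^+ k.
Proof. by rewrite mulr_ge0 ?exprn_ge0// ltW. Qed.

Let ck0 k : 0 <= ck k.
Proof. by rewrite mulr_ge0. Qed.

Let mind k : measurable_fun setT (eindic (level_set k)).
Proof. by apply: measurable_eindic; exact: measurable_level_set. Qed.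

Let pk0 k z : (0 <= pk k z)%E.
Proof. by apply: pot_ge0; [exact: riesz_ge0|exact: eindic_ge0]. Qed.

Let mpk k : measurable_fun setT (pk k).
Proof.
apply: measurable_pot; [exact: measurable_riesz|exact: riesz_ge0|exact: mind|exact: eindic_ge0].
Qed.

Let mf : measurable_fun setT (fun x : X4 => (`|f x|)%:E).
Proof.
apply/measurable_EFinP; apply: continuous_measurable4 => x.
by apply: cvg_norm; exact: (smooth_continuous cf.1).
Qed.

Let mg : measurable_fun setT g.
Proof.
apply/measurable_EFinP; apply: continuous_measurable4 => x.
by apply: cvg_norm; exact: (continuous_laplacian cf.1).
Qed.

Let ak0 k z : (0 <= ak k z)%E.
Proof. by rewrite /ak mule_ge0// lee_fin. Qed.

Let mak k : measurable_fun setT (ak k).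
Proof. exact: emeasurable_funM. Qed.

Let mu_level_set k : mu4 (level_set k) = (mass (level_set k))%:E.
Proof. by apply: (massE _ _).1; [exact: measurable_level_set|exact: level_set_sub]. Qed.

(** On the level set the level is less than |f|, hence less than twice the
    potential of |Laplacian f|; symmetry moves the potential to the density. *)
Lemma level_weight_le k : ((level_weight k)%:E <= 2%:E * \int[mu4]_z (g z * ak k z))%E.
Proof.
have -> : ((level_weight k)%:E = \int[mu4]_x ((ck k)%:E * ((lam * 2 ^+ k)%:E * eindic (level_set k) x)))%E.
  have mi : measurable_fun setT (fun x : X4 => (lam * 2 ^+ k)%:E * eindic (level_set k) x)%E.
    exact: emeasurable_funM.
  rewrite ge0_integralZl ?lee_fin//; last first.
    by move=> x _; rewrite mule_ge0 ?eindic_ge0// lee_fin.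
  rewrite ge0_integralZl ?lee_fin//; last by move=> x _; exact: eindic_ge0.
  rewrite integral_eindic; last exact: measurable_level_set.
  rewrite mu_level_set -!EFinM; congr (_%:E); rewrite /level_weight /ck expr2; ring.
have g0 : forall x, (0 <= g x)%E by move=> x; rewrite lee_fin.
have mrk := @measurable_riesz R; have rk0 := @riesz_ge0 R.
have mpg : measurable_fun setT (pot (@riesz R) g : X4 -> _) by exact: measurable_pot.
have pg0 x : (0 <= pot (@riesz R) g x)%E by exact: pot_ge0.
have i0 x : (0 <= eindic (level_set k) x)%E by exact: eindic_ge0.
have mig : measurable_fun setT (fun x : X4 => eindic (level_set k) x * pot (@riesz R) g x)%E.
  exact: emeasurable_funM.
apply: (@le_trans _ _ (\int[mu4]_x ((2 * ck k)%:E * (eindic (level_set k) x * pot (@riesz R) g x)))%E).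
  apply: ge0_le_integral.
  - exact: measurableT.
  - by move=> x _; rewrite !mule_ge0// lee_fin.
  - by do 2 apply: emeasurable_funM => //.
  - exact: emeasurable_funM.
  move=> x _; have [Ax|nAx] := pselect (level_set k x); last first.
    by rewrite /eindic indicE memNset// mul0e !mule0.
  have -> : eindic (level_set k) x = 1%E by rewrite /eindic indicE mem_set.
  rewrite mule1 mul1e.
  have -> : ((2 * ck k)%:E = (ck k)%:E * 2%:E)%E by rewrite -EFinM mulrC.
  rewrite -muleA; apply: lee_wpmul2l; first by rewrite lee_fin.
  have := potential_bound x cf.
  rewrite (_ : (\int[mu4]_y _ = pot (@riesz R) g x)%E); last first.
    by apply: eq_integral => y _; rewrite /g /riesz -EFinM.
  case: (pot (@riesz R) g x) (pg0 x) => [p|_ _|//]; last first.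
    by rewrite gt0_muley ?leey// lte_fin.
  rewrite -EFinM !lee_fin => _ h; move: Ax; rewrite /level_set /=; lra.
have c20 : 0 <= 2 * ck k by exact: mulr_ge0.
rewrite ge0_integralZl ?lee_fin//; last by move=> x _; rewrite mule_ge0.
rewrite (@pot_swap R _ g (eindic (level_set k)))//; last exact: rieszN.
rewrite EFinM -muleA; apply: lee_wpmul2l => //.
rewrite -(@ge0_integralZl _ _ _ mu4 _ measurableT _ (emeasurable_funM mg (mpk k))
  (ck k)%:E (fun x _ => mule_ge0 (g0 x) (pk0 k x)) (ck0 k)).
rewrite le_eqVlt; apply/orP; left; apply/eqP.
by apply: eq_integral => x _; rewrite /ak muleCA.
Qed.

(** For j <= k the double potential of the density on the j-th level set is
    at most [capconst], so that the cross term is at most (lam 2^j) (lam 2^k)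
    times the mass of the density on the k-th level set. The sum over j <= k
    is geometric and leaves (lam 2^k)^2. *)
Lemma energy_le n :
  (\int[mu4]_z (eindic Om z * ((\sum_(k < n) ak k z) * (\sum_(k < n) ak k z)))
    <= (4 * capconst * \sum_(k < n) level_weight k)%:E)%E.
Proof.
have mrk := @measurable_riesz R; have rk0 := @riesz_ge0 R.
have iO0 := eindic_ge0 Om; have miO := measurable_eindic mOm.
have mS m : measurable_fun setT (fun z : X4 => \sum_(k < m) ak k z)%E.
  by apply: emeasurable_fun_sum => k _; exact: mak.
have S0 m z : (0 <= \sum_(k < m) ak k z)%E by apply: sume_ge0.
have cross j k : (\int[mu4]_z (eindic Om z * (ak k z * ak j z)) <=
    (lam * 2 ^+ j * (lam * 2 ^+ k) * (mass (level_set k) * equi_dens (level_set k)) * capconst)%:E)%E.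
  have mG : measurable_fun setT (fun z : X4 => eindic Om z * pk j z)%E by exact: emeasurable_funM.
  have G0 z : (0 <= eindic Om z * pk j z)%E by rewrite mule_ge0.
  have -> : (\int[mu4]_z (eindic Om z * (ak k z * ak j z)) =
     (lam * 2 ^+ j * ck k)%:E * ((equi_dens (level_set j))%:E * \int[mu4]_x
       (eindic (level_set k) x * pot (@riesz R) (fun z : X4 => eindic Om z * pk j z) x)))%E.
    transitivity ((ck k * ck j)%:E * \int[mu4]_x
        (eindic (level_set k) x * pot (@riesz R) (fun z : X4 => eindic Om z * pk j z) x))%E; last first.
      move: (integral _ _ _) => I; rewrite /ck.
      move: (lam * 2 ^+ j) (lam * 2 ^+ k) (equi_dens (level_set j)) (equi_dens (level_set k)) => lj lk dj dk.
      by rewrite muleA -EFinM; congr (_%:E * _)%E; ring.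
    rewrite -(@pot_swap R _ (eindic (level_set k)) (fun z : X4 => eindic Om z * pk j z)%E mrk rk0
      (@rieszN R) (mind k) (eindic_ge0 _) mG G0).
    have c0 : 0 <= ck k * ck j by exact: mulr_ge0.
    rewrite -(@ge0_integralZl _ _ _ mu4 _ measurableT _ (emeasurable_funM mG (mpk k))
      (ck k * ck j)%:E (fun z _ => mule_ge0 (G0 z) (pk0 k z)) c0).
    apply: eq_integral => z _; rewrite /ak.
    move: (ck k) (ck j) (pk k z) (pk j z) (eindic Om z) => b c p q a.
    by rewrite EFinM; exact: mule_shuffle.
  apply: (@le_trans _ _ ((lam * 2 ^+ j * ck k)%:E * (capconst * mass (level_set k))%:E)%E); last first.
    rewrite -EFinM lee_fin le_eqVlt; apply/orP; left; apply/eqP.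
    by rewrite /ck; move: (equi_dens _) (mass _) capconst => d m c; ring.
  apply: lee_wpmul2l; first by rewrite lee_fin mulr_ge0.
  have mpG : measurable_fun setT (pot (@riesz R) (fun z : X4 => eindic Om z * pk j z)%E : X4 -> _).
    exact: measurable_pot.
  have pG0 x : (0 <= pot (@riesz R) (fun z : X4 => eindic Om z * pk j z) x)%E by exact: pot_ge0.
  rewrite -(@ge0_integralZl _ _ _ mu4 _ measurableT _ (emeasurable_funM (mind k) mpG)
    (equi_dens (level_set j))%:E (fun x _ => mule_ge0 (eindic_ge0 _ x) (pG0 x)) (dk0 j)).
  have -> : ((capconst * mass (level_set k))%:E = \int[mu4]_x (capconst%:E * eindic (level_set k) x))%E.
    rewrite ge0_integralZl ?lee_fin ?(ltW capconst_gt0)//; last by move=> x _; exact: eindic_ge0.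
    by rewrite integral_eindic ?mu_level_set ?EFinM//; exact: measurable_level_set.
  apply: ge0_le_integral; first exact: measurableT.
  - move=> x _; have d0 : (0 <= (equi_dens (level_set j))%:E)%E by rewrite lee_fin.
    exact: mule_ge0 d0 (mule_ge0 (eindic_ge0 _ x) (pG0 x)).
  - apply: emeasurable_funM; first exact: measurable_cst.
    exact: emeasurable_funM (mind k) mpG.
  - by apply: emeasurable_funM; [exact: measurable_cst|exact: mind].
  - move=> x _; have [Ax|nAx] := pselect (level_set k x); last first.
      by rewrite /eindic [\1_(level_set k) x]indicE memNset// mul0e !mule0.
    have -> : eindic (level_set k) x = 1%E by rewrite /eindic indicE mem_set.
    rewrite mul1e mule1; apply: equilibrium_le.
    + exact: measurable_level_set.
    + exact: level_set_sub.
    + exact: (level_set_sub Ax).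
have m3 k j : measurable_fun setT (fun z : X4 => eindic Om z * (ak k z * ak j z))%E.
  exact: emeasurable_funM miO (emeasurable_funM (mak k) (mak j)).
have p3 k j z : (0 <= eindic Om z * (ak k z * ak j z))%E.
  exact: mule_ge0 (iO0 z) (mule_ge0 (ak0 k z) (ak0 j z)).
have m4 k m : measurable_fun setT
    (fun z : X4 => \sum_(j < m) (eindic Om z * (ak k z * ak j z)))%E.
  by apply: emeasurable_fun_sum => j _; exact: m3.
have m5 : measurable_fun setT
    (fun z : X4 => \sum_(k < n) \sum_(j < k.+1) (eindic Om z * (ak k z * ak j z)))%E.
  by apply: emeasurable_fun_sum => k _; exact: m4.
apply: (@le_trans _ _ (\int[mu4]_z (2%:E * \sum_(k < n) \sum_(j < k.+1) (eindic Om z * (ak k z * ak j z))))%E).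
  apply: ge0_le_integral => //.
  - by move=> z _; exact: mule_ge0 (iO0 z) (mule_ge0 (S0 n z) (S0 n z)).
  - exact: emeasurable_funM miO (emeasurable_funM (mS n) (mS n)).
  - by apply: emeasurable_funM => //; exact: m5.
  move=> z _; apply: (@le_trans _ _ (eindic Om z * (2%:E * \sum_(k < n) (ak k z * \sum_(j < k.+1) ak j z)))%E).
    by apply: lee_wpmul2l => //; exact: (@sum_sqr_le (fun k => ak k z) n (fun k => ak0 k z)).
  rewrite muleCA; apply: lee_wpmul2l => //.
  rewrite ge0_sume_distrr; last by move=> k _; rewrite mule_ge0.
  apply: lee_sum => k _; rewrite ge0_sume_distrr// ge0_sume_distrr// => j _.
  by rewrite mule_ge0.
have p4 k m z : (0 <= \sum_(j < m) (eindic Om z * (ak k z * ak j z)))%E by exact: sume_ge0.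
have p5 z : (0 <= \sum_(k < n) \sum_(j < k.+1) (eindic Om z * (ak k z * ak j z)))%E by exact: sume_ge0.
rewrite (@ge0_integralZl _ _ _ mu4 _ measurableT _ m5 2%:E (fun z _ => p5 z) (ler0n R 2)).
rewrite (@ge0_integral_sum _ _ _ mu4 _ measurableT _ _ (fun k : 'I_n => m4 k k.+1)
  (fun k z _ => p4 k k.+1 z)).
apply: (@le_trans _ _ (2%:E * \sum_(k < n) (2 * capconst * level_weight k)%:E)%E).
  apply: lee_wpmul2l => //; apply: lee_sum => k _.
  rewrite (@ge0_integral_sum _ _ _ mu4 _ measurableT _ _ (fun j : 'I_k.+1 => m3 k j)
    (fun j z _ => p3 k j z)).
  apply: (@le_trans _ _ (\sum_(j < k.+1) (lam * 2 ^+ j * (lam * 2 ^+ k) *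
      (mass (level_set k) * equi_dens (level_set k)) * capconst)%:E)%E).
    by apply: lee_sum => j _; exact: cross.
  rewrite sumEFin lee_fin -!mulr_suml -mulr_sumr.
  have geo : \sum_(j < k.+1) 2 ^+ j <= 2 * 2 ^+ k :> R.
    have := subrX1 (2 : R) k.+1; have -> : 2 - 1 = 1 :> R by ring.
    rewrite mul1r exprS => <-.
    by rewrite gerBl.
  have cc := capconst_gt0; have [_ /andP[m0 _]] := massE (@measurable_level_set k) (@level_set_sub k).
  have md : 0 <= mass (level_set k) * equi_dens (level_set k) by rewrite mulr_ge0.
  apply: (@le_trans _ _ (lam * (2 * 2 ^+ k) * (lam * 2 ^+ k) *
    (mass (level_set k) * equi_dens (level_set k)) * capconst)).
    apply: ler_wpM2r; first exact: ltW.
    apply: ler_wpM2r => //; apply: ler_wpM2r => //.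
    by apply: ler_wpM2l => //; exact: ltW.
  rewrite le_eqVlt; apply/orP; left; apply/eqP; rewrite /level_weight; ring.
rewrite sumEFin -EFinM lee_fin -mulr_sumr.
by rewrite le_eqVlt; apply/orP; left; apply/eqP; ring.
Qed.

(** With S the left-hand sum and Phi the potential of all weighted densities,
    S <= 2 \int |Laplacian f| Phi by [level_weight_le]. The inequality of
    Young with parameter 4 * capconst and [energy_le] bound this by 8 *
    capconst times the energy plus S / 2, and S is finite. *)
Lemma hansson n : ((\sum_(k < n) level_weight k)%:E <=
   (2 ^+ 4 * capconst)%:E * \int[mu4]_(z in Om) (laplacian f z ^+ 2)%:E)%E.
Proof.
have cc := capconst_gt0.
have iO0 := eindic_ge0 Om; have miO := measurable_eindic mOm.
have mS : measurable_fun setT (fun z : X4 => \sum_(k < n) ak k z)%E.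
  by apply: emeasurable_fun_sum => k _; exact: mak.
have S0 z : (0 <= \sum_(k < n) ak k z)%E by apply: sume_ge0.
have g0 z : (0 <= g z)%E by rewrite lee_fin.
have w0 k : 0 <= level_weight k.
  have [_ /andP[m0 _]] := massE (@measurable_level_set k) (@level_set_sub k).
  by apply: mulr_ge0; [exact: sqr_ge0|exact: mulr_ge0].
set S := \sum_(k < n) level_weight k.
have SS : 0 <= S by apply: sumr_ge0.
pose E := (\int[mu4]_(z in Om) (laplacian f z ^+ 2)%:E)%E.
have ml2 : measurable_fun setT (fun z : X4 => (laplacian f z ^+ 2)%:E).
  apply/measurable_EFinP; apply: measurable_funX; apply: continuous_measurable4.
  exact: (continuous_laplacian cf.1).
have E0 : (0 <= E)%E by apply: integral_ge0 => z _; rewrite lee_fin sqr_ge0.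
have EE : E = (\int[mu4]_z (eindic Om z * (laplacian f z ^+ 2)%:E))%E.
  rewrite /E integral_mkcond; apply: eq_integral => z _.
  by rewrite patchE /eindic indicE; case: ifP => _; rewrite ?mul1e ?mul0e.
have h1 : (S%:E <= 2%:E * \int[mu4]_z (g z * \sum_(k < n) ak k z))%E.
  have mga k : measurable_fun setT (fun z : X4 => g z * ak k z)%E.
    exact: emeasurable_funM mg (mak k).
  have ga0 k z : (0 <= g z * ak k z)%E by exact: mule_ge0 (g0 z) (ak0 k z).
  have -> : (\int[mu4]_z (g z * \sum_(k < n) ak k z) =
      \sum_(k < n) \int[mu4]_z (g z * ak k z))%E.
    rewrite -(@ge0_integral_sum _ _ _ mu4 _ measurableT _ _ (fun k : 'I_n => mga k)
      (fun k z _ => ga0 k z)).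
    by apply: eq_integral => z _; rewrite ge0_sume_distrr.
  rewrite ge0_sume_distrr; last by move=> k _; exact: integral_ge0.
  by rewrite /S -sumEFin; apply: lee_sum => k _; exact: level_weight_le.
pose t : R := 4 * capconst.
have t0 : 0 < t by rewrite mulr_gt0.
have h2 : (\int[mu4]_z (g z * \sum_(k < n) ak k z) <= t%:E * E +
   (4 * t)^-1%:E * \int[mu4]_z (eindic Om z * ((\sum_(k < n) ak k z) * (\sum_(k < n) ak k z))))%E.
  have mO2 : measurable_fun setT (fun z : X4 => eindic Om z * (laplacian f z ^+ 2)%:E)%E.
    exact: emeasurable_funM.
  have O20 z : (0 <= eindic Om z * (laplacian f z ^+ 2)%:E)%E.
    by rewrite mule_ge0// lee_fin sqr_ge0.
  have mOS : measurable_fun setT (fun z : X4 => eindic Om z * ((\sum_(k < n) ak k z) * (\sum_(k < n) ak k z)))%E.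
    exact: emeasurable_funM miO (emeasurable_funM mS mS).
  have OS0 z : (0 <= eindic Om z * ((\sum_(k < n) ak k z) * (\sum_(k < n) ak k z)))%E.
    exact: mule_ge0 (iO0 z) (mule_ge0 (S0 z) (S0 z)).
  have t'0 : (0 <= (4 * t)^-1%:E)%E by rewrite lee_fin invr_ge0 mulr_ge0// ltW.
  have t1 : (0 <= t%:E)%E by rewrite lee_fin ltW.
  rewrite EE -(@ge0_integralZl _ _ _ mu4 _ measurableT _ mO2 t%:E (fun z _ => O20 z) t1).
  rewrite -(@ge0_integralZl _ _ _ mu4 _ measurableT _ mOS (4 * t)^-1%:E (fun z _ => OS0 z) t'0).
  rewrite -ge0_integralD//; last 4 first.
  - by move=> z _; exact: mule_ge0 t1 (O20 z).
  - by apply: emeasurable_funM => //; exact: measurable_cst.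
  - by move=> z _; exact: mule_ge0 t'0 (OS0 z).
  - by apply: emeasurable_funM; [exact: measurable_cst|exact: mOS].
  apply: ge0_le_integral; first exact: measurableT.
  - by move=> z _; exact: mule_ge0 (g0 z) (S0 z).
  - exact: emeasurable_funM mg mS.
  - apply: emeasurable_funD; apply: emeasurable_funM; first exact: measurable_cst.
    + exact: mO2.
    + exact: measurable_cst.
    + exact: mOS.
  move=> z _; have [lz|lz] := eqVneq (laplacian f z) 0.
    rewrite /g lz normr0 mul0e adde_ge0//.
      by rewrite -lz; exact: mule_ge0 t1 (O20 z).
    exact: mule_ge0 t'0 (OS0 z).
  have -> : eindic Om z = 1%E by rewrite /eindic indicE mem_set//; exact: lapOm.
  rewrite !mul1e /g.
  move: (\sum_(k < n) ak k z)%E (S0 z) => s; move: (laplacian f z) lz => l l0.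
  case: s => [s| |//] s0; last first.
    have nl : 0 < `|l| by rewrite normr_gt0.
    have it : 0 < (4 * t)^-1 by rewrite invr_gt0 mulr_gt0.
    by rewrite mulyy gt0_muley ?lte_fin// [X in (_ <= _ + X)%E]gt0_muley ?lte_fin// addey.
  rewrite -!EFinM -EFinD lee_fin.
  have -> : l ^+ 2 = `|l| ^+ 2 by rewrite real_normK ?num_real.
  have := sqr_ge0 (2 * t * `|l| - s); move: (`|l|) => m h.
  have -> : t * m ^+ 2 + (4 * t)^-1 * (s * s) =
      (4 * t)^-1 * ((2 * t * m - s) ^+ 2) + m * s.
    by field; rewrite gt_eqF.
  by rewrite lerDr mulr_ge0// invr_ge0 mulr_ge0// ltW.
have h3 := energy_le n; rewrite -/S in h3.
move: h1 h2 h3; rewrite -/E.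
move: (\int[mu4]_z (g z * _))%E (\int[mu4]_z (eindic Om z * _))%E => A B h1 h2 h3.
have : (S%:E <= 2%:E * (t%:E * E + (4 * t)^-1%:E * (4 * capconst * S)%:E))%E.
  apply: (le_trans h1); apply: lee_wpmul2l => //; apply: (le_trans h2).
  apply: leeD => //; apply: lee_wpmul2l => //.
  by rewrite lee_fin invr_ge0 mulr_ge0// ltW.
move: E E0 {h1 h2 h3 EE} => E E0 H.
case: E E0 H => [e| |//]; last first.
  by move=> _ _; rewrite gt0_muley ?leey// lte_fin mulr_gt0// exprn_gt0.
rewrite lee_fin => e0.
rewrite -[leRHS]/((2 * (t * e + (4 * t)^-1 * (4 * capconst * S)))%:E).
rewrite -[X in _ -> (_ <= X)%E]/((2 ^+ 4 * capconst * e)%:E) !lee_fin.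
have -> : (4 * t)^-1 * (4 * capconst * S) = S / 4.
  by rewrite /t; field; rewrite gt_eqF.
rewrite /t; lra.
Qed.

End capacity.

(** * Decreasing rearrangement *)

Section layer_cake.
Context {R : realType} d (T : measurableType d).
Variable m : {sigma_finite_measure set T -> \bar R}.
Variable f : T -> \bar R.
Hypotheses (mf : measurable_fun setT f) (f0 : forall x, (0 <= f x)%E).
Local Notation leb := (@lebesgue_measure R).

Definition hypograph : set (T * measurableTypeR R) :=
  [set p | 0 < p.2 /\ (p.2%:E < f p.1)%E].

Lemma measurable_hypograph : measurable hypograph.
Proof.
have m1 : measurable_fun setT (fun p : T * measurableTypeR R => f p.1 - (p.2 : R)%:E)%E.
  apply: emeasurable_funB; first exact: (measurableT_comp mf measurable_fst).
  by apply/measurable_EFinP; exact: measurable_snd.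
rewrite (_ : hypograph = (snd @^-1` `]0, +oo[%classic) `&`
   (setT `&` [set p | (0 < f p.1 - (p.2 : R)%:E)%E])); last first.
  apply/seteqP; split=> [p [h1 h2]|p].
    split; first by rewrite /= in_itv/= andbT.
    by split; [exact: I|rewrite /mkset sube_gt0].
  move=> [h1 [_ h2]]; split; first by move: h1; rewrite /= in_itv/= andbT.
  by move: h2; rewrite /mkset sube_gt0.
apply: measurableI.
  by rewrite -[X in measurable X]setTI; apply: measurable_snd => //; exact: measurable_itv.
by apply: emeasurable_fun_o_infty.
Qed.

(** The measure of the region under the graph, computed by sections in both
    orders. *)
Lemma layer_cake : (\int[m]_x f x =
  \int[leb]_(s in `]0%R, +oo[) m [set x | s%:E < f x])%E.
Proof.
have mh := measurable_hypograph.
transitivity (\int[m]_x \int[leb]_s (\1_hypograph (x, s))%:E)%E.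
  apply: eq_integral => x _.
  transitivity (leb [set s : R | 0 < s /\ (s%:E < f x)%E]); last first.
    rewrite -[RHS]/(\int[leb]_s (\1_[set s : R | 0 < s /\ (s%:E < f x)%E] s)%:E)%E.
    rewrite integral_indic ?setIT//.
    have := measurable_xsection x mh; congr measurable.
    by apply/seteqP; split=> s; rewrite /xsection /= inE.
  case: (f x) (f0 x) => [r| |//]; last first.
    move=> _; rewrite (_ : [set _ | _] = `]0, +oo[%classic).
      by rewrite lebesgue_measure_itv/= ltry.
    apply/seteqP; split=> s; rewrite /= in_itv/= andbT; first by case.
    by move=> s0; split => //; rewrite ltry.
  rewrite lee_fin => r0; rewrite (_ : [set _ | _] = `]0, r[%classic).
    rewrite lebesgue_measure_itv/= lte_fin; case: ltP => // h.
      by rewrite oppr0 adde0.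
    by congr (_%:E); apply/eqP; rewrite eq_le h r0.
  apply/seteqP; split=> s; rewrite /= in_itv/= lte_fin; last by move/andP.
  by move=> [-> ->].
rewrite (fubini_tonelli (fun p : T * measurableTypeR R => (\1_hypograph p)%:E)); last 2 first.
- by apply/measurable_EFinP; exact: measurable_indic.
- by move=> p; rewrite lee_fin indicE.
rewrite [RHS]integral_mkcond; apply: eq_integral => s _.
rewrite patchE; case: ifPn => [|].
  rewrite inE/= in_itv/= andbT => s0.
  rewrite -[LHS]/(\int[m]_x (\1_[set x | hypograph (x, s)] x)%:E)%E.
  rewrite integral_indic//; last first.
    by have := measurable_ysection s mh; congr measurable;
      apply/seteqP; split=> x; rewrite /ysection /= inE.
  by rewrite setIT; congr (m _); apply/seteqP; split=> x /=; [case|split].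
rewrite notin_setE/= in_itv/= andbT => s0.
by rewrite integral0_eq// => x _; rewrite indicE memNset//= => -[].
Qed.

Lemma measurable_layer :
  measurable_fun (`]0, +oo[%classic : set (measurableTypeR R))
    (fun s : measurableTypeR R => m [set x | (s%:E < f x)%E]).
Proof.
apply: (eq_measurable_fun (m \o ysection hypograph)).
  move=> s; rewrite inE/= in_itv/= andbT => s0; congr (m _).
  by apply/seteqP; split=> x; rewrite /ysection/= inE; [case|split].
apply: measurable_funTS; apply: measurable_fun_ysection; exact: measurable_hypograph.
Qed.

End layer_cake.

Lemma layer_cake_le (R : realType) d1 d2 (T1 : measurableType d1) (T2 : measurableType d2)
    (m1 : {sigma_finite_measure set T1 -> \bar R})
    (m2 : {sigma_finite_measure set T2 -> \bar R}) f1 f2 :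
  measurable_fun setT f1 -> (forall x, (0 <= f1 x)%E) ->
  measurable_fun setT f2 -> (forall x, (0 <= f2 x)%E) ->
  (forall s : R, (0 < s)%R ->
    m1 [set x | s%:E < f1 x] <= m2 [set x | s%:E < f2 x])%E ->
  (\int[m1]_x f1 x <= \int[m2]_x f2 x)%E.
Proof.
move=> mf1 f10 mf2 f20 le12; rewrite !layer_cake//.
apply: ge0_le_integral => //.
- exact: measurable_layer.
- exact: measurable_layer.
- by move=> s; rewrite /= in_itv/= andbT => /le12.
Qed.

Section rearrangement.
Context {R : realType}.
Local Notation leb := (@lebesgue_measure R).
Variables (Om : set (R4 R)) (g : R4 R -> \bar R).
Hypotheses (mOm : measurable (Om : set (R4L R))) (mg : lebesgue_measurable_fun Om g).
Hypotheses (g0 : forall x, Om x -> (0 <= g x)%E).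

Lemma leb4_sigma_finite : sigma_finite setT (leb4 R).
Proof.
have := @completed_measure_extension_sigma_finite _ _ R (borel_leb4 R).
by apply; exact: (sigma_finiteT mu4).
Qed.

(** A copy of [leb4] that carries its sigma-finiteness as a structure. *)
Definition sleb4 : set (R4L R) -> \bar R := leb4 R.
HB.instance Definition _ := Measure.on sleb4.
HB.instance Definition _ := Measure_isSigmaFinite.Build _ _ _ sleb4 leb4_sigma_finite.

Lemma measurable_restrict4 (A : set (R4 R)) : measurable (A : set (R4L R)) -> A `<=` Om ->
  @measurable_fun _ _ (R4L R) _ setT ((g : R4L R -> _) \_ A).
Proof. by move=> mA AO; apply/(measurable_restrictT _ mA); exact: measurable_funS mOm AO mg. Qed.

Lemma restrict4_ge0 (A : set (R4 R)) x : A `<=` Om -> (0 <= ((g : R4L R -> _) \_ A) x)%E.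
Proof. by move=> AO; rewrite patchE; case: ifPn => // /set_mem /AO /g0. Qed.

Lemma superlevel_restrict4 (A : set (R4 R)) s : 0 < s ->
  [set x | (s%:E < ((g : R4L R -> _) \_ A) x)%E] = A `&` [set x | (s%:E < g x)%E].
Proof.
move=> s0; apply/seteqP; split=> x /=; rewrite patchE.
  by case: ifPn => [/set_mem|_]; [|rewrite lte_fin ltNge (ltW s0)].
by move=> [Ax h]; rewrite mem_set.
Qed.

Local Notation gs := (rearr Om g).

Lemma rearr_ge0 t : (0 <= gs t)%E.
Proof. by apply: le_ereal_inf_tmp => _ [s [s0 _] <-]; rewrite lee_fin ltW. Qed.

Lemma rearr_nincr t1 t2 : t1 <= t2 -> (gs t2 <= gs t1)%E.
Proof.
move=> t12; apply: le_ereal_inf => _ [s [s0 h] <-]; exists s => //; split => //.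
by rewrite (lt_le_trans h)// lee_fin.
Qed.

Lemma measurable_rearr : measurable_fun setT (gs : measurableTypeR R -> \bar R).
Proof.
apply: (measurability _ (ErealGenOInfty.measurableE R)) => _ [_ [a ->] <-].
rewrite setTI; apply: is_interval_measurable => x y /= hx hy z /andP[xz zy].
move: hy; rewrite /= !in_itv/= !andbT => hy.
by apply: (lt_le_trans hy); exact: rearr_nincr.
Qed.

Lemma rearr_lt t s : 0 < s -> (s%:E < gs t)%E -> (t%:E <= alpha Om g s)%E.
Proof.
move=> s0 h; rewrite leNgt; apply/negP => at_.
by move: h; rewrite ltNge => /negP; apply; apply: ereal_inf_lbound; exists s.
Qed.

Lemma measurable_superlevel (A : set (R4 R)) s : measurable (A : set (R4L R)) ->
  A `<=` Om -> measurable ((A `&` [set x | (s%:E < g x)%E]) : set (R4L R)).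
Proof.
move=> mA AO; have mgA : lebesgue_measurable_fun A g by exact: measurable_funS mOm AO mg.
exact: (@emeasurable_fun_o_infty _ (R4L R) R A g mA mgA).
Qed.

Lemma alphaE s : alpha Om g s = leb4 R (Om `&` [set x | (s%:E < g x)%E]).
Proof.
rewrite /alpha; congr (leb4 R _); apply/seteqP; split=> x [/= Ox h]; split => //=.
  by move: h; rewrite gee0_abs// g0.
by rewrite gee0_abs// g0.
Qed.

Lemma alpha_nincr s1 s2 : s1 <= s2 -> (alpha Om g s2 <= alpha Om g s1)%E.
Proof.
move=> s12; rewrite !alphaE; apply: le_measure; rewrite ?inE;
  try exact: measurable_superlevel.
by move=> x [/= Ox h]; split => //=; apply: le_lt_trans h; rewrite lee_fin.
Qed.

Lemma rearr_ge t s : 0 < s -> (t%:E <= alpha Om g s)%E -> (s%:E <= gs t)%E.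
Proof.
move=> s0 h; apply: le_ereal_inf_tmp => _ [r [r0 hr] <-]; rewrite lee_fin leNgt.
apply/negP => rs; have := alpha_nincr (ltW rs); rewrite leNgt => /negP; apply.
exact: lt_le_trans hr h.
Qed.

(** This is t times [rearr_avg Om g t]. *)
Definition int_rearr (t : R) : \bar R := (\int[leb]_(s in `]0%R, t[) gs s)%E.

Lemma int_rearr_ge0 t : (0 <= int_rearr t)%E.
Proof. by apply: integral_ge0 => s _; exact: rearr_ge0. Qed.

Lemma leb_itv0 b : 0 <= b -> leb (`]0, b[%classic : set R) = b%:E.
Proof.
move=> b0; rewrite lebesgue_measure_itv/= lte_fin; case: ltP => h; first by rewrite oppr0 adde0.
by congr (_%:E); apply/eqP; rewrite eq_le h b0.
Qed.

Lemma leb_itvco s t : s <= t -> leb (`[s, t[%classic : set R) = (t - s)%:E.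
Proof.
move=> st; rewrite lebesgue_measure_itv/= lte_fin; case: ltP => h; first by rewrite -EFinB.
by congr (_%:E); apply/esym/eqP; rewrite subr_eq0 eq_le h st.
Qed.

Lemma int_rearr_ge s : 0 < s -> (s%:E * gs s <= int_rearr s)%E.
Proof.
move=> s0; have -> : (s%:E * gs s = \int[leb]_(x in `]0%R, s[) cst (gs s) x)%E.
  rewrite integral_cst// muleC; congr (_ * _)%E; apply/esym; exact: leb_itv0 (ltW s0).
apply: ge0_le_integral => //.
- by move=> x _; exact: rearr_ge0.
- by apply: measurable_funTS; exact: measurable_rearr.
- by move=> x; rewrite /= in_itv/= => /andP[_ xs]; apply: rearr_nincr; exact: ltW.
Qed.

(** The mean value over (0, t) of a nonincreasing function is nonincreasing
    in t. *)
Lemma int_rearr_ratio s t : 0 < s -> s <= t -> (int_rearr t <= (t / s)%:E * int_rearr s)%E.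
Proof.
move=> s0 st.
have -> : (int_rearr t = int_rearr s + \int[leb]_(x in `[s, t[) gs x)%E.
  rewrite /int_rearr -ge0_integral_setU//=.
  - congr (integral _ _ _); apply/seteqP; split=> x; rewrite /= !in_itv/=.
      by move=> /andP[x0 xt]; have [xs|sx] := ltP x s; [left|right]; apply/andP.
    by case=> /andP[h1 h2]; apply/andP; split => //; lra.
  - by apply: measurable_funTS; exact: measurable_rearr.
  - by move=> x _; exact: rearr_ge0.
  - apply/disj_setPS => x [] /=; rewrite !in_itv/= => /andP[_ h1] /andP[h2 _].
    by move: (lt_le_trans h1 h2); rewrite ltxx.
have h : (\int[leb]_(x in `[s, t[) gs x <= (t - s)%:E * gs s)%E.
  have -> : ((t - s)%:E * gs s = \int[leb]_(x in `[s, t[) cst (gs s) x)%E.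
    rewrite integral_cst// muleC; congr (_ * _)%E; apply/esym; exact: leb_itvco.
  apply: ge0_le_integral => //.
  - by move=> x _; exact: rearr_ge0.
  - by apply: measurable_funTS; exact: measurable_rearr.
  - by move=> x; rewrite /= in_itv/= => /andP[sx _]; exact: rearr_nincr.
have G0 := int_rearr_ge0 s.
have -> : ((t / s)%:E * int_rearr s = int_rearr s + ((t - s) / s)%:E * int_rearr s)%E.
  have -> : t / s = 1 + (t - s) / s by field; rewrite gt_eqF.
  by rewrite EFinD ge0_muleDl ?mul1e// lee_fin divr_ge0 ?subr_ge0// ltW.
apply: leeD => //; apply: (le_trans h).
have -> : (t - s)%:E = (((t - s) / s)%:E * s%:E)%E by rewrite -EFinM divfK// gt_eqF.
rewrite -muleA; apply: lee_wpmul2l; last exact: int_rearr_ge.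
by rewrite lee_fin divr_ge0 ?subr_ge0// ltW.
Qed.

(** The inequality of Hardy and Littlewood, by comparison of the measures of
    superlevel sets. Up to the measure of a superlevel set the rearrangement
    is at least the level, but not necessarily greater; the factor 2 makes
    this strict and is harmless here. *)
Lemma integral_le_rearr (A : set (R4 R)) a : measurable (A : set (R4L R)) -> A `<=` Om ->
  0 <= a -> leb4 R A = a%:E ->
  (\int[leb4 R]_(x in (A : set (R4L R))) g x <= 2%:E * int_rearr a)%E.
Proof.
move=> mA AO a0 Aa; rewrite /int_rearr -ge0_integralZl//; last 2 first.
- by apply: measurable_funTS; exact: measurable_rearr.
- by move=> s _; exact: rearr_ge0.
rewrite [leLHS]integral_mkcond [leRHS]integral_mkcond.
have mI : measurable (`]0, a[%classic : set (measurableTypeR R)) by exact: measurable_itv.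
have m2 : measurable_fun setT ((fun s : measurableTypeR R => 2%:E * gs s)%E \_ `]0, a[).
  apply/(measurable_restrictT _ mI); apply: emeasurable_funM => //.
  by apply: measurable_funTS; exact: measurable_rearr.
apply: (@layer_cake_le R _ _ (R4L R) (measurableTypeR R) sleb4 leb _ _
  (measurable_restrict4 mA AO) (fun x => restrict4_ge0 x AO) m2).
  by move=> s; rewrite patchE; case: ifPn => // _; rewrite mule_ge0// rearr_ge0.
move=> s s0; rewrite superlevel_restrict4//.
have mS := measurable_superlevel s mA AO.
have le_a : (leb4 R (A `&` [set x | (s%:E < g x)%E]) <= a%:E)%E.
  by rewrite -Aa; apply: le_measure; rewrite ?inE// => x [].
have le_al : (leb4 R (A `&` [set x | (s%:E < g x)%E]) <= alpha Om g s)%E.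
  rewrite alphaE; apply: le_measure; rewrite ?inE//.
    exact: measurable_superlevel.
  by move=> x [/AO ? ?].
rewrite -[leLHS]/(leb4 R (A `&` [set x | (s%:E < g x)%E])).
have b0 : (0 <= leb4 R (A `&` [set x | (s%:E < g x)%E]))%E by exact: measure_ge0.
move: (leb4 R (A `&` _)) le_a le_al b0 => [b| |//]; last by rewrite leye_eq.
rewrite !lee_fin => ba bal b0; rewrite -(leb_itv0 b0).
apply: le_measure; rewrite ?inE; first exact: measurable_itv.
  by rewrite -[X in measurable X]setTI; exact: emeasurable_fun_o_infty.
move=> t; rewrite /= in_itv/= => /andP[t0 tb].
rewrite patchE mem_set; last by rewrite /= in_itv/= t0 (lt_le_trans tb).
have : (s%:E <= gs t)%E.
  by apply: rearr_ge => //; apply: le_trans bal; rewrite lee_fin ltW.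
case: (gs t) => [y| |//]; last by move=> _; rewrite gt0_muley ?ltry// lte_fin.
by rewrite lee_fin -EFinM lte_fin; lra.
Qed.

(** The inequality of Hardy and Littlewood is reversed on a set comparable by
    inclusion with every superlevel set of g. *)
Lemma rearr_le_integral (A : set (R4 R)) a : measurable (A : set (R4L R)) -> A `<=` Om ->
  0 <= a -> leb4 R A = a%:E ->
  (forall s, 0 < s -> A `<=` [set x | (s%:E < g x)%E] \/
    Om `&` [set x | (s%:E < g x)%E] `<=` A) ->
  (int_rearr a <= \int[leb4 R]_(x in (A : set (R4L R))) g x)%E.
Proof.
move=> mA AO a0 Aa nest; rewrite /int_rearr.
rewrite [leLHS]integral_mkcond [leRHS]integral_mkcond.
have mI : measurable (`]0, a[%classic : set (measurableTypeR R)) by exact: measurable_itv.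
pose F : measurableTypeR R -> \bar R := (gs : measurableTypeR R -> _) \_ `]0, a[.
have m2 : measurable_fun setT F.
  apply/(measurable_restrictT _ mI).
  by apply: measurable_funTS; exact: measurable_rearr.
apply: (@layer_cake_le R _ _ (measurableTypeR R) (R4L R) leb sleb4 _ _
  m2 _ (measurable_restrict4 mA AO) (fun x => restrict4_ge0 x AO)).
  by move=> s; rewrite /F patchE; case: ifPn => // _; rewrite rearr_ge0.
move=> s s0; rewrite superlevel_restrict4//.
rewrite -[leRHS]/(leb4 R (A `&` [set x | (s%:E < g x)%E])).
have mS : measurable [set t : measurableTypeR R | (s%:E < F t)%E].
  by rewrite -[X in measurable X]setTI; exact: emeasurable_fun_o_infty.
have sub t : (s%:E < F t)%E ->
    0 < t < a /\ (t%:E <= alpha Om g s)%E.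
  rewrite /F patchE; case: ifPn => [/set_mem|_]; last by rewrite lte_fin ltNge (ltW s0).
  by rewrite /= in_itv/= => h1 h2; split => //; exact: rearr_lt.
have [As|sA] := nest _ s0.
  have -> : A `&` [set x | (s%:E < g x)%E] = A by apply/setIidPl.
  rewrite Aa -(leb_itv0 a0); apply: le_measure; rewrite ?inE//.
  by move=> t /sub[]; rewrite /= in_itv.
have -> : leb4 R (A `&` [set x | (s%:E < g x)%E]) = alpha Om g s.
  rewrite alphaE; congr (leb4 R _); apply/seteqP; split=> x [h1 h2]; split => //.
    exact: AO.
  by apply: sA.
have al0 : (0 <= alpha Om g s)%E by rewrite alphaE; exact: measure_ge0.
move: (alpha Om g s) sub al0 => [b| |//] sub al0; last exact: leey.
have -> : b%:E = leb (`]0, b]%classic : set R).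
  rewrite lebesgue_measure_itv/= lte_fin; case: ltP => h; first by rewrite oppr0 adde0.
  by congr (_%:E); apply/eqP; rewrite eq_le h.
apply: le_measure; rewrite ?inE//.
by move=> t /sub[/andP[h1 _]]; rewrite /= in_itv/= h1 lee_fin.
Qed.

End rearrangement.

(** * Weights in M log L are admissible *)

Lemma dyadic_level_ex (R : realType) (lam y : R) n : lam < y -> y <= lam * 2 ^+ n ->
  exists k : 'I_n, lam * 2 ^+ k < y /\ y <= 2 * (lam * 2 ^+ k).
Proof.
move=> ly; elim: n => [|n IH]; first by rewrite expr0 mulr1 leNgt ly.
move=> yn; have [h|h] := leP y (lam * 2 ^+ n).
  by have [k hk] := IH h; exists (widen_ord (leqnSn n) k).
by exists ord_max; split => //=; rewrite exprS in yn; lra.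
Qed.

Section sufficiency.
Context {R : realType}.
Local Notation X4 := (R4 (measurableTypeR R)).
Local Notation leb := (@lebesgue_measure R).
Variables (Om : set (R4 R)) (g : R4 R -> \bar R).
Hypotheses (oOm : open Om) (mg : lebesgue_measurable_fun Om g).
Hypotheses (g0 : forall x, Om x -> (0 <= g x)%E).
Variable M : R.
Hypotheses (M0 : 0 < M) (muOm : leb4 R Om = M%:E).

Let mOm : measurable (Om : set (R4L R)).
Proof. by apply: measurable_R4L; exact: open_measurable4. Qed.

Lemma MlogL_int_rearr : MlogL Om g -> exists2 K : R, 0 <= K &
  forall t, 0 < t < M -> ((ln (M / t))%:E * int_rearr Om g t <= K%:E)%E.
Proof.
move=> [_ _]; rewrite muOm /=.
set S := ereal_sup _ => Soo.
have ub t : 0 < t < M -> ((ln (M / t))%:E * int_rearr Om g t <= S)%E.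
  move=> /andP[t0 tM]; apply: ereal_sup_ubound; exists t; first by split; rewrite ?lte_fin.
  rewrite /rearr_avg muleA -EFinM; congr (_%:E * _)%E.
  by rewrite mulrAC mulfV ?mul1r// gt_eqF.
have M_gt0 := M0; have M2 : 0 < M / 2 < M by apply/andP; split; lra.
have S0 : (0 <= S)%E.
  apply: le_trans (ub _ M2); rewrite mule_ge0 ?int_rearr_ge0// lee_fin.
  rewrite ln_ge0//; case/andP: M2 => h1 h2; rewrite ler_pdivlMr// mul1r; lra.
move: S Soo S0 ub => [K _ K0 ub|//|//].
by exists K.
Qed.

(** For sets of measure a with ln (M / a) >= 1 this is [integral_le_rearr].
    For larger sets the total mass of g suffices: [int_rearr_ratio] bounds it
    by the value at M / 4. *)
Lemma MlogL_mass : MlogL Om g -> exists2 K : R, 0 <= K &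
  forall (A : set (R4 R)) a, measurable (A : set (R4L R)) -> A `<=` Om ->
    0 < a -> a <= M -> leb4 R A = a%:E ->
    (\int[leb4 R]_(x in (A : set (R4L R))) g x <= (K * inv_log M a)%:E)%E.
Proof.
move=> /MlogL_int_rearr [K0 K00 HK]; have M_gt0 := M0.
have l4 : 0 < ln 4 :> R by rewrite ln_gt0// ltr1n.
have GM : (int_rearr Om g M <= (4 * (K0 / ln 4))%:E)%E.
  apply: (@le_trans _ _ ((M / (M / 4))%:E * int_rearr Om g (M / 4))%E).
    by apply: int_rearr_ratio; lra.
  have -> : M / (M / 4) = 4 by field; rewrite gt_eqF.
  rewrite EFinM; apply: lee_wpmul2l => //.
  have /HK : 0 < M / 4 < M by apply/andP; split; lra.
  have -> : M / (M / 4) = 4 by field; rewrite gt_eqF.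
  by rewrite EFinM lee_pdivlMr// muleC.
have GMo : (\int[leb4 R]_(x in (Om : set (R4L R))) g x <= (8 * (K0 / ln 4))%:E)%E.
  apply: (le_trans (integral_le_rearr mOm mg g0 mOm (@subset_refl _ _) (ltW M0) muOm)).
  have -> : 8 * (K0 / ln 4) = 2 * (4 * (K0 / ln 4)) by ring.
  by rewrite [leRHS]EFinM; apply: lee_wpmul2l.
have KL : 0 <= K0 / ln 4 by rewrite divr_ge0// ltW.
(* 1 + ln (M / a) is at most 2 ln (M / a) when ln (M / a) >= 1, and at most 2
   otherwise; the two summands serve these two cases. *)
exists (4 * K0 + 16 * (K0 / ln 4)); first by rewrite addr_ge0// mulr_ge0.
move=> A a mA AO a0 aM Aa.
have l0 : 0 <= ln (M / a) by rewrite ln_ge0// ler_pdivlMr// mul1r.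
have l1 : 0 < 1 + ln (M / a) by lra.
have [h|h] := leP 1 (ln (M / a)).
  have aM' : 0 < a < M.
    rewrite a0 lt_neqAle aM andbT; apply/eqP => aE; move: h.
    by rewrite aE divff ?gt_eqF// ln1; lra.
  have := HK _ aM'; have lp : 0 < ln (M / a) by lra.
  rewrite muleC -lee_pdivlMr// -EFinM => Ga.
  apply: (le_trans (integral_le_rearr mOm mg g0 mA AO (ltW a0) Aa)).
  apply: (@le_trans _ _ (2%:E * (K0 * (ln (M / a))^-1)%:E)%E); first by apply: lee_wpmul2l.
  rewrite -EFinM lee_fin /inv_log.
  apply: (@le_trans _ _ (4 * K0 * (1 + ln (M / a))^-1)); last first.
    by apply: ler_wpM2r; [rewrite invr_ge0 ltW|rewrite lerDl mulr_ge0].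
  rewrite mulrA ler_pdivrMr// mulrAC ler_pdivlMr//.
  have := ler_wpM2l K00 h; lra.
apply: (@le_trans _ _ (\int[leb4 R]_(x in (Om : set (R4L R))) g x)%E).
  exact: ge0_subset_integral.
apply: (le_trans GMo); rewrite lee_fin /inv_log ler_pdivlMr//.
have : 8 * (K0 / ln 4) * (1 + ln (M / a)) <= 8 * (K0 / ln 4) * 2.
  by apply: ler_wpM2l; [rewrite mulr_ge0|lra].
lra.
Qed.

Variable D : R.
Hypotheses (D0 : 0 < D) (MD : M <= D ^+ 4).
Hypothesis OmD : forall y z, Om y -> Om z -> `|y - z| < D.

(** Where lam 2^k < |f| <= lam 2^(k+1), f^2 is at most 4 (lam 2^k)^2, so
    [MlogL_mass] and [hansson] bound the integral over |f| > lam uniformly in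
    lam. Where |f| <= lam the integral is at most lam^2 times the mass of g,
    and lam tends to 0. *)
Lemma weighted_le_test_function : MlogL Om g -> exists2 C : R, 0 < C &
  forall f, test_function Om f ->
   (\int[leb4 R]_(x in (Om : set (R4L R))) (g x * (f x ^+ 2)%:E) <= C%:E * sq_int Om (laplacian f))%E.
Proof.
move=> Mg; have [K K0 HK] := MlogL_mass Mg.
have mOmB := open_measurable4 oOm.
have muOmB : mu4 (Om : set X4) = M%:E by rewrite -leb4E.
have cc : 0 < capconst M D by exact: capconst_gt0.
exists (4 * (K + 1) * (2 ^+ 4 * capconst M D)); first by rewrite !mulr_gt0 ?exprn_gt0//; lra.
move=> f [sf cf sOm]; have csf : csmooth f by split.
have fOm x : f x != 0 -> Om x by move=> fx; apply: sOm; exact: subset_closure.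
have lOm x : laplacian f x != 0 -> Om x.
  move=> /eqP lx; apply: sOm; apply: contrapT => nx; apply: lx; exact: laplacian_off_supp.
have cf0 := smooth_continuous sf.
have -> : sq_int Om (laplacian f) = (\int[mu4]_(z in (Om : set X4)) (laplacian f z ^+ 2)%:E)%E.
  apply: ge0_integral_leb4 => //.
  - apply/measurable_EFinP; apply: measurable_funX; apply: measurable_funTS.
    by apply: continuous_measurable4; exact: continuous_laplacian.
  - by move=> x _; rewrite lee_fin sqr_ge0.
set E := (\int[mu4]_(z in _) _)%E.
have mgA (A : set (R4 R)) : measurable (A : set (R4L R)) -> A `<=` Om ->
  @measurable_fun _ _ (R4L R) _ A g by move=> mA AO; exact: measurable_funS mOm AO mg.
have main lam : 0 < lam ->
  (\int[leb4 R]_(x in (Om : set (R4L R))) (g x * (f x ^+ 2)%:E) <=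
    (lam ^+ 2 * K)%:E + (4 * K)%:E * ((2 ^+ 4 * capconst M D)%:E * E))%E.
  move=> lam0.
  have [r [B [_ B0 fB _]]] := csmooth_bound csf.
  have [n nB] : exists n : nat, B <= lam * 2 ^+ n.
    exists (Num.trunc (B / lam)).+1.
    have /andP[_] := truncn_itv (ltW (divr_gt0 B0 lam0)); set n := (Num.trunc _).+1 => h.
    rewrite mulrC -ler_pdivrMr//; apply: (le_trans (ltW h)).
    by rewrite -natrX ler_nat ltnW// ltn_expl.
  pose A k : set (R4 R) := level_set f lam k.
  have mA k : measurable (A k : set (R4L R)).
    by apply: measurable_R4L; exact: measurable_level_set.
  have AO k : A k `<=` Om by exact: level_set_sub.
  have Ag k : (\int[leb4 R]_(x in (A k : set (R4L R))) g x <=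
      (K * (mass (A k) * equi_dens M (A k)))%:E)%E.
    have mAB : measurable (A k : set X4) by exact: measurable_level_set.
    have [muA /andP[m0 mM]] := massE mOmB muOmB mAB (AO k).
    have [mz|mn0] := eqVneq (mass (A k)) 0.
      rewrite null_set_integral//; first by rewrite lee_fin mulr_ge0// mz mul0r.
        by apply: mgA.
      by rewrite leb4E// muA mz.
    have mp : 0 < mass (A k) by rewrite lt_neqAle eq_sym mn0.
    have -> : mass (A k) * equi_dens M (A k) = inv_log M (mass (A k)).
      by rewrite /equi_dens mulrA mulfV// mul1r.
    apply: HK => //.
    by rewrite leb4E.
  pose c k : R := 4 * (lam * 2 ^+ k) ^+ 2.
  have c0 k : 0 <= c k by rewrite mulr_ge0// sqr_ge0.
  pose gA k : R4L R -> \bar R := (g : R4L R -> _) \_ (A k).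
  have gA0 k x : Om x -> (0 <= gA k x)%E.
    by move=> Ox; rewrite /gA patchE; case: ifPn => // _; exact: g0.
  have mgAk k : @measurable_fun _ _ (R4L R) _ Om (gA k).
    apply: measurable_funTS; apply/(measurable_restrictT _ (mA k)).
    exact: mgA.
  have mcg k : @measurable_fun _ _ (R4L R) _ Om (fun x => (c k)%:E * gA k x)%E.
    exact: emeasurable_funM (measurable_cst _) (mgAk k).
  have cg0 k x : Om x -> (0 <= (c k)%:E * gA k x)%E.
    by move=> Ox; apply: mule_ge0; [rewrite lee_fin|exact: gA0].
  have lg0 x : Om x -> (0 <= (lam ^+ 2)%:E * g x)%E.
    by move=> Ox; apply: mule_ge0; [rewrite lee_fin sqr_ge0|exact: g0].
  have mlg : @measurable_fun _ _ (R4L R) _ Om (fun x => (lam ^+ 2)%:E * g x)%E.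
    exact: emeasurable_funM (measurable_cst _) mg.
  have msum : @measurable_fun _ _ (R4L R) _ Om (fun x => \sum_(k < n) ((c k)%:E * gA k x))%E.
    by apply: emeasurable_fun_sum => k _; exact: mcg.
  have mf2 : @measurable_fun _ _ (R4L R) _ Om (fun x => (f x ^+ 2)%:E).
    apply: measurable_fun_R4L => //; apply/measurable_EFinP; apply: measurable_funX.
    by apply: measurable_funTS; exact: continuous_measurable4.
  apply: (@le_trans _ _ (\int[leb4 R]_(x in (Om : set (R4L R)))
    ((lam ^+ 2)%:E * g x + \sum_(k < n) ((c k)%:E * gA k x)))%E).
    apply: ge0_le_integral.
    - exact: mOm.
    - by move=> x Ox; apply: mule_ge0; [exact: g0|rewrite lee_fin sqr_ge0].
    - exact: emeasurable_funM mg mf2.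
    - exact: emeasurable_funD mlg msum.
    move=> x Ox; have gx := g0 Ox.
    have s0 : (0 <= \sum_(k < n) ((c k)%:E * gA k x))%E.
      by apply: sume_ge0 => k _; exact: cg0.
    have f2 y : 0 <= y -> `|f x| <= y -> f x ^+ 2 <= y ^+ 2.
      move=> y0 fy; rewrite -real_normK ?num_real//.
      by apply: lerXn2r; rewrite ?nnegrE.
    have [fl|fl] := leP `|f x| lam.
      apply: (@le_trans _ _ ((lam ^+ 2)%:E * g x)%E); last exact: leeDl.
      rewrite muleC; apply: lee_wpmul2r => //; rewrite lee_fin.
      by apply: f2 => //; exact: ltW.
    have [k [k1 k2]] := dyadic_level_ex fl (le_trans (fB x) nB).
    apply: (@le_trans _ _ ((c k)%:E * gA k x)%E).
      have -> : gA k x = g x by rewrite /gA patchE mem_set.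
      rewrite muleC; apply: lee_wpmul2r => //; rewrite lee_fin.
      have -> : c k = (2 * (lam * 2 ^+ k)) ^+ 2 by rewrite exprMn /c; congr (_ * _); ring.
      by apply: f2 => //; rewrite mulr_ge0// mulr_ge0 ?exprn_ge0// ltW.
    rewrite (bigD1 k)//= addeCA; apply: leeDl; rewrite adde_ge0//; first exact: lg0.
    by apply: sume_ge0 => j _; exact: cg0.
  rewrite (@ge0_integralD _ (R4L R) R (leb4 R) Om mOm _ _ lg0 mlg); last 2 first.
  - by move=> x Ox; apply: sume_ge0 => k _; exact: cg0.
  - exact: msum.
  have l20 : (0 <= (lam ^+ 2)%:E)%E by rewrite lee_fin sqr_ge0.
  apply: leeD.
    rewrite (@ge0_integralZl _ (R4L R) R (leb4 R) Om mOm _ mg (lam ^+ 2)%:E g0 l20).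
    rewrite [leRHS]EFinM; apply: lee_wpmul2l; first exact: l20.
    have := HK Om M mOm (@subset_refl _ _) M0 (lexx _) muOm.
    by rewrite /inv_log divff ?gt_eqF// ln1 addr0 invr1 mulr1.
  rewrite (@ge0_integral_sum _ (R4L R) R (leb4 R) Om mOm _ _
    (fun k : 'I_n => mcg k) (fun k x Ox => cg0 k x Ox)).
  apply: (@le_trans _ _ (\sum_(k < n) (4 * K * level_weight M f lam k)%:E)%E).
    apply: lee_sum => k _.
    have ck0 : (0 <= (c k)%:E)%E by rewrite lee_fin.
    rewrite (@ge0_integralZl _ (R4L R) R (leb4 R) Om mOm _ (mgAk k) (c k)%:E
      (fun x Ox => gA0 k x Ox) ck0).
    rewrite /gA -integral_mkcondr (_ : Om `&` A k = A k); last exact/setIidPr.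
    have -> : 4 * K * level_weight M f lam k = c k * (K * (mass (A k) * equi_dens M (A k))).
      by rewrite /level_weight /c -/(A k); move: (mass _) (equi_dens _ _) => m d; ring.
    by rewrite [leRHS]EFinM; apply: lee_wpmul2l.
  rewrite sumEFin -mulr_sumr [leLHS]EFinM; apply: lee_wpmul2l; first by rewrite lee_fin mulr_ge0.
  exact: hansson.
have E0 : (0 <= E)%E by apply: integral_ge0 => x _; rewrite lee_fin sqr_ge0.
have B0 : (0 <= (2 ^+ 4 * capconst M D)%:E * E)%E.
  by rewrite mule_ge0// lee_fin ltW// mulr_gt0// exprn_gt0.
rewrite EFinM -muleA; move: (_ * E)%E B0 main => B B0 main.
case: B B0 main => [b| |//] b0 main; last by rewrite gt0_muley ?leey// lte_fin; lra.
rewrite lee_fin in b0; apply/lee_addgt0Pr => e e0.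
have K1 : 0 < K + 1 by lra.
(* For this lam the contribution of |f| <= lam is at most e. *)
have lam0 : 0 < Num.sqrt (e / (K + 1)) by rewrite sqrtr_gt0 divr_gt0.
apply: (le_trans (main _ lam0)); rewrite sqr_sqrtr; last by rewrite divr_ge0// ltW.
rewrite -!EFinM -!EFinD lee_fin addrC; apply: lerD.
  by apply: ler_wpM2r => //; lra.
by rewrite mulrAC ler_pdivrMr// ler_wpM2l ?ltW//; lra.
Qed.

Lemma sq_int_split (p q : R4 R -> R) : lebesgue_measurable_fun Om p ->
  lebesgue_measurable_fun Om q ->
  (sq_int Om p <= 2%:E * sq_int Om q + 2%:E * sq_int Om (fun x => p x - q x)%R)%E.
Proof.
move=> mp mq; rewrite /sq_int.
have msq (h : R4 R -> R) : lebesgue_measurable_fun Om h ->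
    @measurable_fun _ _ (R4L R) _ Om (fun x => (h x ^+ 2)%:E).
  by move=> mh; apply/measurable_EFinP; exact: measurable_funX.
have mpq : lebesgue_measurable_fun Om (fun x => p x - q x)%R by exact: measurable_funB.
have sq0 (h : R4 R -> R) x : Om x -> (0 <= (h x ^+ 2)%:E)%E by rewrite lee_fin sqr_ge0.
have m2 (h : R4 R -> R) : lebesgue_measurable_fun Om h ->
    @measurable_fun _ _ (R4L R) _ Om (fun x => 2%:E * (h x ^+ 2)%:E)%E.
  by move=> mh; exact: emeasurable_funM (measurable_cst _) (msq _ mh).
have p2 (h : R4 R -> R) x : Om x -> (0 <= 2%:E * (h x ^+ 2)%:E)%E.
  by move=> Ox; apply: mule_ge0 => //; exact: sq0 Ox.
have two0 : (0 <= 2%:E :> \bar R)%E by [].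
rewrite -(@ge0_integralZl _ (R4L R) R (leb4 R) Om mOm _ (msq _ mq) 2%:E (sq0 q) two0).
rewrite -(@ge0_integralZl _ (R4L R) R (leb4 R) Om mOm _ (msq _ mpq) 2%:E
  (sq0 (fun x => p x - q x)%R) two0).
rewrite -(@ge0_integralD _ (R4L R) R (leb4 R) Om mOm _ _ (p2 q) (m2 _ mq)
  (p2 (fun x => p x - q x)%R) (m2 _ mpq)).
apply: ge0_le_integral.
- exact: mOm.
- exact: sq0.
- exact: msq.
- exact: emeasurable_funD (m2 _ mq) (m2 _ mpq).
- move=> x _; rewrite -!EFinM -EFinD lee_fin.
  have := sqr_ge0 (p x - 2 * q x); nra.
Qed.

(** On the set where g <= n the left-hand side is continuous in u for the L^2
    norm, so the inequality for test functions passes to the limit with a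
    constant independent of n. As n grows these sets exhaust Omega up to a
    null set. *)
Lemma admissible_of_MlogL : MlogL Om g -> admissible Om g.
Proof.
move=> Mg; have [C C0 HC] := weighted_le_test_function Mg.
have [_ gfin _] := Mg.
exists (4 * C); first by rewrite mulr_gt0.
move=> u w [mu mw [phi [tphi cu cw]]].
set W := sq_int Om w.
have W0 : (0 <= W)%E by apply: integral_ge0 => x _; rewrite lee_fin sqr_ge0.
pose E n : set (R4 R) := Om `&` [set x | (g x <= n%:R%:E)%E].
have mE n : measurable (E n : set (R4L R)).
  exact: (@emeasurable_fun_infty_c _ (R4L R) R Om g mOm mg).
have mgu : @measurable_fun _ _ (R4L R) _ Om (fun x => g x * (u x ^+ 2)%:E)%E.
  apply: emeasurable_funM; first exact: mg.
  by apply/measurable_EFinP; exact: measurable_funX.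
have gu0 x : Om x -> (0 <= g x * (u x ^+ 2)%:E)%E.
  by move=> Ox; apply: mule_ge0; [exact: g0|rewrite lee_fin sqr_ge0].
have small (v : nat -> \bar R) (e : R) : v k @[k --> \oo] --> 0%E -> 0 < e ->
    \forall k \near \oo, (v k < e%:E)%E.
  move=> cv e0; have h : ereal_nbhs (0 : \bar R)%E (fun z => z < e%:E)%E.
    by apply: open_ereal_lt'; rewrite lte_fin.
  exact: (cv _ h).
have part n : (\int[leb4 R]_(x in (E n : set (R4L R))) (g x * (u x ^+ 2)%:E) <= (4 * C)%:E * W)%E.
  have EO : E n `<=` Om by move=> x [].
  have C40 : 0 < 4 * C by rewrite mulr_gt0.
  have [Woo|Wfin] := eqVneq W +oo%E; first by rewrite Woo gt0_muley ?leey// lte_fin.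
  apply/lee_addgt0Pr => e e0.
  have K0 : 0 < 4 * C + 2 * n%:R by rewrite ltr_wpDr// mulr_ge0.
  (* An error t costs 4 C t through the Laplacian and 2 n t through the function. *)
  pose t := e / (4 * C + 2 * n%:R); have t0 : 0 < t by rewrite divr_gt0.
  have [k _ /(_ k (leqnn k))[/ltW h1 /ltW h2]] := filterI (small _ _ cu t0) (small _ _ cw t0).
  have mphi : lebesgue_measurable_fun Om (phi k).
    apply: measurable_fun_R4L; first exact: open_measurable4.
    apply: measurable_funTS; apply: continuous_measurable4.
    by apply: smooth_continuous; case: (tphi k).
  have mlap : lebesgue_measurable_fun Om (laplacian (phi k)).
    apply: measurable_fun_R4L; first exact: open_measurable4.
    apply: measurable_funTS; apply: continuous_measurable4.
    by apply: continuous_laplacian; case: (tphi k).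
  have h3 := HC _ (tphi k).
  have h4 := sq_int_split mlap mw; rewrite -/W in h4.
  pose F1 x := (g x * (phi k x ^+ 2)%:E)%E.
  pose F2 x := (((phi k x - u x) ^+ 2)%R)%:E.
  have F10 x : Om x -> (0 <= F1 x)%E.
    by move=> Ox; apply: mule_ge0; [exact: g0|rewrite lee_fin sqr_ge0].
  have F20 x : Om x -> (0 <= F2 x)%E by move=> _; rewrite lee_fin sqr_ge0.
  have mF1 : @measurable_fun _ _ (R4L R) _ Om F1.
    apply: emeasurable_funM; first exact: mg.
    by apply/measurable_EFinP; exact: measurable_funX.
  have mF2 : @measurable_fun _ _ (R4L R) _ Om F2.
    by apply/measurable_EFinP; apply: measurable_funX; exact: measurable_funB.
  have two0 : (0 <= 2%:E :> \bar R)%E by [].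
  have n20 : (0 <= (2 * n%:R)%:E :> \bar R)%E by rewrite lee_fin mulr_ge0.
  have mF1' : @measurable_fun _ _ (R4L R) _ Om (fun x => 2%:E * F1 x)%E.
    exact: emeasurable_funM (measurable_cst _) mF1.
  have mF2' : @measurable_fun _ _ (R4L R) _ Om (fun x => (2 * n%:R)%:E * F2 x)%E.
    exact: emeasurable_funM (measurable_cst _) mF2.
  have F10' x : Om x -> (0 <= 2%:E * F1 x)%E by move=> /F10 h; exact: mule_ge0.
  have F20' x : Om x -> (0 <= (2 * n%:R)%:E * F2 x)%E by move=> /F20 h; exact: mule_ge0.
  have step : (\int[leb4 R]_(x in (E n : set (R4L R))) (g x * (u x ^+ 2)%:E) <=
     2%:E * \int[leb4 R]_(x in (Om : set (R4L R))) F1 x +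
     (2 * n%:R)%:E * sq_int Om (fun x => phi k x - u x)%R)%E.
    rewrite -(@ge0_integralZl _ (R4L R) R (leb4 R) Om mOm _ mF1 2%:E F10 two0).
    rewrite -(@ge0_integralZl _ (R4L R) R (leb4 R) Om mOm _ mF2 (2 * n%:R)%:E F20 n20).
    rewrite -(@ge0_integralD _ (R4L R) R (leb4 R) Om mOm _ _ F10' mF1' F20' mF2').
    apply: (@le_trans _ _ (\int[leb4 R]_(x in (E n : set (R4L R)))
       (2%:E * F1 x + (2 * n%:R)%:E * F2 x))%E).
      apply: ge0_le_integral.
      - exact: mE.
      - by move=> x Ex; exact: gu0 (EO _ Ex).
      - exact: measurable_funS mOm EO mgu.
      - exact: measurable_funS mOm EO (emeasurable_funD mF1' mF2').
      - move=> x [Ox gn]; rewrite /F1 /F2.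
        have := g0 Ox; move: gn => /=; case: (g x) => [y| |]; last 2 first.
        - by rewrite leye_eq.
        - by [].
        rewrite !lee_fin => yn y0.
        move: (phi k x) (u x) => p q.
        have d0 := sqr_ge0 (p - q).
        have := ler_wpM2r d0 yn; have := mulr_ge0 y0 (sqr_ge0 (q - 2 * p)).
        nra.
    apply: ge0_subset_integral.
    - exact: mE.
    - exact: mOm.
    - exact: emeasurable_funD mF1' mF2'.
    - by move=> x Ox; exact: adde_ge0 (F10' _ Ox) (F20' _ Ox).
    - exact: EO.
  have Wn : W \is a fin_num by rewrite ge0_fin_numE// ltey.
  rewrite -(fineK Wn) in h4 *; move: (fine W) h4 => w' h4.
  apply: (le_trans step).
  apply: (@le_trans _ _ (2%:E * (C%:E * (2%:E * w'%:E + 2%:E * t%:E)) + (2 * n%:R)%:E * t%:E)%E).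
    apply: leeD; last exact: lee_wpmul2l.
    apply: lee_wpmul2l => //; apply: (le_trans h3).
    apply: lee_wpmul2l; first by rewrite lee_fin ltW.
    apply: (le_trans h4); apply: leeD => //; exact: lee_wpmul2l.
  rewrite -[leLHS]/((2 * (C * (2 * w' + 2 * t)) + 2 * n%:R * t)%:E).
  rewrite -[leRHS]/((4 * C * w' + e)%:E) lee_fin.
  have -> : e = (4 * C + 2 * n%:R) * t by rewrite /t; field; rewrite gt_eqF.
  by rewrite le_eqVlt; apply/orP; left; apply/eqP; ring.
have -> : (\int[leb4 R]_(x in (Om : set (R4L R))) (g x * (u x ^+ 2)%:E) =
   \int[leb4 R]_(x in (\bigcup_n E n : set (R4L R))) (g x * (u x ^+ 2)%:E))%E.
  pose N : set (R4 R) := Om `&` [set x | (+oo <= g x)%E].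
  have mN : measurable (N : set (R4L R)).
    exact: (@emeasurable_fun_c_infty _ (R4L R) R Om g mOm mg).
  have N0 : leb4 R N = 0%E.
    apply: measure_negligible => //; apply: negligibleS gfin.
    by move=> x [Ox /=]; rewrite leye_eq => /eqP gx; move=> /(_ Ox); rewrite gx.
  rewrite (ge0_negligible_integral mN mOm mgu gu0 N0).
  congr (integral _ _ _); apply/seteqP; split=> x.
    move=> [Ox nN]; have gx : (g x < +oo)%E.
      by rewrite ltNge; apply/negP => h; apply: nN.
    have := g0 Ox; move: gx; case gxE : (g x) => [y| |//] // _ y0.
    exists (Num.trunc y).+1 => //; split => //=; rewrite gxE lee_fin.
    by have /andP[_ /ltW] := truncn_itv (y0 : 0 <= y).
  move=> [n _ [Ox gn]]; split => // -[_ /=]; rewrite leye_eq => /eqP gx.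
  by move: gn; rewrite /= gx leye_eq.
have nd : {homo (fun n => E n : set (R4L R)) : n m / (n <= m)%N >-> (n <= m)%O}.
  move=> n m nm; apply/subsetPset => x [Ox h]; split => //=.
  by apply: (le_trans h); rewrite lee_fin ler_nat.
have H := @ge0_nondecreasing_set_cvg_integral _ (R4L R) R _ (fun x => g x * (u x ^+ 2)%:E)%E
  (leb4 R) nd mE (fun n => measurable_funS mOm (@subIsetl _ _ _) mgu) (fun n x Ex => gu0 x (Ex.1)).
rewrite -(cvg_lim _ H)//; apply: lime_le; first by apply/cvg_ex; eexists; exact: H.
by apply: nearW.
Qed.

End sufficiency.

(** * Smooth bumps *)

Section flat_function.
Context {R : realType}.
Implicit Types (s y : R).

Lemma pow_expRN_le (k : nat) y : 0 <= y -> y ^+ k * expR (- y) <= k%:R ^+ k.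
Proof.
move=> y0; case: k => [|k].
  by rewrite expr0 mul1r expr0 expR_le1; lra.
have k0 : (0 : R) < k.+1%:R by rewrite ltr0n.
have h : (y / k.+1%:R) ^+ k.+1 <= expR y.
  have -> : expR y = expR (y / k.+1%:R) ^+ k.+1.
    by rewrite -expRM_natl; congr expR; field; rewrite gt_eqF.
  apply: lerXn2r; rewrite ?nnegrE ?divr_ge0 ?expR_ge0 ?ler0n//.
  by move: (y / k.+1%:R) => z; have := expR_ge1Dx z; lra.
rewrite expRN ler_pdivrMr ?expR_gt0//.
have -> : y ^+ k.+1 = k.+1%:R ^+ k.+1 * (y / k.+1%:R) ^+ k.+1.
  by rewrite -exprMn; congr (_ ^+ _); field; rewrite gt_eqF.
by apply: ler_wpM2l => //; rewrite exprn_ge0// ler0n.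
Qed.

Lemma horner_le (p : {poly R}) : exists2 A : R, 0 <= A &
  forall y, 1 <= y -> `|p.[y]| <= A * y ^+ size p.
Proof.
exists (\sum_(i < size p) `|p`_i|); first by apply: sumr_ge0.
move=> y y1; rewrite horner_coef mulr_suml.
apply: (le_trans (ler_norm_sum _ _ _)); apply: ler_sum => i _.
rewrite normrM; apply: ler_wpM2l => //.
have y0 : 0 <= y by lra.
by rewrite ger0_norm ?exprn_ge0// ler_weXn2l// ltnW.
Qed.

(** The derivative of p(1/s) exp(-1/s) is q(1/s) exp(-1/s) with q = X^2 (p -
    p^`()). *)
Fixpoint flat_poly (n : nat) : {poly R} :=
  if n is m.+1 then 'X^2 * (flat_poly m - (flat_poly m)^`()) else 1.

(** The n-th derivative of the function exp(-1/s) extended by 0. *)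
Definition flat n s : R :=
  if 0 < s then (flat_poly n).[s^-1] * expR (- s^-1) else 0.

Lemma flat_le0 n s : s <= 0 -> flat n s = 0.
Proof. by rewrite /flat leNgt => /negbTE ->. Qed.

(** exp(-1/s) is smaller than any power of s; a quadratic bound is what
    differentiability at 0 requires. *)
Lemma flat_bound n : exists2 C : R, 0 <= C & forall s, s <= 1 -> `|flat n s| <= C * s ^+ 2.
Proof.
have [A A0 HA] := horner_le (flat_poly n).
set m := size (flat_poly n) in HA.
exists (A * m.+2%:R ^+ m.+2); first by rewrite mulr_ge0// exprn_ge0// ler0n.
move=> s s1; have [s0|s0] := leP s 0.
  rewrite flat_le0// normr0 mulr_ge0 ?sqr_ge0// mulr_ge0// exprn_ge0// ler0n.
have y1 : 1 <= s^-1 by rewrite invf_ge1.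
have y0 : 0 <= s^-1 by lra.
rewrite /flat s0 normrM [X in _ * X]ger0_norm ?expR_ge0//.
apply: (@le_trans _ _ (A * s^-1 ^+ m * expR (- s^-1))).
  by apply: ler_wpM2r; [exact: expR_ge0|exact: HA].
have h := pow_expRN_le m.+2 y0.
have -> : A * s^-1 ^+ m * expR (- s^-1) = A * (s^-1 ^+ m.+2 * expR (- s^-1)) * s ^+ 2.
  by rewrite !exprS; field; rewrite gt_eqF.
by apply: ler_wpM2r; [exact: sqr_ge0|exact: ler_wpM2l].
Qed.

Lemma is_derive_flat n s : is_derive s (1 : R) (flat n) (flat n.+1 s).
Proof.
have [s0|s0|->] := ltgtP s 0.
- rewrite [flat n.+1 s]flat_le0 ?ltW//.
  apply: (@near_eq_is_derive _ _ _ (cst (0 : R))).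
  have := lt_nbhsl s0; apply: filterS => t t0.
  by rewrite flat_le0// ltW.
- have H1 : is_derive s (1 : R) (fun t : R => t^-1) (- s ^- 2).
    have := @is_deriveV R id s 1 1 (lt0r_neq0 s0) (is_derive_id _ _).
    by move=> K; apply: (is_derive_eq K); rewrite [_ *: 1]mulr1.
  have H2 := is_derive1_comp (is_derive_poly (flat_poly n) s^-1) H1.
  have H3 := @is_derive1_comp R expR (- (fun t : R => t^-1)) s _ _
    (is_derive_expR (- s^-1)) (is_deriveN H1).
  have H4 := is_deriveM H2 H3.
  apply: (@near_eq_is_derive _ _ _
    ((horner (flat_poly n) \o (fun t : R => t^-1)) * (expR \o (- (fun t : R => t^-1))))).
    have := lt_nbhsr s0; apply: filterS => t t0.
    by rewrite /flat t0.
  apply: (is_derive_eq H4).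
  rewrite /flat s0 /= !hornerE -![_ *: _]/(_ * _) /=.
  by move: (flat_poly n) => p; field; rewrite gt_eqF.
have [C C0 HC] := flat_bound n.
have H : (fun h : R => h^-1 *: ((flat n \o shift 0) (h *: (1 : R)) - flat n 0)) @ 0^' --> (0 : R).
  apply/cvgrPdist_lt => e e0; near=> h.
  have h0 : h != 0 by near: h; exact: nbhs_dnbhs_neq.
  have h1 : `|h| < 1 by near: h; exact: dnbhs0_lt.
  have h2 : `|h| < e / (C + 1) by near: h; apply: dnbhs0_lt; rewrite divr_gt0//; lra.
  rewrite sub0r normrN (flat_le0 n (lexx 0)) subr0 /= addr0 [_%:A]mulr1.
  rewrite -[_ *: _]/(_ * _) normrM normfV.
  have hn : 0 < `|h| by rewrite normr_gt0.
  rewrite mulrC ltr_pdivrMr//.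
  have hle : h <= 1 by rewrite (le_trans (ler_norm h))// ltW.
  apply: (le_lt_trans (HC _ hle)).
  have -> : h ^+ 2 = `|h| * `|h| by rewrite -expr2 real_normK ?num_real.
  rewrite mulrA ltr_pM2r//.
  have C1 : 0 < C + 1 by lra.
  rewrite ltr_pdivlMr// in h2.
  by apply: le_lt_trans h2; rewrite mulrC ler_wpM2l//; lra.
rewrite [flat n.+1 0]flat_le0//; apply: DeriveDef.
  by apply/cvg_ex; exists 0.
exact: cvg_lim.
Unshelve. all: by end_near. Qed.

Lemma continuous_flat n : continuous (flat n).
Proof.
move=> s; apply: differentiable_continuous; apply/derivable1_diffP.
by have [] := is_derive_flat n s.
Qed.

End flat_function.

Section bump_algebra.
Context {R : realType}.
Implicit Types (f : R4 R -> R) (x : R4 R).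

(** This class consists of continuous functions and is stable under partial
    derivatives, so its members are smooth, and no iterated derivative has to
    be computed. *)
Inductive bumpalg : (R4 R -> R) -> Prop :=
| ba_cst c : bumpalg (fun=> c)
| ba_coord i : bumpalg (coord i)
| ba_flat n b : bumpalg (fun x => flat n (1 - b * sqnorm x))
| ba_add f1 f2 : bumpalg f1 -> bumpalg f2 -> bumpalg (fun x => f1 x + f2 x)
| ba_mul f1 f2 : bumpalg f1 -> bumpalg f2 -> bumpalg (fun x => f1 x * f2 x).

Lemma is_derive_flat_sqnorm i n b x : is_derive x (basis4 R i)
  (fun x => flat n (1 - b * sqnorm x)) (- (2 * b * coord i x) * flat n.+1 (1 - b * sqnorm x)).
Proof.
have H : is_derive x (basis4 R i) (fun x => 1 - b * sqnorm x) (- (2 * b * coord i x)).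
  have := is_deriveB (is_derive_cst (1 : R) x (basis4 R i)) (is_deriveZ b (is_derive_sqnorm i x)).
  move=> K; apply: (is_derive_eq K).
  by rewrite sub0r -[_ *: _]/(_ * _) mulrCA mulrA.
have := is_derive_comp1 (is_derive_flat n (1 - b * sqnorm x)) H.
by move=> K; apply: (is_derive_eq K); rewrite mulrC.
Qed.

Lemma bumpalg_derive f i : bumpalg f ->
  exists2 g, bumpalg g & forall x, is_derive x (basis4 R i) f (g x).
Proof.
elim=> [c|j|n b|f1 f2 _ [g1 b1 d1] _ [g2 b2 d2]|f1 f2 a1 [g1 b1 d1] a2 [g2 b2 d2]].
- by exists (fun=> 0); [exact: ba_cst|move=> x; exact: is_derive_cst].
- by exists (fun=> (i == j)%:R); [exact: ba_cst|move=> x; exact: is_derive_coord].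
- exists (fun x => (- (2 * b)) * coord i x * flat n.+1 (1 - b * sqnorm x)).
    apply: ba_mul; last exact: ba_flat.
    by apply: ba_mul; [exact: ba_cst|exact: ba_coord].
  by move=> x; apply: (is_derive_eq (is_derive_flat_sqnorm i n b x)); rewrite !mulNr.
- exists (fun x => g1 x + g2 x); first exact: ba_add.
  by move=> x; exact: is_deriveD.
- exists (fun x => f1 x * g2 x + f2 x * g1 x).
    by apply: ba_add; apply: ba_mul.
  by move=> x; exact: is_deriveM.
Qed.

Lemma bumpalg_continuous f : bumpalg f -> continuous f.
Proof.
elim=> [c|j|n b|f1 f2 _ c1 _ c2|f1 f2 _ c1 _ c2] x.
- exact: cvg_cst.
- exact: continuous_coord.
- apply: (@continuous_comp _ _ _ (fun x => 1 - b * sqnorm x) (flat n)).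
    apply: cvgB; first exact: cvg_cst.
    by apply: cvgM; [exact: cvg_cst|exact: continuous_sqnorm].
  exact: continuous_flat.
- by apply: cvgD; [exact: c1|exact: c2].
- by apply: cvgM; [exact: c1|exact: c2].
Qed.

Lemma bumpalg_partial i f : bumpalg f -> bumpalg (partial i f).
Proof.
move=> /(bumpalg_derive i) [g bg dg].
have -> // : partial i f = g.
by apply/funext => x; exact: (@derive_val _ _ _ _ _ _ _ (dg x)).
Qed.

Lemma bumpalg_smooth f : bumpalg f -> smooth f.
Proof.
move=> bf s; have bs : bumpalg (foldr (@partial R) f s).
  by elim: s => [//|i s IH] /=; exact: bumpalg_partial.
split; first exact: bumpalg_continuous.
by move=> i x; have [g _ dg] := bumpalg_derive i bs; case: (dg x).
Qed.

Lemma bumpalg_sum (F : nat -> R4 R -> R) n : (forall k, bumpalg (F k)) ->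
  bumpalg (fun x => \sum_(k < n) F k x).
Proof.
move=> bF; elim: n => [|n IH].
  rewrite (_ : (fun _ => _) = fun=> 0); first exact: ba_cst.
  by apply/funext => x; rewrite big_ord0.
rewrite (_ : (fun _ => _) = fun x => \sum_(k < n) F k x + F n x); first exact: ba_add.
by apply/funext => x; rewrite big_ord_recr.
Qed.

End bump_algebra.

(** * Averages of bumps over dyadic scales *)

Section log_test_functions.
Context {R : realType}.
Local Notation X4 := (R4 (measurableTypeR R)).
Implicit Types (f : R4 R -> R) (x : R4 R).

Lemma is_derive_csum i n (c : R) (F : 'I_n -> R4 R -> R) (dF : 'I_n -> R) x :
  (forall k, is_derive x (basis4 R i) (F k) (dF k)) ->
  is_derive x (basis4 R i) (fun x => c * \sum_(k < n) F k x) (c * \sum_(k < n) dF k).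
Proof.
move=> dFk; have := is_deriveZ c (is_derive_sum dFk).
rewrite (_ : _ \*: _ = fun x => c * \sum_(k < n) F k x)//.
by apply/funext => z /=; rewrite fct_sumE.
Qed.

(** A sum of radial bumps supported in the Euclidean balls of radius (b
    k)^(-1/2). *)
Definition bumps n (c : R) (b : nat -> R) x : R :=
  c * \sum_(k < n) flat 0 (1 - b k * sqnorm x).

(** The Laplacian of a single bump. *)
Definition bump_lap (b : R) x : R :=
  4 * b ^+ 2 * sqnorm x * flat 2 (1 - b * sqnorm x) - 8 * b * flat 1 (1 - b * sqnorm x).

Lemma laplacian_bumps n c b x :
  laplacian (bumps n c b) x = c * \sum_(k < n) bump_lap (b k) x.
Proof.
have p1 i : partial i (bumps n c b) =
    fun x => c * \sum_(k < n) (- (2 * b k * coord i x) * flat 1 (1 - b k * sqnorm x)).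
  apply/funext => z; apply: (@derive_val _ _ _ _ _ _ _ _).
  by apply: is_derive_csum => k; exact: is_derive_flat_sqnorm.
have p2 i z : partial i (partial i (bumps n c b)) z = c * \sum_(k < n)
    (4 * (b k) ^+ 2 * coord i z ^+ 2 * flat 2 (1 - b k * sqnorm z) - 2 * b k * flat 1 (1 - b k * sqnorm z)).
  rewrite p1; apply: (@derive_val _ _ _ _ _ _ _ _).
  apply: is_derive_csum => k.
  have := is_deriveM (is_deriveZ (- (2 * b k)) (is_derive_coord i i z)) (is_derive_flat_sqnorm i 1 (b k) z).
  rewrite (_ : _ * _ = fun x => - (2 * b k * coord i x) * flat 1 (1 - b k * sqnorm x)); last first.
    apply/funext => y; transitivity (- (2 * b k) * coord i y * flat 1 (1 - b k * sqnorm y)) => //.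
    by rewrite mulNr.
  move=> K; apply: (is_derive_eq K); rewrite eqxx -![_ *: _]/(_ * _) /=.
  move: (flat _ _) (flat _ _) (coord i z) => p q t.
  by rewrite -[_ *: t]/(_ * _); ring.
rewrite /laplacian; under eq_bigr do rewrite p2.
rewrite -mulr_sumr exchange_big/=; congr (_ * _); apply: eq_bigr => k _.
rewrite big_split/= /bump_lap -mulr_suml -mulr_sumr -/(sqnorm x) sumr_const card_ord -mulr_natl.
by move: (sqnorm x) (flat _ _) (flat _ _) => t p q; ring.
Qed.

(** On the support b |x|^2 <= 1, so both terms of the Laplacian are O(b). *)
Lemma bump_lap_le : exists2 C : R, 0 <= C & forall b x, 0 <= b ->
  `|bump_lap b x| <= C * (b * (b * sqnorm x < 1)%R%:R).
Proof.
have [C1 C10 H1] := @flat_bound R 1; have [C2 C20 H2] := @flat_bound R 2.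
exists (4 * C2 + 8 * C1); first lra.
move=> b x b0; have q0 := sqnorm_ge0 x; have bq0 := mulr_ge0 b0 q0.
have [bq|bq] := ltP (b * sqnorm x) 1; last first.
  by rewrite /bump_lap !flat_le0 ?mulr0 ?subrr ?normr0//; lra.
rewrite mulr1 /bump_lap.
set s := 1 - b * sqnorm x; have s1 : s <= 1 by rewrite /s; lra.
have s2 : s ^+ 2 <= 1 by rewrite expr_le1// /s; lra.
have h1 : `|flat 1 s| <= C1.
  by apply: (le_trans (H1 _ s1)); rewrite -[leRHS]mulr1 ler_wpM2l.
have h2 : `|flat 2 s| <= C2.
  by apply: (le_trans (H2 _ s1)); rewrite -[leRHS]mulr1 ler_wpM2l.
apply: (le_trans (ler_normB _ _)); 
rewrite (normrM _ (flat 2 s)) (normrM _ (flat 1 s)).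
rewrite (ger0_norm (_ : 0 <= 4 * b ^+ 2 * sqnorm x)); last by rewrite !mulr_ge0.
rewrite (ger0_norm (_ : 0 <= 8 * b)); last by rewrite mulr_ge0.
have k1 : b ^+ 2 * sqnorm x * `|flat 2 s| <= b * C2.
  have : b * (b * sqnorm x) <= b * 1 by apply: ler_wpM2l => //; exact: ltW.
  rewrite mulr1 mulrA -expr2 => h.
  by apply: ler_pM => //; rewrite mulr_ge0// sqr_ge0.
have k2 : b * `|flat 1 s| <= b * C1 by exact: ler_wpM2l.
lra.
Qed.

(** The cross terms are summable because the weights decay geometrically; the
    first bound is needed for the induction, in which the sum is shifted by
    one index. *)
Lemma quarter_sum_sqr_le (chi : nat -> bool) n :
  \sum_(k < n) 4 ^- k * (chi k)%:R <= 4 / 3 :> R /\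
  (\sum_(k < n) 4 ^- k * (chi k)%:R) ^+ 2 <= 2 * \sum_(k < n) 16 ^- k * (chi k)%:R :> R.
Proof.
elim: n chi => [|n IH] chi.
  by rewrite !big_ord0 expr0n mulr0; split => //; lra.
have [h1 h2] := IH (fun k => chi k.+1).
rewrite !big_ord_recl /= !expr0 !invr1 !mul1r.
have e c : \sum_(i < n) c ^- (bump 0 i) * (chi (bump 0 i))%:R =
    c^-1 * \sum_(i < n) c ^- i * (chi i.+1)%:R :> R.
  rewrite mulr_sumr; apply: eq_bigr => i _.
  by rewrite /bump /= add1n exprS invfM mulrA.
rewrite !e.
have s0 : 0 <= \sum_(i < n) 4 ^- i * (chi i.+1)%:R :> R.
  by apply: sumr_ge0 => i _; rewrite mulr_ge0 ?ler0n// invr_ge0 exprn_ge0.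
have q0 : 0 <= \sum_(i < n) 16 ^- i * (chi i.+1)%:R :> R.
  by apply: sumr_ge0 => i _; rewrite mulr_ge0 ?ler0n// invr_ge0 exprn_ge0.
move: (\sum_(i < n) 4 ^- i * _) (\sum_(i < n) 16 ^- i * _) h1 h2 s0 q0 => S Q h1 h2 s0 q0.
by case: (chi 0) => /=; split; nra.
Qed.

End log_test_functions.

Section log_bump.
Context {R : realType}.
Local Notation X4 := (R4 (measurableTypeR R)).
Implicit Types (x : R4 R) (a r : R).

Lemma compact_of_closed_norm_le (A : set (R4 R)) r :
  closed A -> (forall x, A x -> `|x| <= r) -> compact A.
Proof.
move=> cA Ar; pose I : set R := `[- r, r]%classic.
have cI : compact I by exact: segment_compact.
have cB := compact_setX (compact_setX (compact_setX cI cI) cI) cI.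
apply: (subclosed_compact cA cB) => x /Ar xr.
have h i : I (coord i x).
  by rewrite /I /= in_itv/= -ler_norml (le_trans (coord_le_norm i x)).
have h0 := h (@Ordinal 4 0 isT); have h1 := h (@Ordinal 4 1 isT).
by have h2 := h (@Ordinal 4 2 isT); have h3 := h (@Ordinal 4 3 isT).
Qed.

(** The mean of one bump dilated to the radii a, 2 a, 4 a and so on: a smooth
    substitute for a truncated logarithm. *)
Definition log_bump a n : R4 R -> R :=
  bumps n n%:R^-1 (fun k => (4 ^+ k * a ^+ 2)^-1).

Lemma smooth_log_bump a n : smooth (log_bump a n).
Proof.
apply: bumpalg_smooth; apply: ba_mul; first exact: ba_cst.
by apply: (@bumpalg_sum _ (fun k x => flat 0 (1 - (4 ^+ k * a ^+ 2)^-1 * sqnorm x))) => k; exact: ba_flat.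
Qed.

Lemma log_bump_supp a n x : 0 < a -> log_bump a n.+1 x != 0 -> sqnorm x <= 4 ^+ n * a ^+ 2.
Proof.
move=> a0 /eqP ux; rewrite leNgt; apply/negP => qx; apply: ux.
rewrite /log_bump /bumps big1 ?mulr0// => k _; apply: flat_le0.
have ka : 0 < 4 ^+ k * a ^+ 2 by rewrite mulr_gt0// exprn_gt0.
have : 1 <= (4 ^+ k * a ^+ 2)^-1 * sqnorm x.
  rewrite mulrC ler_pdivlMr// mul1r (le_trans _ (ltW qx))//.
  apply: ler_wpM2r; first exact: sqr_ge0.
  by rewrite ler_weXn2l ?ler1n// -ltnS.
by move: (_ * sqnorm x) => z; lra.
Qed.

Lemma log_bump_ge a n x : 0 < a -> sqnorm x < (a / 2) ^+ 2 ->
  expR (- (4 / 3)) <= log_bump a n.+1 x.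
Proof.
move=> a0 qx; rewrite /log_bump /bumps.
have -> : expR (- (4 / 3)) = n.+1%:R^-1 * \sum_(k < n.+1) expR (- (4 / 3)) :> R.
  by rewrite sumr_const card_ord -(mulr_natl (expR _)) mulrA mulVf ?mul1r// pnatr_eq0.
apply: ler_wpM2l; first by rewrite invr_ge0 ler0n.
apply: ler_sum => k _.
have ka : a ^+ 2 <= 4 ^+ k * a ^+ 2.
  by rewrite ler_peMl ?sqr_ge0// exprn_ege1// ler1n.
have a2 : 0 < a ^+ 2 by rewrite exprn_gt0.
have h : (4 ^+ k * a ^+ 2)^-1 * sqnorm x <= 1 / 4.
  rewrite mulrC ler_pdivrMr; last exact: lt_le_trans ka.
  by move: (4 ^+ k * _) ka => z ka; move: qx; rewrite expr_div_n => qx; lra.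
rewrite /flat; move: (_ * sqnorm x) h => z h.
have s0 : 0 < 1 - z by lra.
rewrite s0 /= hornerC mul1r ler_expR lerN2 -[X in X <= _]div1r ler_pdivrMr//; lra.
Qed.

Lemma test_function_log_bump a n (Om : set (R4 R)) : 0 < a ->
  (forall x, sqnorm x <= 4 ^+ n * a ^+ 2 -> Om x) -> test_function Om (log_bump a n.+1).
Proof.
move=> a0 qO; set B := [set x | sqnorm x <= 4 ^+ n * a ^+ 2].
have cB : closed B.
  by apply: (@closed_comp _ _ sqnorm [set z | z <= _]); [move=> x _; exact: continuous_sqnorm|exact: closed_le].
have sB : closure [set x | log_bump a n.+1 x != 0] `<=` B.
  by apply: closure_sub_closed => // x; exact: log_bump_supp.
split; first exact: smooth_log_bump.
  apply: (@subclosed_compact _ _ B) => //; first exact: closed_closure.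
  apply: (@compact_of_closed_norm_le _ (Num.sqrt (4 ^+ n * a ^+ 2))) => // x xB.
  rewrite -[leLHS]normr_id -sqrtr_sqr ler_sqrt; last by rewrite mulr_ge0 ?exprn_ge0// ltW.
  exact: le_trans (sqr_norm_le_sqnorm x) xB.
by move=> x /sB; exact: qO.
Qed.

(** The k-th Laplacian is of order (2^k a)^-2 on a ball of radius 2^k a,
    hence its energy does not depend on k. By [quarter_sum_sqr_le] the square
    of the sum is comparable with the sum of the squares, so that the energy
    of the mean is O(n / n^2). *)
Lemma log_bump_energy : exists2 C : R, 0 <= C &
  forall (Om : set (R4 R)) a n, open Om -> 0 < a ->
    (sq_int Om (laplacian (log_bump a n.+1)) <= (C / n.+1%:R)%:E)%E.
Proof.
have [C C0 HC] := @bump_lap_le R.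
exists (2 ^+ 5 * C ^+ 2); first by rewrite mulr_ge0 ?sqr_ge0.
move=> Om a n oOm a0; set u := log_bump a n.+1.
pose b k : R := (4 ^+ k * a ^+ 2)^-1.
have b0 k : 0 < b k by rewrite invr_gt0 mulr_gt0// exprn_gt0.
pose m : R := n.+1%:R; have m0 : 0 < m by rewrite ltr0n.
pose d k : R := m^-1 ^+ 2 * C ^+ 2 * a ^- 4 * 2 * 16 ^- k.
have d0 k : 0 <= d k by rewrite !mulr_ge0 ?sqr_ge0// ?invr_ge0 ?exprn_ge0 ?sqr_ge0// ltW.
have bnd x : laplacian u x ^+ 2 <= \sum_(k < n.+1) d k * (b k * sqnorm x < 1)%R%:R.
  pose chi k := (b k * sqnorm x < 1)%R.
  have h1 : `|laplacian u x| <= m^-1 * (C * (a ^- 2 * \sum_(k < n.+1) 4 ^- k * (chi k)%:R)).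
    rewrite laplacian_bumps -/m normrM ger0_norm ?invr_ge0 ?(ltW m0)//.
    apply: ler_wpM2l; first by rewrite invr_ge0 ltW.
    apply: (le_trans (ler_norm_sum _ _ _)); rewrite !mulr_sumr; apply: ler_sum => k _.
    apply: (le_trans (HC _ _ (ltW (b0 k)))); rewrite /chi; move: (_ < _)%R => e.
    apply: ler_wpM2l => //.
    by rewrite /b invfM [X in X * _]mulrC -mulrA.
  have [_ h2] := quarter_sum_sqr_le (R := R) chi n.+1.
  rewrite -real_normK ?num_real//.
  apply: (@le_trans _ _ ((m^-1 * (C * (a ^- 2 * \sum_(k < n.+1) 4 ^- k * (chi k)%:R))) ^+ 2)).
    by apply: lerXn2r; rewrite ?nnegrE// (le_trans _ h1).
  have -> : \sum_(k < n.+1) d k * (chi k)%:R =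
      m^-1 ^+ 2 * C ^+ 2 * a ^- 4 * (2 * \sum_(k < n.+1) 16 ^- k * (chi k)%:R).
    by rewrite !mulr_sumr; apply: eq_bigr => k _; rewrite /d !mulrA.
  move: (\sum_(k < _) _) (\sum_(k < _) _) h2 => T S h2.
  have -> : (m^-1 * (C * (a ^- 2 * S))) ^+ 2 = m^-1 ^+ 2 * C ^+ 2 * a ^- 4 * S ^+ 2.
    by field; rewrite !gt_eqF.
  apply: ler_wpM2l => //.
  by rewrite mulr_ge0 ?invr_ge0 ?exprn_ge0 ?(ltW a0)// mulr_ge0 ?sqr_ge0.
have mOmB := open_measurable4 oOm.
pose F k (x : X4) : \bar R := ((d k)%:E * (\1_(ball (0 : R4 R) (2 ^+ k * a) : set X4) x)%:E)%E.
have mF k : measurable_fun setT (F k) by exact: measurable_cst_ball.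
have F0 k x : (0 <= F k x)%E by rewrite /F mule_ge0// lee_fin.
have mlap : measurable_fun setT (fun x : X4 => (laplacian u x ^+ 2)%:E).
  apply/measurable_EFinP; apply: measurable_funX; apply: continuous_measurable4.
  by apply: continuous_laplacian; exact: smooth_log_bump.
have sq0 x : (0 <= (laplacian u x ^+ 2)%:E)%E by rewrite lee_fin sqr_ge0.
have mS : measurable_fun setT (fun x : X4 => \sum_(k < n.+1) F k x)%E.
  by apply: emeasurable_fun_sum => k _; exact: mF.
rewrite /sq_int (ge0_integral_leb4 mOmB); [|exact: measurable_funTS|by move=> x _; exact: sq0].
apply: (@le_trans _ _ (\int[mu4]_x (laplacian u (x : X4) ^+ 2)%:E)%E).
  exact: ge0_subset_integral.
apply: (@le_trans _ _ (\int[mu4]_x (\sum_(k < n.+1) F k x))%E).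
  apply: ge0_le_integral.
  - exact: measurableT.
  - by move=> x _; exact: sq0.
  - exact: mlap.
  - exact: mS.
  move=> x _; apply: (@le_trans _ _ (\sum_(k < n.+1) (d k * (b k * sqnorm x < 1)%R%:R)%:E)%E).
    by rewrite sumEFin lee_fin; exact: bnd.
  apply: lee_sum => k _; rewrite EFinM; apply: lee_wpmul2l; first by rewrite lee_fin.
  have [h|_] := ltP (b k * sqnorm x) 1; last by rewrite lee_fin indicE.
  rewrite indic_ball//.
  rewrite subr0 -(ltr_pXn2r (n := 2))// ?nnegrE//; last by rewrite mulr_ge0 ?exprn_ge0// ltW.
  apply: (le_lt_trans (sqr_norm_le_sqnorm x)).
  move: h; rewrite /b mulrC ltr_pdivrMr ?mul1r; last by rewrite mulr_gt0// exprn_gt0.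
  by rewrite exprMn -exprM mulnC exprM (_ : 2 ^+ 2 = 4 :> R)//; ring.
rewrite (@ge0_integral_sum _ _ _ mu4 _ measurableT _ _ (fun k : 'I_n.+1 => mF k)
    (fun k x _ => F0 k x)).
apply: (@le_trans _ _ (\sum_(k < n.+1) (2 ^+ 5 * C ^+ 2 * m^-1 ^+ 2)%:E)%E).
  apply: lee_sum => k _; rewrite integral_cst_ball//; last by rewrite mulr_ge0 ?exprn_ge0// ltW.
  rewrite lee_fin le_eqVlt; apply/orP; left; apply/eqP; rewrite /d.
  have -> : (2 ^+ k * a *+ 2) ^+ 4 = 16 ^+ k * (16 * a ^+ 4).
    rewrite -mulr_natl !exprMn -exprM mulnC exprM.
    have -> : 2 ^+ 4 = 16 :> R by ring.
    by ring.
  have k16 : 16 ^+ k != 0 :> R by rewrite expf_neq0.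
  have am : a != 0 by rewrite gt_eqF.
  have mm : m != 0 by rewrite gt_eqF.
  move: (16 ^+ k) k16 m mm {m0 d d0 bnd F mF F0 mS} => z z0 m mm; field.
  by rewrite z0 am mm.
rewrite sumEFin lee_fin sumr_const card_ord -mulr_natl -/m.
by rewrite le_eqVlt; apply/orP; left; apply/eqP; field; rewrite gt_eqF.
Qed.

End log_bump.

(** * Admissible radially decreasing weights are in M log L *)

Section necessity.
Context {R : realType}.
Local Notation X4 := (R4 (measurableTypeR R)).
Local Notation leb := (@lebesgue_measure R).
Implicit Types (x : R4 R) (Om : set (R4 R)) (g : R4 R -> \bar R) (a r rho : R).

Definition eball rho : set (R4 R) := [set x | enorm x < rho].

Lemma enorm_lt x rho : 0 <= rho -> (enorm x < rho) = (sqnorm x < rho ^+ 2).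
Proof.
by move=> r0; rewrite -[in RHS](sqr_sqrtr (sqnorm_ge0 x)) enormE ltr_pXn2r// nnegrE sqrtr_ge0.
Qed.

Lemma open_eball rho : open (eball rho).
Proof.
have [r0|r0] := leP 0 rho; last first.
  rewrite (_ : eball rho = set0); first exact: open0.
  apply/seteqP; split=> x //=; rewrite /eball /= enormE => h.
  by have := le_lt_trans (sqrtr_ge0 _) (lt_trans h r0); rewrite ltxx.
rewrite (_ : eball rho = sqnorm @^-1` [set y | y < rho ^+ 2]).
  by apply: open_comp; [move=> x _; exact: continuous_sqnorm|exact: open_lt].
by apply/seteqP; split=> x /=; rewrite /eball /= enorm_lt.
Qed.

Lemma measure_eball rho : 0 <= rho -> exists b : R,
  leb4 R (eball rho) = b%:E /\ rho ^+ 4 <= b <= (2 * rho) ^+ 4.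
Proof.
move=> r0; have mE := open_measurable4 (@open_eball rho).
have rh : 0 <= rho / 2 by rewrite divr_ge0.
have h1 : ((((rho / 2) *+ 2) ^+ 4)%:E <= mu4 (eball rho : set X4))%E.
  rewrite -(mu4_ball 0 rh); apply: le_measure; rewrite ?inE//; first exact: measurable_ball4.
  move=> x; rewrite -ball_normE /= sub0r normrN => xr.
  rewrite /eball /= enorm_lt//; apply: (le_lt_trans (sqnorm_le_sqr_norm x)).
  have := normr_ge0 x; nra.
have h2 : (mu4 (eball rho : set X4) <= ((rho *+ 2) ^+ 4)%:E)%E.
  rewrite -(mu4_ball 0 r0); apply: le_measure; rewrite ?inE//; first exact: measurable_ball4.
  move=> x; rewrite /eball /= enorm_lt// => xr.
  rewrite -ball_normE /= sub0r normrN -(ltr_pXn2r (n := 2))// ?nnegrE//.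
  exact: le_lt_trans (sqr_norm_le_sqnorm x) xr.
rewrite leb4E//; move: (mu4 _) h1 h2 => [b| |//] h1 h2; last by [].
exists b; split => //; move: h1 h2; rewrite !lee_fin.
have -> : (rho / 2) *+ 2 = rho by field.
by rewrite -(mulr_natl rho) => -> ->.
Qed.

(** The constant sequence is an approximation. *)
Lemma D220_test_function Om f : measurable (Om : set X4) ->
  test_function Om f -> D220 Om f (laplacian f).
Proof.
move=> mOm tf; have [sf _ _] := tf.
have z0 : sq_int Om (fun x => f x - f x) = 0%E.
  by rewrite /sq_int; apply: integral0_eq => x _; rewrite subrr expr0n.
have z1 : sq_int Om (fun x => laplacian f x - laplacian f x) = 0%E.
  by rewrite /sq_int; apply: integral0_eq => x _; rewrite subrr expr0n.
split.
- apply: measurable_fun_R4L => //; apply: measurable_funTS.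
  by apply: continuous_measurable4; exact: smooth_continuous.
- apply: measurable_fun_R4L => //; apply: measurable_funTS.
  by apply: continuous_measurable4; exact: continuous_laplacian.
exists (fun=> f); split => //.
- by rewrite z0; exact: cvg_cst.
- by rewrite z1; exact: cvg_cst.
Qed.

(** The function tested is the mean of n + 1 bumps of which the largest has
    radius r / 2 and the smallest radius a = r / 2^(n+1); it is at least
    [expR (- (4 / 3))] on the ball of radius a / 2. *)
Lemma admissible_mass r g : 0 < r -> lebesgue_measurable_fun (eball r) g ->
  (forall x, eball r x -> (0 <= g x)%E) -> admissible (eball r) g ->
  exists2 K : R, 0 <= K & forall n,
   (\int[leb4 R]_(x in (eball (r / 2 ^+ n.+2) : set (R4L R))) g x <= (K / n.+1%:R)%:E)%E.
Proof.
move=> r0 mg g0 [C C0 HC]; have [E E0 HE] := @log_bump_energy R.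
pose c : R := expR (- (4 / 3)).
have c0 : 0 < c by exact: expR_gt0.
have c2 : 0 < c ^+ 2 by rewrite exprn_gt0.
exists (C * E / c ^+ 2); first by apply: divr_ge0; [apply: mulr_ge0 => //|]; exact: ltW.
move=> n; pose a := r / 2 ^+ n.+1; have a0 : 0 < a by rewrite divr_gt0// exprn_gt0.
have aE : r / 2 ^+ n.+2 = a / 2.
  by rewrite /a exprSr; field; rewrite expf_neq0.
have a2 : 0 <= a / 2 by rewrite divr_ge0// ltW.
have aO : eball (a / 2) `<=` eball r.
  move=> x; rewrite /eball /= => h; apply: (lt_le_trans h).
  rewrite -aE ler_pdivrMr ?exprn_gt0// ler_peMr ?(ltW r0)// exprn_ege1//; lra.
rewrite aE; set B := eball (a / 2).
have mOB := open_measurable4 (@open_eball r); have mBB := open_measurable4 (@open_eball (a / 2)).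
have mO : measurable (eball r : set (R4L R)) by exact: measurable_R4L.
have mB : measurable (B : set (R4L R)) by exact: measurable_R4L.
have tu : test_function (eball r) (log_bump a n.+1).
  apply: test_function_log_bump => // x qx; rewrite /eball /= enorm_lt ?ltW//.
  apply: (le_lt_trans qx).
  have -> : 4 ^+ n * a ^+ 2 = r ^+ 2 / 4.
    have -> : 4 ^+ n = (2 ^+ n) ^+ 2 :> R.
      by rewrite -exprM mulnC exprM (_ : 2 ^+ 2 = 4 :> R)//; ring.
    by rewrite /a [2 ^+ n.+1]exprS; field; rewrite expf_neq0.
  have : 0 < r ^+ 2 by rewrite exprn_gt0.
  by move: (r ^+ 2) => z; lra.
set u := log_bump a n.+1 in tu.
have Hu := HC _ _ (D220_test_function mOB tu).
have cu : continuous u by apply: smooth_continuous; case: tu.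
have mu2 : @measurable_fun _ _ (R4L R) _ (eball r) (fun x => (u x ^+ 2)%:E).
  apply: measurable_fun_R4L => //; apply/measurable_EFinP; apply: measurable_funX.
  by apply: measurable_funTS; exact: continuous_measurable4.
have mgB : @measurable_fun _ _ (R4L R) _ B g by exact: measurable_funS mO aO mg.
have mgu : @measurable_fun _ _ (R4L R) _ (eball r) (fun x => g x * (u x ^+ 2)%:E)%E.
  exact: emeasurable_funM mg mu2.
have gu0 x : eball r x -> (0 <= g x * (u x ^+ 2)%:E)%E.
  by move=> Ox; apply: mule_ge0; [exact: g0|rewrite lee_fin sqr_ge0].
have gB0 x : B x -> (0 <= g x)%E by move=> /aO; exact: g0.
have c20 : (0 <= (c ^+ 2)%:E)%E by rewrite lee_fin ltW.
have h1 : ((c ^+ 2)%:E * \int[leb4 R]_(x in (B : set (R4L R))) g x <= (C * E / n.+1%:R)%:E)%E.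
  rewrite -(@ge0_integralZl _ (R4L R) R (leb4 R) B mB _ mgB (c ^+ 2)%:E gB0 c20).
  apply: (@le_trans _ _ (\int[leb4 R]_(x in (B : set (R4L R))) (g x * (u x ^+ 2)%:E))%E).
    apply: ge0_le_integral.
    - exact: mB.
    - by move=> x Bx; apply: mule_ge0; [exact: c20|exact: gB0].
    - exact: emeasurable_funM (measurable_cst _) mgB.
    - exact: measurable_funS mO aO mgu.
    move=> x Bx; rewrite muleC; apply: lee_wpmul2l; first exact: gB0.
    rewrite lee_fin; have : c <= u x.
      by apply: log_bump_ge => //; rewrite -enorm_lt.
    move=> cx; apply: lerXn2r => //; rewrite nnegrE ?ltW//; exact: lt_le_trans cx.
  apply: (@le_trans _ _ (\int[leb4 R]_(x in (eball r : set (R4L R))) (g x * (u x ^+ 2)%:E))%E).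
    by apply: ge0_subset_integral.
  apply: (le_trans Hu); rewrite -mulrA EFinM; apply: lee_wpmul2l.
    by rewrite lee_fin ltW.
  by apply: HE => //; exact: (@open_eball _).
have -> : C * E / c ^+ 2 / n.+1%:R = C * E / n.+1%:R / c ^+ 2 by rewrite mulrAC.
by rewrite [leRHS]EFinM lee_pdivlMr// muleC.
Qed.

Lemma eball_nested r rho g s : rho <= r -> radial_decreasing (eball r) g ->
  eball rho `<=` [set x | (s%:E < g x)%E] \/
  eball r `&` [set x | (s%:E < g x)%E] `<=` eball rho.
Proof.
move=> rr [_ gdec].
have [h|/existsNP[y /not_implyP[yB /negP]]] := pselect (eball rho `<=` [set x | (s%:E < g x)%E]).
  by left.
rewrite -leNgt => gy; right=> x [Ox /= sx].
rewrite /eball /= ltNge; apply/negP => xr.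
have Oy : eball r y by exact: lt_le_trans yB rr.
have := gdec _ _ Oy Ox (ltW (lt_le_trans yB xr)) => gxy.
by have := lt_le_trans sx (le_trans gxy gy); rewrite ltxx.
Qed.

(** If g were infinite at some x <> 0, it would be infinite on the ball of
    radius |x|, whose smaller concentric balls would then have infinite mass. *)
Lemma fin_num_of_mass r g (K : R) : 0 < r -> radial_decreasing (eball r) g ->
  (forall x, eball r x -> (0 <= g x)%E) ->
  (forall n, (\int[leb4 R]_(x in (eball (r / 2 ^+ n.+2) : set (R4L R))) g x <= K%:E)%E) ->
  {ae leb4 R, forall x, eball r x -> g x \is a fin_num}.
Proof.
move=> r0 [_ gdec] g0 HK; have [m0 z0] := mu4_set1 (0 : R4 R).
exists [set (0 : R4 R)]; split.
- exact: measurable_R4L.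
- by rewrite leb4E.
move=> x /= /not_implyP[Ox gx]; apply: contrapT => /eqP xn0; apply: gx.
rewrite ge0_fin_numE ?g0//; apply: contrapT => /negP; rewrite -leNgt leye_eq => /eqP goo.
have ex : 0 < enorm x.
  rewrite enormE sqrtr_gt0; apply: lt_le_trans (sqr_norm_le_sqnorm x).
  by rewrite exprn_gt0// normr_gt0.
pose n := Num.trunc (r / enorm x).
have rn : r / 2 ^+ n.+2 <= enorm x.
  have /andP[_] := truncn_itv (ltW (divr_gt0 r0 ex)); rewrite -/n => h.
  rewrite ler_pdivrMr ?exprn_gt0// mulrC -ler_pdivrMr//; apply: (le_trans (ltW h)).
  by rewrite -natrX ler_nat (leq_trans (leqnSn _))// ltnW// ltn_expl.
have rnr : r / 2 ^+ n.+2 <= r.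
  rewrite ler_pdivrMr ?exprn_gt0// ler_peMr ?(ltW r0)// exprn_ege1//; lra.
have rn0 : 0 < r / 2 ^+ n.+2 by rewrite divr_gt0// exprn_gt0.
have [b [bE /andP[b1 _]]] := measure_eball (ltW rn0).
have b0 : 0 < b by apply: lt_le_trans b1; rewrite exprn_gt0.
have := HK n.
rewrite (@eq_integral _ (R4L R) R (leb4 R) _ (cst +oo%E)); last first.
  move=> y /set_mem yB; apply/eqP; rewrite -leye_eq -goo; apply: gdec => //.
    exact: lt_le_trans yB rnr.
  exact: ltW (lt_le_trans yB rn).
rewrite integral_cst/=; last by apply: measurable_R4L; exact: open_measurable4 (@open_eball _).
by rewrite bE gt0_mulye.
Qed.

Lemma ln2_le1 : ln 2 <= 1 :> R.
Proof. have := @le_ln1Dx R 1; rewrite (_ : 1 + 1 = 2 :> R)//; apply; lra. Qed.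

(** The balls of [admissible_mass] have measures b n comparable with 2^(-4
    n). For t between b k.+1 and b k the logarithm of M / t is O(k + 1) and
    the integral of the rearrangement is at most K / (k + 1); for t above b 0
    both are bounded. *)
Lemma MlogL_of_admissible r g : 0 < r -> lebesgue_measurable_fun (eball r) g ->
  (forall x, eball r x -> (0 <= g x)%E) -> radial_decreasing (eball r) g ->
  admissible (eball r) g -> MlogL (eball r) g.
Proof.
move=> r0 mg g0 rad adm; have [K K0 HK] := admissible_mass r0 mg g0 adm.
have KnK n : K / n.+1%:R <= K.
  by rewrite ler_pdivrMr ?ltr0n// ler_peMr// ler1n.
have mO : measurable (eball r : set (R4L R)).
  by apply: measurable_R4L; exact: open_measurable4 (@open_eball _).
split=> //.
  apply: (fin_num_of_mass (K := K)) => // n.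
  by apply: (le_trans (HK n)); rewrite lee_fin.
have [M [ME /andP[M1 M2]]] := measure_eball (ltW r0).
have M0 : 0 < M by apply: lt_le_trans M1; rewrite exprn_gt0.
pose rho n := r / 2 ^+ n.+2.
have rho0 n : 0 < rho n by rewrite divr_gt0// exprn_gt0.
have rhor n : rho n <= r.
  rewrite ler_pdivrMr ?exprn_gt0// ler_peMr ?(ltW r0)// exprn_ege1//; lra.
have /choice[b Hb] : forall n, exists b : R, leb4 R (eball (rho n)) = b%:E /\
    rho n ^+ 4 <= b <= (2 * rho n) ^+ 4.
  by move=> n; apply: measure_eball; exact: ltW.
have b0 n : 0 < b n.
  by have [_ /andP[h _]] := Hb n; apply: lt_le_trans h; rewrite exprn_gt0.
have Gb n : (int_rearr (eball r) g (b n) <= (K / n.+1%:R)%:E)%E.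
  apply: le_trans (HK n); apply: rearr_le_integral => //.
  - by apply: measurable_R4L; exact: open_measurable4 (@open_eball _).
  - by move=> x h; exact: lt_le_trans h (rhor n).
  - exact: ltW.
  - by case: (Hb n).
  - by move=> s _; exact: eball_nested (rhor n) rad.
have b0M : b 0 <= M.
  rewrite -lee_fin -ME; have [<- _] := Hb 0%N; apply: le_measure; rewrite ?inE//.
    by apply: measurable_R4L; exact: open_measurable4 (@open_eball _).
  by move=> x h; exact: lt_le_trans h (rhor 0%N).
have L0 : 0 <= ln (M / b 0) by rewrite ln_ge0// ler_pdivlMr// mul1r.
pose K1 := ln (M / b 0) * (M / b 0 * K).
have K10 : 0 <= K1.
  by rewrite /K1 mulr_ge0// mulr_ge0// divr_ge0// ltW.
have key t : 0 < t < M -> ((ln (M / t))%:E * int_rearr (eball r) g t <= (K1 + 16 * K)%:E)%E.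
  move=> /andP[t0 tM].
  have G0 s : (0 <= int_rearr (eball r) g s)%E by exact: int_rearr_ge0.
  have Lt : 0 <= ln (M / t) by rewrite ln_ge0// ler_pdivlMr// mul1r ltW.
  have [bt|tb] := leP (b 0) t.
    apply: (@le_trans _ _ (ln (M / b 0) * (M / b 0 * K))%:E); last first.
      by rewrite lee_fin lerDl mulr_ge0.
    rewrite [leRHS]EFinM; apply: lee_pmul => //.
      rewrite lee_fin ler_ln ?posrE ?divr_gt0// ler_pM2l// lef_pV2// posrE//.
    apply: (le_trans (int_rearr_ratio _ _ (b0 0%N) bt)).
    rewrite [leRHS]EFinM; apply: lee_pmul => //.
    - by rewrite lee_fin divr_ge0 ?ltW.
    - by rewrite lee_fin ler_pM2r ?invr_gt0// ltW.
    - by apply: (le_trans (Gb 0%N)); rewrite lee_fin.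
  have ex : exists n, b n <= t.
    (* The n-th ball has measure at most (r / 2^(n+1))^4 <= r^4 / (n + 1). *)
    exists (Num.trunc (r ^+ 4 / t)); set n := Num.trunc _.
    have [_ /andP[_ h]] := Hb n; apply: (le_trans h).
    have r40 : 0 < r ^+ 4 by rewrite exprn_gt0.
    have /andP[_] := truncn_itv (ltW (divr_gt0 r40 t0)); rewrite -/n => hn.
    have -> : 2 * rho n = r / 2 ^+ n.+1.
      by rewrite /rho [in LHS]exprS; field; rewrite expf_neq0.
    rewrite expr_div_n ler_pdivrMr ?exprn_gt0// mulrC -ler_pdivrMr//; apply: (le_trans (ltW hn)).
    rewrite -!natrX ler_nat (leq_trans (ltnW (ltn_expl n.+1 (ltnSn 1))))//.
    by rewrite -expnM leq_exp2l// leq_pmulr.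
  case: (ex_minnP ex) => -[|k] bk mink; first by rewrite leNgt tb in bk.
  have tbk : t <= b k.
    by rewrite leNgt; apply/negP => /ltW /mink; rewrite ltnn.
  have Gt : (int_rearr (eball r) g t <= (K / k.+1%:R)%:E)%E.
    apply: le_trans (Gb k); rewrite /int_rearr; apply: ge0_subset_integral => //.
    - by apply: measurable_funTS; exact: (@measurable_rearr R (eball r) g).
    - by move=> s _; exact: rearr_ge0.
    - by move=> s; rewrite /= !in_itv/= => /andP[-> h]; exact: lt_le_trans h tbk.
  have Lk : ln (M / t) <= 16 * k.+1%:R.
    have h : M / t <= 2 ^+ (4 * k.+4).
      rewrite ler_pdivrMr//; apply: (le_trans M2).
      apply: (@le_trans _ _ (2 ^+ (4 * k.+4) * rho k.+1 ^+ 4)); last first.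
        apply: ler_wpM2l; first by rewrite exprn_ge0.
        by apply: le_trans bk; case: (Hb k.+1) => _ /andP[].
      rewrite mulnC exprM -exprMn le_eqVlt; apply/orP; left; apply/eqP.
      congr (_ ^+ 4); rewrite /rho [in RHS]exprS; field; rewrite expf_neq0//.
    apply: (@le_trans _ _ (ln (2 ^+ (4 * k.+4)))).
      by rewrite ler_ln ?posrE ?divr_gt0// exprn_gt0.
    rewrite lnXn// -(mulr_natl (ln 2)).
    apply: (@le_trans _ _ ((4 * k.+4)%:R * 1)).
      by apply: ler_wpM2l; [exact: ler0n|exact: ln2_le1].
    rewrite mulr1 -[16]/(16%:R) -natrM ler_nat.
    rewrite -[16%N]/(4 * 4)%N -mulnA leq_mul2l/= mulnS -addn4 addnC leq_add2l.
    by rewrite leq_pmull.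
  apply: (@le_trans _ _ (16 * k.+1%:R * (K / k.+1%:R))%:E).
    by rewrite EFinM; apply: lee_pmul.
  by rewrite lee_fin -mulrA [_%:R * (K / _)]mulrCA mulfV ?pnatr_eq0// mulr1 lerDr.
apply: (@le_lt_trans _ _ (K1 + 16 * K)%:E); last exact: ltry.
apply: ub_ereal_sup => _ [t [t0 tM] <-]; rewrite ME in tM *; rewrite lte_fin in tM.
rewrite /= /rearr_avg muleA -EFinM.
rewrite (_ : t * ln (M / t) * t^-1 = ln (M / t)); first by apply: key; apply/andP.
by rewrite mulrAC mulfV ?mul1r// gt_eqF.
Qed.

End necessity.

(** * The characterisation *)

Lemma null_admissible (R : realType) (Om : set (R4 R)) (g : R4 R -> \bar R) :
  open Om -> lebesgue_measurable_fun Om g -> leb4 R Om = 0%E -> admissible Om g.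
Proof.
move=> oOm mg Om0; exists 1 => // u w [mu _ _].
apply: (@le_trans _ _ 0%E); last first.
  by rewrite mul1e; apply: integral_ge0 => x _; rewrite lee_fin sqr_ge0.
rewrite le_eqVlt; apply/orP; left; apply/eqP; apply: null_set_integral.
- by apply: measurable_R4L; exact: open_measurable4.
- apply: emeasurable_funM; first exact: mg.
  by apply/measurable_EFinP; exact: measurable_funX.
- exact: Om0.
Qed.

Theorem theorem1p4 (R : realType) (Omega : set (R4 R)) (g : R4 R -> \bar R)
    (openO : open Omega) (bndO : bounded_set Omega)
    (mg : lebesgue_measurable_fun Omega g)
    (g0 : forall x, Omega x -> (0 <= g x)%E) :
  (MlogL Omega g -> admissible Omega g) /\
  (centered_ball Omega -> radial_decreasing Omega g ->
     admissible Omega g -> MlogL Omega g).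
Proof.
split=> [Mg|[r r0 OmE]]; last first.
  by move: mg g0; rewrite OmE => mg' g0'; exact: MlogL_of_admissible.
have [r r0 Or] := bounded_set_lt bndO.
have Ole : (leb4 R Omega <= ((2 * r) ^+ 4)%:E)%E.
  rewrite mulr_natl -(mu4_ball 0 (ltW r0)) leb4E; last exact: open_measurable4.
  apply: le_measure; rewrite ?inE; [exact: open_measurable4|exact: measurable_ball4|].
  by move=> x /Or xr; rewrite -ball_normE /= sub0r normrN.
have [M ME] : exists M, leb4 R Omega = M%:E.
  exists (fine (leb4 R Omega)); rewrite fineK// ge0_fin_numE ?measure_ge0//.
  exact: le_lt_trans Ole (ltry _).
have [M0|M0] := eqVneq M 0; first by apply: null_admissible; rewrite // ME M0.
have Mgt0 : 0 < M by rewrite lt_neqAle eq_sym M0 -lee_fin -ME measure_ge0.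
apply: (admissible_of_MlogL openO mg g0 Mgt0 ME (D := 2 * r)) => //.
- by rewrite mulr_gt0.
- by rewrite -lee_fin -ME.
move=> y z /Or yr /Or zr; apply: (le_lt_trans (ler_normB _ _)).
by rewrite mulr_natl mulr2n ltrD.
Qed.
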